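(* For $a,\beta>0$ let $\Sigma=\Sigma_{a,\beta}\subset\mathbb{C}^2$ be the Joyce–Lee–Tsui surface $$\Sigma=\left\{\left(x\sqrt{\tfrac1a+y^2}\,e^{i\phi(y)},\ \frac{y^2-x^2}{2}-\frac{i}{\beta}\left[\phi(y)+\arg\left(y+iP(y)^{-\frac12}\right)\right]\right):x,y\in\mathbb{R}\right\},$$ and let $\bar\phi=\lim_{y\to\infty}\phi(y)\in(0,\frac{\pi}{2})$, where $P$ and $\phi$ are the functions defined in the context. There is a compatible complex structure $J_1$ on $\mathbb{C}^2$ such that the Kähler angle $\alpha$ of $\Sigma$ with respect to $J_1$ lies between $-\frac{\pi}{2}+\bar\phi$ and $\frac{\pi}{2}-\bar\phi$. In particular, by choosing $\bar\phi$ close to $\frac{\pi}{2}$, for any $\varepsilon>0$ there is a symplectic translating soliton $\Sigma=\Sigma_{a,\beta}$ (a Joyce–Lee–Tsui surface for some $a,\beta>0$) with respect to $J_1$ such that $\cos\alpha\ge1-\varepsilon$. Furthermore, the translating soliton $\Sigma$ has bounded second fundamental form, genus $0$, first Betti number $0$, extrinsic quadratic area growth, and $$\lim_{r\to\infty}\int_{\Sigma\cap\{r<|\mathbf{x}|<2r\}}|\mathbf{H}|^2\,d\mu>0.$$ In particular, $\int_\Sigma|\mathbf{H}|^2\,d\mu=\infty$.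
   Context: For $a,\beta>0$, $$P(t)=\frac{1}{t^2}\left[(1+at^2)e^{\beta t^2}-1\right]\ (t\ne0),\quad P(0)=a+\beta,\qquad \phi(y)=\int_0^y\frac{dt}{\left(\frac1a+t^2\right)\sqrt{P(t)}}.$$ $\phi$ is increasing, tends to $\bar\phi\in(0,\frac\pi2)$ as $y\to\infty$ and to $-\bar\phi$ as $y\to-\infty$; for fixed $\beta$ the map $a\mapsto\bar\phi$ is a bijection $(0,\infty)\to(0,\frac\pi2)$. $\arg$ takes values in $(0,\pi)$ here. $\mathbb{C}^2=\mathbb{R}^4$ via $(z_1,z_2)\leftrightarrow(\mathrm{Re}\,z_1,\mathrm{Im}\,z_1,\mathrm{Re}\,z_2,\mathrm{Im}\,z_2)$. It is known (Joyce–Lee–Tsui) that $\Sigma$ is an embedded surface diffeomorphic to $\mathbb{R}^2$, and a translating soliton with translating vector $\mathbf{T}=(0,0,\beta,0)$, meaning $\mathbf{H}=\mathbf{T}^\perp$ (normal part of $\mathbf{T}$), $\mathbf{H}$ the mean curvature vector. $\Sigma$ is oriented by the parameters $(x,y)$. A compatible complex structure is an orthogonal linear map $J$ of $\mathbb{R}^4$ with $J^2=-\mathrm{Id}$. The Kähler angle $\alpha$ with respect to $J$ is given by $\cos\alpha=\langle Je_1,e_2\rangle$ for an oriented orthonormal frame $\{e_1,e_2\}$ of $T\Sigma$; since only $\cos\alpha$ is defined, the assertion that $\alpha$ lies between $-\frac\pi2+\bar\phi$ and $\frac\pi2-\bar\phi$ means $\cos\alpha\ge\sin\bar\phi$ on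 $\Sigma$. $\Sigma$ is symplectic with respect to $J$ if $\cos\alpha>0$ on $\Sigma$. Extrinsic quadratic area growth: there is a constant $\Lambda$ (depending on $\Sigma$) with $\mathrm{Area}(\Sigma\cap B_r(0))\le\Lambda r^2$ for all $r\ge1$. $\mathbf{x}$ is the position vector and $\mu$ the area measure. The limit is allowed to be $+\infty$. *)

(* Defs.v *)
From HB Require Import structures.
From mathcomp Require Import all_boot all_order all_algebra.
From mathcomp Require Import all_classical all_reals all_analysis.
From mathcomp.multinomials Require Import freeg.

Set Implicit Arguments.
Unset Strict Implicit.
Unset Printing Implicit Defensive.

Import Order.TTheory GRing.Theory Num.Theory.
Import numFieldNormedType.Exports.

Local Open Scope classical_set_scope.
Local Open Scope ring_scope.

(* The norm of the library on ['rV[R]_n] is the sup norm, whence [enorm]. *)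
Definition dotp (R : realType) (n : nat) (u v : 'rV[R]_n) : R :=
  \sum_(i < n) u 0 i * v 0 i.

Definition enorm (R : realType) (n : nat) (u : 'rV[R]_n) : R :=
  Num.sqrt (dotp u u).

(* Linear maps act on row vectors from the right: [J v] is [v *m J]. *)
Definition compatible_complex_structure (R : realType) (J : 'M[R]_4) : Prop :=
  J *m J^T = 1%:M /\ J *m J = - 1%:M.

(* Parametrized surfaces [F : R -> R -> 'rV[R]_4], [(x, y) |-> F x y];        *)
(* coordinate 0 of ['I_2] is [x] and coordinate 1 is [y].                     *)
Definition param_map (R : realType) (F : R -> R -> 'rV[R]_4) (p : R * R) :
  'rV[R]_4 := F p.1 p.2.

Definition partial (R : realType) (F : R -> R -> 'rV[R]_4) (i : 'I_2) :
    R -> R -> 'rV[R]_4 :=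
  fun x y => if i == 0 then derive1 (fun t => F t y) x else derive1 (F x) y.

Definition smooth_param (R : realType) (F : R -> R -> 'rV[R]_4) : Prop :=
  forall s : seq 'I_2, let G := foldl (@partial R) F s in
    (forall x y, derivable (fun t => G t y) x 1 /\
                 derivable (fun t => G x t) y 1) /\
    continuous (param_map G).

(* The rows of the 2 x 4 Jacobian are the coordinate tangent vectors. *)
Definition jacobian (R : realType) (F : R -> R -> 'rV[R]_4) (x y : R) :
  'M[R]_(2, 4) := \matrix_(i < 2) partial F i x y.

Definition embedded_surface (R : realType) (F : R -> R -> 'rV[R]_4) : Prop :=
  [/\ smooth_param F,
      forall x y, row_free (jacobian F x y) &
      exists2 G : 'rV[R]_4 -> R * R,
        cancel (param_map F) G & {within range (param_map F), continuous G}].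

Definition metric (R : realType) (F : R -> R -> 'rV[R]_4) (x y : R) :
  'M[R]_2 := jacobian F x y *m (jacobian F x y)^T.

Definition normal_part (R : realType) (F : R -> R -> 'rV[R]_4) (x y : R)
    (v : 'rV[R]_4) : 'rV[R]_4 :=
  let D := jacobian F x y in v - v *m D^T *m invmx (metric F x y) *m D.

Definition second_ff (R : realType) (F : R -> R -> 'rV[R]_4) (x y : R)
    (i j : 'I_2) : 'rV[R]_4 :=
  normal_part F x y (partial (partial F j) i x y).

Definition mean_curvature (R : realType) (F : R -> R -> 'rV[R]_4) (x y : R) :
    'rV[R]_4 :=
  let ginv := invmx (metric F x y) in
  \sum_(i < 2) \sum_(j < 2) ginv i j *: second_ff F x y i j.

Definition second_ff_norm (R : realType) (F : R -> R -> 'rV[R]_4) (x y : R) :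
    R :=
  let ginv := invmx (metric F x y) in
  Num.sqrt (\sum_(i < 2) \sum_(j < 2) \sum_(k < 2) \sum_(l < 2)
    ginv i k * ginv j l * dotp (second_ff F x y i j) (second_ff F x y k l)).

Definition bounded_second_ff (R : realType) (F : R -> R -> 'rV[R]_4) : Prop :=
  exists C : R, forall x y, second_ff_norm F x y <= C.

Definition translating_soliton (R : realType) (F : R -> R -> 'rV[R]_4)
    (T : 'rV[R]_4) : Prop :=
  embedded_surface F /\
  forall x y, mean_curvature F x y = normal_part F x y T.

(* The rows [e1, e2] of [E] form an orthonormal frame of the tangent plane at *)
(* [F x y] with the orientation of the coordinate frame.                      *)
Definition oriented_frame (R : realType) (F : R -> R -> 'rV[R]_4) (x y : R)
    (E : 'M[R]_(2, 4)) : Prop :=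
  E *m E^T = 1%:M /\
  exists2 B : 'M[R]_2, 0 < \det B & E = B *m jacobian F x y.

Definition cos_kahler_angle (R : realType) (J : 'M[R]_4) (E : 'M[R]_(2, 4)) :
  R := dotp (row 0 E *m J) (row 1 E).

Definition cos_kahler_angle_ge (R : realType) (J : 'M[R]_4)
    (F : R -> R -> 'rV[R]_4) (m : R) : Prop :=
  forall x y E, oriented_frame F x y E -> m <= cos_kahler_angle J E.

Definition symplectic (R : realType) (J : 'M[R]_4) (F : R -> R -> 'rV[R]_4) :
    Prop :=
  forall x y E, oriented_frame F x y E -> 0 < cos_kahler_angle J E.

(* The integral of [f] over [A] intersected with the surface, with respect to *)
(* the area measure, pulled back by the (injective) parametrization.          *)
Definition surface_integral (R : realType) (F : R -> R -> 'rV[R]_4)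
    (f : R -> R -> R) (A : set 'rV[R]_4) : \bar R :=
  (\int[(@lebesgue_measure R \x @lebesgue_measure R)]_(p in param_map F @^-1` A)
     (f p.1 p.2 * Num.sqrt (\det (metric F p.1 p.2)))%:E)%E.

Definition area (R : realType) (F : R -> R -> 'rV[R]_4) (A : set 'rV[R]_4) :
  \bar R := surface_integral F (fun _ _ => 1) A.

Definition quadratic_area_growth (R : realType) (F : R -> R -> 'rV[R]_4) :
    Prop :=
  exists L : R, forall r : R, 1 <= r ->
    (area F [set v | (enorm v < r)%R] <= (L * r ^+ 2)%:E)%E.

Definition mean_curvature_energy (R : realType) (F : R -> R -> 'rV[R]_4)
    (A : set 'rV[R]_4) : \bar R :=
  surface_integral F (fun x y => enorm (mean_curvature F x y) ^+ 2) A.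

(* Genus of a connected orientable surface [S]: the maximal number of         *)
(* pairwise disjoint smooth simple closed curves whose union does not         *)
(* separate [S].                                                              *)
Definition simple_closed_curve (R : realType) (S : set 'rV[R]_4)
    (c : R -> 'rV[R]_4) : Prop :=
  [/\ forall n t, derivable (derive1n n c) t 1,
      forall t, derive1 c t != 0,
      forall t, c (t + 1) = c t,
      {in `[0, 1[ &, injective c} &
      range c `<=` S].

Definition nonseparating_curves (R : realType) (S : set 'rV[R]_4) (n : nat)
    (c : 'I_n -> R -> 'rV[R]_4) : Prop :=
  [/\ forall i, simple_closed_curve S (c i),
      forall i j, i != j -> range (c i) `&` range (c j) = set0 &
      connected (S `\` \bigcup_(i in [set: 'I_n]) range (c i))].

Definition has_genus (R : realType) (S : set 'rV[R]_4) (g : nat) : Prop :=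
  (exists c : 'I_g -> R -> 'rV[R]_4, nonseparating_curves S c) /\
  forall n (c : 'I_n -> R -> 'rV[R]_4), nonseparating_curves S c -> (n <= g)%N.

(* Singular homology with integer coefficients. A singular simplex is encoded *)
(* by its extension by 0 outside the standard simplex, so that Leibniz        *)
(* equality is equality of maps on the standard simplex.                      *)
Definition std_simplex (R : realType) (k : nat) : set 'rV[R]_k.+1 :=
  [set t | (forall i, 0 <= t 0 i) /\ \sum_(i < k.+1) t 0 i = 1].

Definition singular_simplex (R : realType) (S : set 'rV[R]_4) (k : nat)
    (s : 'rV[R]_k.+1 -> 'rV[R]_4) : Prop :=
  [/\ {within @std_simplex R k, continuous s},
      s @` @std_simplex R k `<=` S &
      forall t, ~ std_simplex t -> s t = 0].

Definition coface (R : realType) (k : nat) (i : 'I_k.+2) (t : 'rV[R]_k.+1) :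
  'rV[R]_k.+2 := \row_j (if unlift i j is Some l then t 0 l else 0).

Definition face (R : realType) (k : nat) (i : 'I_k.+2)
    (s : 'rV[R]_k.+2 -> 'rV[R]_4) : 'rV[R]_k.+1 -> 'rV[R]_4 :=
  patch (fun=> 0) (@std_simplex R k) (s \o coface i).

Definition formal_chain (R : realType) (k : nat) :=
  {freeg ('rV[R]_k.+1 -> 'rV[R]_4) / int}.

Definition singular_chain (R : realType) (S : set 'rV[R]_4) (k : nat)
    (c : formal_chain R k) : Prop :=
  forall s, s \in dom c -> singular_simplex S s.

Definition boundary (R : realType) (k : nat) (c : formal_chain R k.+1) :
    formal_chain R k :=
  fglift (fun s => \sum_(i < k.+2) (-1) ^+ i *: (<< face i s >> : formal_chain R k)) c.

Definition singular_1cycle (R : realType) (S : set 'rV[R]_4)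
    (z : formal_chain R 1) : Prop :=
  singular_chain S z /\ boundary z = 0.

Definition singular_1boundary (R : realType) (S : set 'rV[R]_4)
    (z : formal_chain R 1) : Prop :=
  exists2 c : formal_chain R 2, singular_chain S c & z = boundary c.

Definition independent_1cycles (R : realType) (S : set 'rV[R]_4) (n : nat)
    (z : 'I_n -> formal_chain R 1) : Prop :=
  (forall i, singular_1cycle S (z i)) /\
  forall m : 'I_n -> int,
    singular_1boundary S (\sum_(i < n) m i *: z i) -> forall i, m i = 0.

(* The rank of the first singular homology group of [S] is [b]. *)
Definition first_betti_number (R : realType) (S : set 'rV[R]_4) (b : nat) :
    Prop :=
  (exists z : 'I_b -> formal_chain R 1, independent_1cycles S z) /\
  forall n (z : 'I_n -> formal_chain R 1), independent_1cycles S z -> (n <= b)%N.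

(* Argument in [(0, pi)] of a complex number [u + i v] with [v > 0]. *)
Definition upper_arg (R : realType) (u v : R) : R :=
  acos (u / Num.sqrt (u ^+ 2 + v ^+ 2)).

Definition jlt_P (R : realType) (a b t : R) : R :=
  if t == 0 then a + b
  else ((1 + a * t ^+ 2) * expR (b * t ^+ 2) - 1) / t ^+ 2.

Definition jlt_phi_integrand (R : realType) (a b t : R) : R :=
  ((a^-1 + t ^+ 2) * Num.sqrt (jlt_P a b t))^-1.

Definition jlt_phi (R : realType) (a b y : R) : R :=
  if 0 <= y
  then \int[@lebesgue_measure R]_(t in `[0, y]) jlt_phi_integrand a b t
  else - \int[@lebesgue_measure R]_(t in `[y, 0]) jlt_phi_integrand a b t.

Definition jlt_phibar (R : realType) (a b : R) : R :=
  lim (jlt_phi a b y @[y --> +oo]).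

(* The coordinates are (Re z1, Im z1, Re z2, Im z2); [b] is beta. *)
Definition jlt_map (R : realType) (a b x y : R) : 'rV[R]_4 :=
  \row_(j < 4)
    [:: x * Num.sqrt (a^-1 + y ^+ 2) * cos (jlt_phi a b y);
        x * Num.sqrt (a^-1 + y ^+ 2) * sin (jlt_phi a b y);
        (y ^+ 2 - x ^+ 2) / 2;
        - b^-1 * (jlt_phi a b y +
                  upper_arg y (Num.sqrt (jlt_P a b y))^-1)]`_j.

Definition jlt_surface (R : realType) (a b : R) : set 'rV[R]_4 :=
  range (param_map (jlt_map a b)).

Definition jlt_vector (R : realType) (b : R) : 'rV[R]_4 :=
  \row_(j < 4) [:: 0; 0; b; 0]`_j.

(* Main.v *)
Require Import Defs.
From HB Require Import structures.
From mathcomp Require Import all_boot all_order all_algebra.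
From mathcomp Require Import all_classical all_reals all_analysis.
From mathcomp Require Import measurable_realfun ring lra.
From mathcomp.multinomials Require Import freeg.
From mathcomp Require Import fintype.

Set Implicit Arguments.
Unset Strict Implicit.
Unset Printing Implicit Defensive.

Import Order.TTheory GRing.Theory Num.Theory.
Import numFieldNormedType.Exports.
Import Defs.

Local Open Scope classical_set_scope.
Local Open Scope ring_scope.

(** Write [r = sqrt (1 / a + y^2)], [s = sqrt (P y)] and [w = y + i / s]. The map
    [F] of the statement satisfies [F_x = (r exp (i phi), - x)] and
    [F_y = w (x exp (i phi) / r, 1)]. These vectors are orthogonal for the Hermitian
    product of [C^2]: the coordinates are orthogonal, with
    [E = |F_x|^2 = r^2 + x^2] and [|F_y|^2 = |w|^2 E / r^2], and the surface is
    Lagrangian, so that [i F_x] and [i F_y] span the normal plane. The whole geometry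
    is then explicit ([jlt_normal_part]). The translator equation and the
    bound on the second fundamental form result from the differential equation
    [jlt_s_ode] of [s].

    The holomorphic volume form [dz1 dz2] has argument [theta = phi + arg w] on the
    surface, and [theta' = - b / s]: the angle [theta] decreases and is symmetric
    around its value [pi / 2] at [0]. Since [phi < theta], the limit [phibar] of
    [phi] is at most [theta 1 < pi / 2] ([jlt_phibar_lt]), and [theta] takes its
    values in [[phibar, pi - phibar]]. For the complex structure whose Kaehler form is
    the imaginary part of [dz1 dz2], the Kaehler angle has cosine [sin theta]
    ([jlt_cos_kahler_angle]), which is at least [sin phibar]. For [a = 1] and [b]
    tending to [0], the integrand of [phi] tends to [1 / (1 + t^2)] and [phibar] to
    [pi / 2] ([jlt_phibar_near]).

    The last coordinate of [F] is [- theta / b], a monotone function of [y]; this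
    gives a continuous inverse of the parametrization ([jlt_inv]), and the surface is
    an embedded plane. Its first homology vanishes because the cone operator of the
    plane contracts singular chains ([boundary_cone]). Its genus is zero because a
    regular closed curve of the plane separates it ([curve_separates]): the angle
    swept by the curve as seen from a point is a locally constant function of
    that point off the curve, and takes different values on the two sides of the
    curve ([turn_jump]).

    Finally [|F|^2 = x^2 / a + (x^2 + y^2)^2 / 4 + theta^2 / b^2], and the area element
    is [E |w| / r] with [|w| <= r]. The ball of radius [c] therefore lies over a disc
    of squared radius [2 c], where the area element is at most [1 / a + 2 c]: the
    area growth is quadratic. As [|H|^2 = b^2 exp (- b y^2) / (a E)], the factor [E]
    disappears from the energy density, which depends on [y] only, while over the
    annulus between the radii [c] and [2 c] the coordinate [x] ranges over intervals
    of length of order [sqrt c]: the energy of the annulus tends to infinity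
    ([jlt_energy_annulus]). *)

(** * Smooth functions of one real variable *)

Section SmoothFunctions.
Variable R : realType.
Implicit Types f g : R -> R.

(** Differentiability to order [n], without continuity of the last
    derivative: this makes all closure properties plain inductions. *)
Fixpoint ndiff (n : nat) f : Prop :=
  if n is m.+1 then (forall x : R, derivable f x 1) /\ ndiff m (derive1 f)
  else True.

Definition smooth f := forall n, ndiff n f.

Lemma is_derive_derive1 f (x l : R) : is_derive x 1 f l -> derive1 f x = l.
Proof. by move=> [_ <-]; rewrite derive1E. Qed.

Lemma is_derive_ndiffS n f f' :
  (forall x : R, is_derive x 1 f (f' x)) -> ndiff n f' -> ndiff n.+1 f.
Proof.
move=> df nf'; split=> [x|]; first by have [] := df x.
by rewrite (_ : derive1 f = f') //; apply/funext => x; exact: is_derive_derive1.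
Qed.

Lemma ndiff_is_derive n f (x : R) : ndiff n.+1 f -> is_derive x 1 f (derive1 f x).
Proof. by move=> [df _]; apply: DeriveDef => //; rewrite derive1E. Qed.

Lemma ndiffW n f : ndiff n.+1 f -> ndiff n f.
Proof.
elim: n f => // n IH f [df nf]; split=> //; exact: IH.
Qed.

Lemma ndiff_cst n (c : R) : ndiff n (fun=> c).
Proof.
elim: n c => // n IH c; by apply: (@is_derive_ndiffS _ _ (fun=> 0)).
Qed.

Lemma ndiff_id n : ndiff n (fun x : R => x).
Proof.
case: n => // n; by apply: (@is_derive_ndiffS _ _ (fun=> 1)); exact: ndiff_cst.
Qed.

Lemma ndiffD n f g : ndiff n f -> ndiff n g -> ndiff n (fun x => f x + g x).
Proof.
elim: n f g => // n IH f g nf ng.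
apply: (@is_derive_ndiffS _ _ (fun x => derive1 f x + derive1 g x)) => [x|].
  by have := ndiff_is_derive x nf; have := ndiff_is_derive x ng; move=> ? ?;
     exact: is_deriveD.
by apply: IH; [case: nf | case: ng].
Qed.

Lemma ndiffM n f g : ndiff n f -> ndiff n g -> ndiff n (fun x => f x * g x).
Proof.
elim: n f g => // n IH f g nf ng.
apply: (@is_derive_ndiffS _ _ (fun x => f x * derive1 g x + g x * derive1 f x)).
  move=> x; have := ndiff_is_derive x nf; have := ndiff_is_derive x ng.
  by move=> ? ?; exact: is_deriveM.
by apply: ndiffD; apply: IH; [exact: ndiffW | case: ng | exact: ndiffW | case: nf].
Qed.

Lemma ndiff_comp n f g : ndiff n f -> ndiff n g -> ndiff n (fun x => f (g x)).
Proof.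
elim: n f g => // n IH f g nf ng.
have dfg (x : R) : is_derive x 1 (fun x => f (g x)) (derive1 f (g x) * derive1 g x).
  have := ndiff_is_derive x ng; have := ndiff_is_derive (g x) nf.
  by move=> ? ?; exact: (@is_derive1_comp _ f g).
apply: (is_derive_ndiffS dfg); apply: ndiffM; last by case: ng.
by apply: IH; [case: nf | exact: ndiffW].
Qed.

Lemma ndiffV n f : (forall x, f x != 0) -> ndiff n f ->
  ndiff n (fun x => (f x)^-1).
Proof.
move=> f0; elim: n => // n IH nf.
have dV (x : R) : is_derive x 1 (fun x => (f x)^-1)
    ((-1 * ((f x)^-1 * (f x)^-1)) * derive1 f x).
  have := is_deriveV (f0 x) (ndiff_is_derive x nf).
  by move=> H; apply: is_derive_eq; rewrite /GRing.scale /= mulN1r -invfM -expr2.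
have nV := IH (ndiffW nf).
apply: (is_derive_ndiffS dV); apply: ndiffM; last by case: nf.
by apply: ndiffM; [exact: ndiff_cst | exact: ndiffM].
Qed.

Lemma ndiff_sqrt n f : (forall x, 0 < f x) -> ndiff n f ->
  ndiff n (fun x => Num.sqrt (f x)).
Proof.
move=> f0; elim: n => // n IH nf.
have s0 x : 2 * Num.sqrt (f x) != 0 by rewrite mulf_neq0 // gt_eqF // sqrtr_gt0.
apply: (@is_derive_ndiffS _ _
  (fun x => (2 * Num.sqrt (f x))^-1 * derive1 f x)) => [x|].
  have := ndiff_is_derive x nf; have := is_derive1_sqrt (f0 x) => ? ?.
  exact: (@is_derive1_comp _ Num.sqrt f).
apply: ndiffM; last by case: nf.
by apply: ndiffV => //; apply: ndiffM; [exact: ndiff_cst | apply: IH; exact: ndiffW].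
Qed.

Lemma smooth_derive f (x : R) : smooth f -> is_derive x 1 f (derive1 f x).
Proof. by move=> /(_ 1) /(ndiff_is_derive x). Qed.

Lemma smooth_derive1 f : smooth f -> smooth (derive1 f).
Proof. by move=> sf n; have [] := sf n.+1. Qed.

Lemma smooth_continuous f : smooth f -> continuous f.
Proof.
move=> sf x; apply: differentiable_continuous; apply/derivable1_diffP.
by have [] := sf 1.
Qed.

Lemma smooth_cst (c : R) : smooth (fun=> c).
Proof. by move=> n; exact: ndiff_cst. Qed.

Lemma smooth_id : smooth (fun x => x).
Proof. by move=> n; exact: ndiff_id. Qed.

Lemma smoothD f g : smooth f -> smooth g -> smooth (fun x => f x + g x).
Proof. by move=> sf sg n; exact: ndiffD. Qed.

Lemma smoothM f g : smooth f -> smooth g -> smooth (fun x => f x * g x).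
Proof. by move=> sf sg n; exact: ndiffM. Qed.

Lemma smoothX f k : smooth f -> smooth (fun x => f x ^+ k).
Proof.
move=> sf; elim: k => [|k IH].
  by rewrite (_ : (fun _ => _) = fun=> 1); [exact: smooth_cst | apply/funext].
rewrite (_ : (fun _ => _) = (fun x => f x * f x ^+ k)); first exact: smoothM.
by apply/funext => x; rewrite exprS.
Qed.

Lemma smooth_comp f g : smooth f -> smooth g -> smooth (fun x => f (g x)).
Proof. by move=> sf sg n; exact: ndiff_comp. Qed.

Lemma smoothV f : (forall x, f x != 0) -> smooth f -> smooth (fun x => (f x)^-1).
Proof. by move=> f0 sf n; exact: ndiffV. Qed.

Lemma smooth_sqrt f : (forall x, 0 < f x) -> smooth f ->
  smooth (fun x => Num.sqrt (f x)).
Proof. by move=> f0 sf n; exact: ndiff_sqrt. Qed.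

Lemma smooth_primitive f f' :
  (forall x : R, is_derive x 1 f (f' x)) -> smooth f' -> smooth f.
Proof. by move=> df sf [|n] //; exact: (is_derive_ndiffS df). Qed.

Lemma smooth_expR : smooth expR.
Proof. by elim=> // n IH; apply: (is_derive_ndiffS _ IH). Qed.

Lemma smooth_sin_cos : smooth sin /\ smooth cos.
Proof.
suff H n : ndiff n (@sin R) /\ ndiff n (@cos R) by split=> n; case: (H n).
elim: n => // n [sn cn]; split; first exact: (is_derive_ndiffS _ cn).
apply: (@is_derive_ndiffS _ _ (fun x => -1 * sin x)) => [x|].
  by rewrite mulN1r; exact: is_derive_cos.
by apply: ndiffM => //; exact: ndiff_cst.
Qed.

(** ** The entire function [(exp s - 1) / s]

    The power series [e_k (s) = \sum_n s^n / (n! (n + k + 1))], which is the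
    moment [\int_0^1 u^k exp (s u) du], satisfies [e_k' = e_(k+1)]; hence
    [e_0] is smooth. *)

Definition emoment_coef (k n : nat) : R := n`!%:R^-1 * (n + k).+1%:R^-1.

Definition emoment (k : nat) (s : R) : R := limn (pseries (emoment_coef k) s).

Lemma is_cvg_emoment k s : cvgn (pseries (emoment_coef k) s).
Proof.
apply: (@normed_cvg R R^o).
apply: (@series_le_cvg _ _ (exp_coeff `|s|)).
- by move=> n; exact: normr_ge0.
- by move=> n; exact: exp_coeff_ge0.
- move=> n /=; rewrite normrM normrX /exp_coeff mulrC ler_wpM2l ?exprn_ge0 //.
  rewrite ger0_norm ?mulr_ge0 ?invr_ge0 //.
  by rewrite ler_piMr ?invr_ge0 // invf_le1 // ler1n.
- exact: is_cvg_series_exp_coeff.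
Qed.

Lemma emoment_coef_diffs k : pseries_diffs (emoment_coef k) = emoment_coef k.+1.
Proof.
apply/funext => n; rewrite /pseries_diffs /emoment_coef factS natrM invfM.
by rewrite -!mulrA mulVKf ?pnatr_eq0 // addSnnS.
Qed.

Lemma is_derive_emoment k (s : R) : is_derive s 1 (emoment k) (emoment k.+1 s).
Proof.
rewrite /emoment -(emoment_coef_diffs k).
apply: (@pseries_snd_diffs _ _ (`|s| + 1)); rewrite ?emoment_coef_diffs;
  try exact: is_cvg_emoment.
by rewrite [ltRHS]ger0_norm // ltrDl.
Qed.

Lemma smooth_emoment k : smooth (emoment k).
Proof.
move=> n; elim: n k => // n IH k.
apply: (is_derive_ndiffS (is_derive_emoment k)); exact: IH.
Qed.

Lemma emoment0M s : s * emoment 0 s = expR s - 1.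
Proof.
have e n : series (exp_coeff s) n.+1 = 1 + s * pseries (emoment_coef 0) s n.
  rewrite /series /= !big_mkord big_ord_recl /exp_coeff /= expr0 divr1.
  congr (_ + _); rewrite big_distrr /= big_mkord; apply: eq_bigr => i _.
  by rewrite /bump leq0n add1n /emoment_coef addn0 factS natrM invfM exprS; ring.
have c : (1 + s * pseries (emoment_coef 0) s n) @[n --> \oo] --> expR s.
  rewrite (_ : (fun _ => _) = (fun n => series (exp_coeff s) n.+1)).
    by rewrite (cvg_shiftS (series (exp_coeff s))); exact: is_cvg_series_exp_coeff.
  by apply/funext => n; rewrite e.
have c' : (1 + s * pseries (emoment_coef 0) s n) @[n --> \oo]
    --> 1 + s * emoment 0 s.
  by apply: cvgD; [exact: cvg_cst | apply: cvgMr; exact: is_cvg_emoment].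
by rewrite (cvg_unique _ c c') // addrC addKr.
Qed.

End SmoothFunctions.

(** * The profile functions *)

(** Deriving from the left endpoint of a larger interval treats both branches
    of a signed integral at once. *)
Lemma is_derive_signed_integral (R : realType) (f : R -> R) (y : R) :
  continuous f ->
  is_derive y 1 (fun y => if 0 <= y
    then \int[@lebesgue_measure R]_(t in `[0, y]) f t
    else - \int[@lebesgue_measure R]_(t in `[y, 0]) f t) (f y).
Proof.
move=> cf.
pose mu := @lebesgue_measure R.
have int u v : mu.-integrable `[u, v] (EFin \o f).
  apply: continuous_compact_integrable; first exact: segment_compact.
  exact: continuous_subspaceT.
pose M := `|y| + 1.
have [yM My] : y < M /\ - M < y.
  by apply/andP; rewrite andbC -ltr_norml ltrDl.
have MM : - M < M by exact: lt_trans yM.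
pose g z := \int[mu]_(t in `[- M, z]) f t.
have split u v : - M <= u -> u <= v -> \int[mu]_(t in `[u, v]) f t = g v - g u.
  move=> Mu uv; rewrite /g.
  rewrite (@Rintegral_itvB _ f (BLeft (- M)) (BRight v) u) //.
  rewrite Rintegral_itv_obnd_cbnd //.
  by apply: integrableS (int u v) => //; apply: subset_itvr; rewrite bnd_simp.
have dg : is_derive y 1 g (f y).
  have [dg eg] := @continuous_FTC1_closed _ f (- M) y M yM (int _ _) My (cf y).
  by apply: DeriveDef; [exact: dg | rewrite -derive1E].
apply: (@near_eq_is_derive _ _ _ (fun z => g z - g 0)).
  have yI : y \in `]- M, M[ by rewrite in_itv /= My yM.
  near=> z.
  have /itvP zI : z \in `]- M, M[ by near: z; exact: near_in_itvoo yI.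
  case: ifPn => z0; first by rewrite split // oppr_le0 addr_ge0.
  by rewrite split ?zI // ?opprB // ltW // ltNge.
have -> : f y = f y - 0 by rewrite subr0.
exact: is_deriveB.
Unshelve. all: by end_near. Qed.

Section Profile.
Variables (R : realType) (a b : R).
Hypotheses (a0 : 0 < a) (b0 : 0 < b).
Implicit Types x y t : R.

Notation P := (jlt_P a b).
Notation phi := (jlt_phi a b).

(** In terms of [w = y + i / s], the first complex coordinate of [F_y] is
    [(x / r) exp (i phi) w] and the second one is [w]; [theta] is the sum of [phi]
    and the argument of [w], and [Q = s^2 |w|^2]. *)
Definition jlt_s y := Num.sqrt (P y).
Definition jlt_r y := Num.sqrt (a^-1 + y ^+ 2).
Definition jlt_theta y := phi y + upper_arg y (jlt_s y)^-1.
Definition jlt_Q y := (1 + a * y ^+ 2) * expR (b * y ^+ 2).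

Notation s := jlt_s.
Notation r := jlt_r.
Notation theta := jlt_theta.
Notation Q := jlt_Q.

Lemma emoment00 : emoment 0 0 = 1 :> R.
Proof.
have d1 : is_derive (0 : R) 1 (fun t => t * emoment 0 t) (emoment 0 0).
  have := is_derive_emoment 0 (0 : R) => ?.
  by apply: is_derive_eq; rewrite /GRing.scale /= mul0r add0r mulr1.
have d2 : is_derive (0 : R) 1 (fun t => t * emoment 0 t) 1.
  rewrite (_ : (fun _ => _) = (fun t => expR t - 1)); last first.
    by apply/funext => t; rewrite emoment0M.
  by apply: is_derive_eq; rewrite expR0 subr0.
exact: etrans (esym (is_derive_derive1 d1)) (is_derive_derive1 d2).
Qed.

Lemma jlt_PE t :
  P t = a * expR (b * t ^+ 2) + b * emoment 0 (b * t ^+ 2).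
Proof.
rewrite /jlt_P; case: eqP => [->|/eqP t0].
  by rewrite expr0n /= mulr0 expR0 emoment00 !mulr1.
apply: (mulfI (expf_neq0 2 t0)).
rewrite mulrC divfK ?expf_neq0 // mulrDr (mulrA _ b) (mulrC _ b) emoment0M.
ring.
Qed.

Lemma smooth_jlt_P : smooth P.
Proof.
rewrite (_ : P = fun t => a * expR (b * t ^+ 2) + b * emoment 0 (b * t ^+ 2)).
  have q : smooth (fun t : R => b * t ^+ 2).
    by apply: smoothM; [exact: smooth_cst | apply: smoothX; exact: smooth_id].
  apply: smoothD; apply: smoothM; (try exact: smooth_cst);
    apply: smooth_comp q; [exact: smooth_expR | exact: smooth_emoment].
by apply/funext => t; exact: jlt_PE.
Qed.

Lemma jlt_QE y : Q y = 1 + y ^+ 2 * P y.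
Proof.
rewrite jlt_PE mulrDr (mulrA _ b) (mulrC _ b) emoment0M /jlt_Q; ring.
Qed.

Lemma jlt_P_ge t : a <= P t.
Proof.
rewrite /jlt_P; case: eqP => [_|/eqP t0]; first by rewrite lerDl ltW.
have t2 : 0 < t ^+ 2 by rewrite exprn_even_gt0.
rewrite ler_pdivlMr // lerBrDl -[leLHS]mulr1 ler_wpM2l //.
  by rewrite addr_ge0 // mulr_ge0 // ltW.
by rewrite -expR0 ler_expR mulr_ge0 // ltW.
Qed.

Lemma jlt_P_gt0 t : 0 < P t.
Proof. exact: lt_le_trans (jlt_P_ge t). Qed.

Lemma jlt_P_even t : P (- t) = P t.
Proof. by rewrite !jlt_PE sqrrN. Qed.

Lemma jlt_s_gt0 y : 0 < s y.
Proof. by rewrite sqrtr_gt0 jlt_P_gt0. Qed.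

Lemma jlt_s_neq0 y : s y != 0.
Proof. by rewrite gt_eqF // jlt_s_gt0. Qed.

Lemma jlt_s_sqr y : s y ^+ 2 = P y.
Proof. by rewrite sqr_sqrtr // ltW // jlt_P_gt0. Qed.

Lemma jlt_r2_gt0 y : 0 < a^-1 + y ^+ 2.
Proof. by rewrite ltr_pwDl ?invr_gt0 // sqr_ge0. Qed.

Lemma jlt_r_gt0 y : 0 < r y.
Proof. by rewrite sqrtr_gt0 jlt_r2_gt0. Qed.

Lemma jlt_r_neq0 y : r y != 0.
Proof. by rewrite gt_eqF // jlt_r_gt0. Qed.

Lemma jlt_r_sqr y : r y ^+ 2 = a^-1 + y ^+ 2.
Proof. by rewrite sqr_sqrtr // ltW // jlt_r2_gt0. Qed.

Lemma smooth_jlt_s : smooth s.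
Proof. apply: smooth_sqrt smooth_jlt_P => t; exact: jlt_P_gt0. Qed.

Lemma smooth_jlt_r2 : smooth (fun y : R => a^-1 + y ^+ 2).
Proof.
by apply: smoothD; [exact: smooth_cst | apply: smoothX; exact: smooth_id].
Qed.

Lemma smooth_jlt_r : smooth r.
Proof. apply: smooth_sqrt smooth_jlt_r2 => t; exact: jlt_r2_gt0. Qed.

Lemma is_derive_jlt_r y : is_derive y 1 r (y / r y).
Proof.
have H := is_derive1_sqrt (jlt_r2_gt0 y).
have H2 : is_derive y 1 (fun y : R => a^-1 + y ^+ 2) (2 * y).
  by apply: is_derive_eq; rewrite /GRing.scale /=; ring.
have := @is_derive1_comp _ Num.sqrt (fun y : R => a^-1 + y ^+ 2) y _ _ H H2.
move=> H3; apply: is_derive_eq; rewrite -/(r y).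
by have := jlt_r_neq0 y => ?; field.
Qed.

Lemma smooth_jlt_phi_integrand : smooth (jlt_phi_integrand a b).
Proof.
apply: smoothV => [t|]; last exact: smoothM smooth_jlt_r2 smooth_jlt_s.
by rewrite mulf_neq0 ?jlt_s_neq0 // gt_eqF // jlt_r2_gt0.
Qed.

Lemma is_derive_jlt_phi y : is_derive y 1 phi (jlt_phi_integrand a b y).
Proof.
apply: is_derive_signed_integral; exact: smooth_continuous smooth_jlt_phi_integrand.
Qed.

Lemma smooth_jlt_phi : smooth phi.
Proof. exact: smooth_primitive is_derive_jlt_phi smooth_jlt_phi_integrand. Qed.

Lemma jlt_phi_integrandE y :
  jlt_phi_integrand a b y = (r y ^+ 2 * s y)^-1.
Proof. by rewrite jlt_r_sqr. Qed.

Lemma jlt_phi_integrand_gt0 y : 0 < jlt_phi_integrand a b y.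
Proof. by rewrite invr_gt0 mulr_gt0 ?jlt_r2_gt0 ?jlt_s_gt0. Qed.

Lemma jlt_phi0 : phi 0 = 0.
Proof. by rewrite /jlt_phi lexx set_itv1 Rintegral_set1. Qed.

Lemma jlt_phiN y : phi (- y) = - phi y.
Proof.
have d t : is_derive t 1 (fun t => phi t + phi (- t)) 0.
  have H1 := is_derive_jlt_phi t.
  have H2 := @is_derive1_comp _ phi (fun t => - t) t _ _
    (is_derive_jlt_phi (- t)) (is_deriveNid t 1).
  apply: is_derive_eq; rewrite /jlt_phi_integrand sqrrN jlt_P_even; ring.
have := is_derive_0_is_cst y 0 d.
by rewrite oppr0 jlt_phi0 addr0 => /eqP; rewrite addrC addr_eq0 => /eqP.
Qed.

(** ** The Lagrangian angle [theta] *)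

(** The inverse tangent is differentiable on the whole line, the arc cosine is
    not. *)
Lemma upper_arg_atan u : 
  forall c : R, 0 < c -> upper_arg u c^-1 = pi / 2 - atan (u * c).
Proof.
move=> c c0; have c1 : c != 0 by rewrite gt_eqF.
have q0 : 0 < 1 + (u * c) ^+ 2 by rewrite ltr_pwDl // sqr_ge0.
have e : u / Num.sqrt (u ^+ 2 + c^-1 ^+ 2) = cos (pi / 2 - atan (u * c)).
  rewrite -cosN opprB cosBpihalf -[sin _](@mulfVK _ (cos (atan (u * c)))).
    rewrite -/(tan _) atanK cos_atan.
    rewrite (_ : u ^+ 2 + c^-1 ^+ 2 = (1 + (u * c) ^+ 2) / c ^+ 2); last by field.
    rewrite sqrtrM ?(ltW q0) // sqrtrV ?exprn_ge0 ?(ltW c0) // sqrtr_sqr gtr0_norm //.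
    have : Num.sqrt (1 + (u * c) ^+ 2) != 0 by rewrite gt_eqF // sqrtr_gt0.
    by move=> h; field; rewrite h c1.
  by rewrite gt_eqF // cos_gt0_pihalf // atan_gtNpi2 atan_ltpi2.
rewrite /upper_arg e cosK // in_itv /= subr_ge0 ltW ?atan_ltpi2 //=.
by rewrite lerBlDr -lerBlDl (_ : _ - _ = - (pi / 2)) ?ltW ?atan_gtNpi2 //; field.
Qed.

Lemma jlt_thetaE y : theta y = phi y + (pi / 2 - atan (y * s y)).
Proof. by rewrite /jlt_theta upper_arg_atan // jlt_s_gt0. Qed.

Lemma is_derive_jlt_s y : is_derive y 1 s (derive1 s y).
Proof. exact: smooth_derive smooth_jlt_s. Qed.

Lemma jlt_QE' y : Q y = a * r y ^+ 2 * expR (b * y ^+ 2).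
Proof. by rewrite jlt_r_sqr mulrDr mulfV ?gt_eqF. Qed.

Lemma jlt_Q_gt0 y : 0 < Q y.
Proof.
by rewrite mulr_gt0 ?expR_gt0 // ltr_pwDl // mulr_ge0 ?sqr_ge0 // ltW.
Qed.

Lemma jlt_QsE y : Q y = 1 + (y * s y) ^+ 2.
Proof. by rewrite jlt_QE exprMn jlt_s_sqr. Qed.

(** Off the origin, divide by [y] the derivative of [1 + y^2 s^2 = Q]. *)
Lemma jlt_s_ode y :
  (s y + y * derive1 s y) * (s y * r y ^+ 2) = Q y * (1 + b * r y ^+ 2).
Proof.
have [->|y0] := eqVneq y 0.
  rewrite mul0r addr0 mulrA -expr2 jlt_s_sqr jlt_r_sqr /jlt_Q /jlt_P eqxx.
  by rewrite expr0n /= !mulr0 expR0 !addr0; field; rewrite gt_eqF.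
have d1 : is_derive y 1 Q (2 * y * (s y + y * derive1 s y) * s y).
  rewrite (_ : Q = fun t => 1 + (t * s t) ^+ 2); last first.
    by apply/funext => t; exact: jlt_QsE.
  have := is_derive_jlt_s y => ?.
  by apply: is_derive_eq; rewrite /GRing.scale /=; ring.
have d2 : is_derive y 1 Q
    (2 * y * ((a + b * (1 + a * y ^+ 2)) * expR (b * y ^+ 2))).
  have d3 : is_derive y 1 (fun t => b * t ^+ 2) (b * (2 * y)).
    by apply: is_derive_eq; rewrite /GRing.scale /=; ring.
  have d4 := @is_derive1_comp _ expR _ y _ _ (is_derive_expR _) d3.
  by clear d1; apply: is_derive_eq; rewrite /GRing.scale /=; ring.
have := etrans (esym (is_derive_derive1 d1)) (is_derive_derive1 d2).
rewrite -!(mulrA 2) -!(mulrA y) => /(mulfI _) e.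
have {e} : (s y + y * derive1 s y) * s y =
  (a + b * (1 + a * y ^+ 2)) * expR (b * y ^+ 2).
  by apply: (mulfI y0); apply: e.
rewrite [in X in _ -> X]mulrA => ->; rewrite /jlt_Q jlt_r_sqr; field.
by rewrite gt_eqF.
Qed.

(** The terms in [1 / r^2] of the derivatives of [phi] and of the argument
    cancel. *)
Lemma is_derive_jlt_theta y : is_derive y 1 theta (- b / s y).
Proof.
rewrite (_ : theta = fun t => phi t + (pi / 2 - atan (t * s t))); last first.
  by apply/funext => t; exact: jlt_thetaE.
have := is_derive_jlt_phi y => dphi; have := is_derive_jlt_s y => ds.
have d : is_derive y 1 (fun t => t * s t) (s y + y * derive1 s y).
  by apply: is_derive_eq; rewrite /GRing.scale /=; ring.
have d2 := @is_derive1_comp _ atan _ y _ _ (is_derive1_atan _) d.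
apply: is_derive_eq; rewrite jlt_phi_integrandE -jlt_QsE.
have s0 := jlt_s_neq0 y; have r0 := jlt_r_neq0 y.
have Q0 : Q y != 0 by rewrite gt_eqF // jlt_Q_gt0.
have -> : s y + y * derive1 s y = Q y * (1 + b * r y ^+ 2) / (s y * r y ^+ 2).
  by rewrite -jlt_s_ode mulfK // mulf_neq0 // expf_neq0.
by field; rewrite s0 r0.
Qed.

Lemma smooth_jlt_theta : smooth theta.
Proof.
apply: smooth_primitive is_derive_jlt_theta _.
by apply: smoothM; [exact: smooth_cst | exact: smoothV jlt_s_neq0 smooth_jlt_s].
Qed.

Lemma jlt_theta_decr y z : y < z -> theta z < theta y.
Proof.
have c := smooth_continuous smooth_jlt_theta.
have d t : derivable theta t 1 by have [] := is_derive_jlt_theta t.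
move=> yz; apply: (@ltr0_derive1_decr _ theta y z) => //; rewrite ?lexx ?ltW //.
- by move=> t _; rewrite (is_derive_derive1 (is_derive_jlt_theta t)) mulNr
    oppr_lt0 divr_gt0 // jlt_s_gt0.
- exact: continuous_subspaceT.
Qed.

Lemma jlt_theta_inj : injective theta.
Proof.
move=> y z e; apply/eqP; rewrite eq_le !leNgt.
by apply/andP; split; apply/negP => /jlt_theta_decr; rewrite e ltxx.
Qed.

Lemma jlt_phi_incr y z : y <= z -> phi y <= phi z.
Proof.
have c := smooth_continuous smooth_jlt_phi.
have d t : derivable phi t 1 by have [] := is_derive_jlt_phi t.
move=> yz; apply: (@ger0_derive1_ndecr _ phi y z) => //; rewrite ?lexx //.
- by move=> t _; rewrite (is_derive_derive1 (is_derive_jlt_phi t)) ltW //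
    jlt_phi_integrand_gt0.
- exact: continuous_subspaceT.
Qed.

Lemma jlt_phi_gt0 : 0 < phi 1.
Proof.
have c := smooth_continuous smooth_jlt_phi.
have d t : derivable phi t 1 by have [] := is_derive_jlt_phi t.
rewrite -[ltLHS]jlt_phi0; apply: (@gtr0_derive1_incr _ phi 0 1) => //.
- by move=> t _; rewrite (is_derive_derive1 (is_derive_jlt_phi t))
    jlt_phi_integrand_gt0.
- exact: continuous_subspaceT.
Qed.

Lemma jlt_phi_lt_theta y : phi y < theta y.
Proof. by rewrite jlt_thetaE ltrDl subr_gt0 atan_ltpi2. Qed.

Lemma jlt_theta0 : theta 0 = pi / 2.
Proof. by rewrite jlt_thetaE jlt_phi0 mul0r atan0 subr0 add0r. Qed.

Lemma jlt_thetaN y : theta (- y) = pi - theta y.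
Proof.
by rewrite !jlt_thetaE jlt_phiN /jlt_s jlt_P_even mulNr atanN; lra.
Qed.

(** Beyond [y = 1], [phi] lies below the decreasing function [theta]. *)
Lemma jlt_phi_le_theta1 y : phi y <= theta 1.
Proof.
have [y1|y1] := leP y 1.
  by rewrite (le_trans (jlt_phi_incr y1)) // ltW // jlt_phi_lt_theta.
by rewrite ltW // (lt_trans (jlt_phi_lt_theta y)) // jlt_theta_decr.
Qed.

Lemma jlt_phi_cvg : phi y @[y --> +oo] --> sup (range phi).
Proof.
apply: nondecreasing_cvgr; first by move=> y z; exact: jlt_phi_incr.
by exists (theta 1) => _ [y _ <-]; exact: jlt_phi_le_theta1.
Qed.

Lemma jlt_phibarE : jlt_phibar a b = sup (range phi).
Proof. by apply: cvg_lim => //; exact: jlt_phi_cvg. Qed.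

Lemma jlt_phi_has_sup : has_sup (range phi).
Proof.
split; first by exists (phi 0), 0.
by exists (theta 1) => _ [y _ <-]; exact: jlt_phi_le_theta1.
Qed.

Lemma jlt_phi_le_phibar y : phi y <= jlt_phibar a b.
Proof.
by rewrite jlt_phibarE; apply: sup_upper_bound jlt_phi_has_sup _ _; exists y.
Qed.

Lemma jlt_phibar_le c : (forall y, phi y <= c) -> jlt_phibar a b <= c.
Proof.
move=> H; rewrite jlt_phibarE; apply: ge_sup; first by exists (phi 0), 0.
by move=> _ [y _ <-].
Qed.

Lemma jlt_phibar_gt0 : 0 < jlt_phibar a b.
Proof. exact: lt_le_trans jlt_phi_gt0 (jlt_phi_le_phibar 1). Qed.

Lemma jlt_phibar_lt : jlt_phibar a b < pi / 2.
Proof.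
rewrite -jlt_theta0; apply: le_lt_trans (jlt_theta_decr ltr01).
exact: jlt_phibar_le jlt_phi_le_theta1.
Qed.

(** For [z] beyond [y], [phi z < theta z < theta y]. *)
Lemma jlt_theta_ge y : jlt_phibar a b <= theta y.
Proof.
apply: jlt_phibar_le => z; have [zy|yz] := leP z y.
  by rewrite (le_trans (jlt_phi_incr zy)) // ltW // jlt_phi_lt_theta.
by rewrite ltW // (lt_trans (jlt_phi_lt_theta z)) // jlt_theta_decr.
Qed.

Lemma jlt_theta_le y : theta y <= pi - jlt_phibar a b.
Proof. by have := jlt_theta_ge (- y); rewrite jlt_thetaN; lra. Qed.

(** Since [theta] is decreasing and [theta - pi / 2] is odd, [theta] takes its values
    between [phibar] and [pi - phibar]. *)
Lemma jlt_sin_theta_ge y : sin (jlt_phibar a b) <= sin (theta y).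
Proof.
have := jlt_theta_ge y; have := jlt_theta_le y.
have := jlt_phibar_gt0; have := jlt_phibar_lt.
set p := jlt_phibar a b; set t := theta y => p2 p0 tp pt.
have [tle|tgt] := leP t (pi / 2).
  have [->//|ne] := eqVneq p t.
  rewrite ltW // ltr_sin ?in_itv /= ?lt_neqAle ?ne //; lra.
have -> : sin t = sin (pi - t).
  by rewrite sinB sinpi cospi mul0r sub0r mulN1r opprK.
have [->//|ne] := eqVneq p (pi - t).
rewrite ltW // ltr_sin ?in_itv /= ?lt_neqAle ?ne //; lra.
Qed.

Lemma sin_jlt_theta y :
  sin (theta y) = (y * s y * sin (phi y) + cos (phi y)) / Num.sqrt (Q y).
Proof.
rewrite jlt_thetaE sinD -(cosN (pi / 2 - _)) opprB cosBpihalf.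
rewrite -(opprB (atan _)) sinN sinBpihalf opprK.
have c0 : cos (atan (y * s y)) != 0.
  by rewrite gt_eqF // cos_gt0_pihalf // atan_gtNpi2 atan_ltpi2.
rewrite -[sin (atan _)](mulfVK c0) -/(tan _) atanK cos_atan -jlt_QsE; ring.
Qed.

End Profile.

(** * Surfaces in Euclidean four-space *)

Section Vec4.
Variable R : realType.

Definition vec4 (u0 u1 u2 u3 : R) : 'rV[R]_4 :=
  \row_(j < 4) [:: u0; u1; u2; u3]`_j.

Lemma forall_ord4 (A : 'I_4 -> Prop) :
  A 0 -> A 1 -> A (inord 2) -> A (inord 3) -> forall j, A j.
Proof.
move=> A0 A1 A2 A3 -[[|[|[|[|//]]]] i].
- by rewrite (_ : Ordinal i = 0) //; apply: val_inj.
- by rewrite (_ : Ordinal i = 1) //; apply: val_inj.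
- by rewrite (_ : Ordinal i = inord 2) //; apply: val_inj; rewrite /= inordK.
- by rewrite (_ : Ordinal i = inord 3) //; apply: val_inj; rewrite /= inordK.
Qed.

Lemma vec4_0 (u0 u1 u2 u3 : R) : vec4 u0 u1 u2 u3 0 0 = u0.
Proof. by rewrite mxE. Qed.
Lemma vec4_1 (u0 u1 u2 u3 : R) : vec4 u0 u1 u2 u3 0 1 = u1.
Proof. by rewrite mxE. Qed.
Lemma vec4_2 (u0 u1 u2 u3 : R) : vec4 u0 u1 u2 u3 0 (inord 2) = u2.
Proof. by rewrite mxE /= inordK. Qed.
Lemma vec4_3 (u0 u1 u2 u3 : R) : vec4 u0 u1 u2 u3 0 (inord 3) = u3.
Proof. by rewrite mxE /= inordK. Qed.

Definition vec4E := (vec4_0, vec4_1, vec4_2, vec4_3).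

Lemma sum_ord4 (V : zmodType) (f : 'I_4 -> V) :
  \sum_i f i = f 0 + f 1 + f (inord 2) + f (inord 3).
Proof.
rewrite !big_ord_recr big_ord0 /= add0r.
congr (f _ + f _ + f _ + f _); apply: val_inj => //=; by rewrite ?inordK.
Qed.

Lemma dotpE (u v : 'rV[R]_4) : dotp u v = u 0 0 * v 0 0 + u 0 1 * v 0 1 +
  u 0 (inord 2) * v 0 (inord 2) + u 0 (inord 3) * v 0 (inord 3).
Proof. exact: sum_ord4. Qed.

Lemma dotp_vec4 (u0 u1 u2 u3 v0 v1 v2 v3 : R) :
  dotp (vec4 u0 u1 u2 u3) (vec4 v0 v1 v2 v3) =
  u0 * v0 + u1 * v1 + u2 * v2 + u3 * v3.
Proof. by rewrite dotpE !vec4E. Qed.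

Lemma is_derive_vec4 (x : R) (f0 f1 f2 f3 : R -> R) (d0 d1 d2 d3 : R) :
  is_derive x 1 f0 d0 -> is_derive x 1 f1 d1 ->
  is_derive x 1 f2 d2 -> is_derive x 1 f3 d3 ->
  derive1 (fun t => vec4 (f0 t) (f1 t) (f2 t) (f3 t)) x = vec4 d0 d1 d2 d3.
Proof.
move=> D0 D1 D2 D3.
have D j : is_derive x 1 (fun t => vec4 (f0 t) (f1 t) (f2 t) (f3 t) 0 j)
    (vec4 d0 d1 d2 d3 0 j).
  move: j; apply: forall_ord4; rewrite vec4E;
    by under eq_fun do rewrite vec4E.
rewrite derive1E derive_mx; last first.
  by apply/derivable_mxP => i j; rewrite ord1; case: (D j).
by apply/rowP => j; rewrite mxE; case: (D j).
Qed.

End Vec4.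

Section InnerProduct.
Variables (R : realType) (n : nat).
Implicit Types u v w : 'rV[R]_n.

Lemma dotp_mulmx u v : dotp u v = (u *m v^T) 0 0.
Proof. by rewrite mxE; apply: eq_bigr => i _; rewrite mxE. Qed.

Lemma dotpC u v : dotp u v = dotp v u.
Proof. by apply: eq_bigr => i _; rewrite mulrC. Qed.

Lemma dotpZl c u w : dotp (c *: u) w = c * dotp u w.
Proof. by rewrite !dotp_mulmx -scalemxAl mxE. Qed.

Lemma dotpZr c u w : dotp w (c *: u) = c * dotp w u.
Proof. by rewrite !(dotpC w) dotpZl. Qed.

Lemma dotp_ge0 u : 0 <= dotp u u.
Proof. by apply: sumr_ge0 => i _; rewrite -expr2 sqr_ge0. Qed.

Lemma enorm_sqr u : enorm u ^+ 2 = dotp u u.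
Proof. by rewrite sqr_sqrtr // dotp_ge0. Qed.

(** The relations say that the matrix of the [K i] has a right inverse; for a
    square matrix this is a left inverse, which is the expansion. *)
Lemma orthogonal_expansion (K : 'I_n -> 'rV[R]_n) (d : 'I_n -> R) v :
  (forall i j, dotp (K i) (K j) = if i == j then d i else 0) ->
  (forall i, d i != 0) ->
  v = \sum_i (dotp v (K i) / d i) *: K i.
Proof.
move=> KK d0; pose A := \matrix_(i < n) K i.
pose D := diag_mx (\row_i (d i)^-1).
have AAD : A *m (A^T *m D) = 1%:M.
  apply/matrixP => i j; rewrite mulmxA mul_mx_diag !mxE.
  transitivity (dotp (K i) (K j) / d j).
    by congr (_ / _); apply: eq_bigr => k _; rewrite !mxE.
  rewrite KK; case: eqP => [->|_]; first by rewrite mulfV.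
  by rewrite mul0r.
rewrite -[LHS]mulmx1 -(mulmx1C AAD) !mulmxA mul_mx_diag.
apply/rowP => j; rewrite !mxE summxE; apply: eq_bigr => i _.
rewrite !mxE; congr (_ / _ * _).
by apply: eq_bigr => k _; rewrite !mxE.
Qed.

End InnerProduct.

Lemma orthogonal_expansion4 (R : realType) (U V N1 N2 v : 'rV[R]_4) (u1 u2 n1 n2 : R) :
  dotp U U = u1 -> dotp V V = u2 -> dotp N1 N1 = n1 -> dotp N2 N2 = n2 ->
  dotp U V = 0 -> dotp U N1 = 0 -> dotp U N2 = 0 ->
  dotp V N1 = 0 -> dotp V N2 = 0 -> dotp N1 N2 = 0 ->
  u1 != 0 -> u2 != 0 -> n1 != 0 -> n2 != 0 ->
  v = (dotp v U / u1) *: U + (dotp v V / u2) *: V +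
      (dotp v N1 / n1) *: N1 + (dotp v N2 / n2) *: N2.
Proof.
move=> UU VV N11 N22 UV UN1 UN2 VN1 VN2 N12 u10 u20 n10 n20.
pose K (i : 'I_4) := [:: U; V; N1; N2]`_i.
pose d (i : 'I_4) := [:: u1; u2; n1; n2]`_i.
have KK i j : dotp (K i) (K j) = if i == j then d i else 0.
  by move: i j; apply: forall_ord4; apply: forall_ord4;
     rewrite /K /d -!val_eqE /= ?inordK //= dotpC.
have d0 i : d i != 0 by move: i; apply: forall_ord4; rewrite /d /= ?inordK.
by rewrite [LHS](orthogonal_expansion v KK d0) sum_ord4 /K /d /= !inordK.
Qed.

(** ** Orthogonal coordinates *)

Section OrthogonalCoordinates.
Variables (R : realType) (F : R -> R -> 'rV[R]_4) (x y : R).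

Notation U := (partial F 0 x y).
Notation V := (partial F 1 x y).

Lemma sum_ord2 (W : zmodType) (f : 'I_2 -> W) : \sum_i f i = f 0 + f 1.
Proof.
by rewrite !big_ord_recr big_ord0 /= add0r; congr (f _ + f _); apply: val_inj.
Qed.

Lemma sum_ord22 (W : zmodType) (f : 'I_2 -> 'I_2 -> W) :
  \sum_i \sum_j f i j = f 0 0 + f 0 1 + (f 1 0 + f 1 1).
Proof. by rewrite sum_ord2; congr (_ + _); exact: sum_ord2. Qed.

Lemma forall_ord2 (A : 'I_2 -> Prop) : A 0 -> A 1 -> forall j, A j.
Proof.
move=> A0 A1 -[[|[|//]] i].
- by rewrite (_ : Ordinal i = 0) //; apply: val_inj.
- by rewrite (_ : Ordinal i = 1) //; apply: val_inj.
Qed.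

Lemma metricE i j : metric F x y i j = dotp (partial F i x y) (partial F j x y).
Proof. by rewrite mxE; apply: eq_bigr => k _; rewrite !mxE. Qed.

Variables (E G : R).
Hypotheses (UU : dotp U U = E) (VV : dotp V V = G) (UV : dotp U V = 0).
Hypotheses (E0 : E != 0) (G0 : G != 0).

Lemma metric_orthogonal : metric F x y = diag_mx (\row_i [:: E; G]`_i).
Proof.
apply/matrixP => i j; rewrite metricE !mxE.
move: i j; apply: forall_ord2; apply: forall_ord2 => /=; rewrite ?mulr1n ?mulr0n.
- exact: UU.
- exact: UV.
- by rewrite dotpC; exact: UV.
- exact: VV.
Qed.

Lemma det_metric : \det (metric F x y) = E * G.
Proof. by rewrite metric_orthogonal det_diag big_ord_recl big_ord1 !mxE. Qed.

Lemma invmx_metric : invmx (metric F x y) = diag_mx (\row_i [:: E^-1; G^-1]`_i).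
Proof.
have e : metric F x y *m diag_mx (\row_i [:: E^-1; G^-1]`_i) = 1%:M.
  rewrite metric_orthogonal mulmx_diag; apply/matrixP => i j; rewrite !mxE.
  by move: i j; apply: forall_ord2; apply: forall_ord2 => //=; rewrite mulfV.
have u : metric F x y \in unitmx by case: (mulmx1_unit e).
by rewrite -[LHS]mulmx1 -e mulmxA mulVmx // mul1mx.
Qed.

(** The tangential projection, read off the inverse of a diagonal metric. *)
Lemma normal_partE v : normal_part F x y v =
  v - (dotp v U / E) *: U - (dotp v V / G) *: V.
Proof.
rewrite /normal_part invmx_metric -addrA -opprD; congr (_ - _).
have vD i : (v *m (jacobian F x y)^T) 0 i = dotp v (partial F i x y).
  by rewrite mxE; apply: eq_bigr => k _; rewrite !mxE.
rewrite mul_mx_diag; apply/rowP => j; rewrite [LHS]mxE sum_ord2.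
rewrite [RHS]mxE; congr (_ + _); rewrite [RHS]mxE; congr (_ * _); rewrite mxE //.
  by rewrite vD mxE.
by rewrite vD mxE.
Qed.

Lemma mean_curvatureE : mean_curvature F x y =
  E^-1 *: second_ff F x y 0 0 + G^-1 *: second_ff F x y 1 1.
Proof.
rewrite /mean_curvature invmx_metric sum_ord22; move: (second_ff F x y) => S.
by rewrite !mxE /= !mulr0n !mulr1n !scale0r addr0 add0r.
Qed.

Lemma second_ff_normE : second_ff_norm F x y = Num.sqrt (
  dotp (second_ff F x y 0 0) (second_ff F x y 0 0) / E ^+ 2 +
  dotp (second_ff F x y 0 1) (second_ff F x y 0 1) / (E * G) +
  dotp (second_ff F x y 1 0) (second_ff F x y 1 0) / (E * G) +
  dotp (second_ff F x y 1 1) (second_ff F x y 1 1) / G ^+ 2).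
Proof.
rewrite /second_ff_norm invmx_metric; congr Num.sqrt.
move: (second_ff F x y) => S; rewrite sum_ord22 !sum_ord22 !mxE /=.
by rewrite !mulr0n !mulr1n; field; rewrite E0 G0.
Qed.

(** When [N1] and [N2] complete the coordinate frame to an orthogonal frame of
    the ambient space, projecting on the normal plane is expanding on them. *)
Variables (N1 N2 : 'rV[R]_4) (n1 n2 : R).
Hypotheses (UN1 : dotp U N1 = 0) (UN2 : dotp U N2 = 0).
Hypotheses (VN1 : dotp V N1 = 0) (VN2 : dotp V N2 = 0).
Hypotheses (N11 : dotp N1 N1 = n1) (N22 : dotp N2 N2 = n2).
Hypotheses (N12 : dotp N1 N2 = 0) (n10 : n1 != 0) (n20 : n2 != 0).

Lemma normal_part_frame v : normal_part F x y v =
  (dotp v N1 / n1) *: N1 + (dotp v N2 / n2) *: N2.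
Proof.
have e := orthogonal_expansion4 v UU VV N11 N22 UV UN1 UN2 VN1 VN2 N12 E0 G0 n10 n20.
have cancel (W : zmodType) (p q t u : W) : p + q + t + u - p - q = t + u.
  by rewrite -(addrA (p + q)) -(addrA _ (- p)) -opprD addrAC subrr add0r.
rewrite normal_partE {1}e; exact: cancel.
Qed.

End OrthogonalCoordinates.

(** * Geometry of the Joyce-Lee-Tsui surface *)

Section Geometry.
Variables (R : realType) (a b : R).
Hypotheses (a0 : 0 < a) (b0 : 0 < b).

Notation P := (jlt_P a b).
Notation phi := (jlt_phi a b).
Notation s := (jlt_s a b).
Notation r := (jlt_r a).
Notation theta := (jlt_theta a b).
Notation Q := (jlt_Q a b).
Notation F := (jlt_map a b).
Notation ds := (derive1 s).

(** Real and imaginary parts of [exp (i phi) (y + i / s)]; the second complex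
    coordinate of [F_y] is the factor [y + i / s]. *)
Definition jlt_c1 (y : R) : R := y * cos (phi y) - sin (phi y) / s y.
Definition jlt_c2 (y : R) : R := y * sin (phi y) + cos (phi y) / s y.

Notation c1 := jlt_c1.
Notation c2 := jlt_c2.

Lemma jlt_mapE : F = fun x y =>
  vec4 (x * r y * cos (phi y)) (x * r y * sin (phi y))
    ((y ^+ 2 - x ^+ 2) / 2) (- b^-1 * theta y).
Proof. by []. Qed.

Lemma partial0_vec4 (f0 f1 f2 f3 : R -> R -> R) (x y : R) (d0 d1 d2 d3 : R) :
  is_derive x 1 (f0 ^~ y) d0 -> is_derive x 1 (f1 ^~ y) d1 ->
  is_derive x 1 (f2 ^~ y) d2 -> is_derive x 1 (f3 ^~ y) d3 ->
  partial (fun x y => vec4 (f0 x y) (f1 x y) (f2 x y) (f3 x y)) 0 x y =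
  vec4 d0 d1 d2 d3.
Proof. exact: is_derive_vec4. Qed.

Lemma partial1_vec4 (f0 f1 f2 f3 : R -> R -> R) (x y : R) (d0 d1 d2 d3 : R) :
  is_derive y 1 (f0 x) d0 -> is_derive y 1 (f1 x) d1 ->
  is_derive y 1 (f2 x) d2 -> is_derive y 1 (f3 x) d3 ->
  partial (fun x y => vec4 (f0 x y) (f1 x y) (f2 x y) (f3 x y)) 1 x y =
  vec4 d0 d1 d2 d3.
Proof. exact: is_derive_vec4. Qed.

Lemma is_derive_cos_phi (y : R) :
  is_derive y 1 (fun y => cos (phi y)) (- sin (phi y) / (r y ^+ 2 * s y)).
Proof.
have d := is_derive_jlt_phi a0 b0 y; rewrite (jlt_phi_integrandE b a0) in d.
exact: (@is_derive1_comp _ cos phi y _ _ (is_derive_cos _) d).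
Qed.

Lemma is_derive_sin_phi (y : R) :
  is_derive y 1 (fun y => sin (phi y)) (cos (phi y) / (r y ^+ 2 * s y)).
Proof.
have d := is_derive_jlt_phi a0 b0 y; rewrite (jlt_phi_integrandE b a0) in d.
exact: (@is_derive1_comp _ sin phi y _ _ (is_derive_sin _) d).
Qed.

Lemma is_derive_rV (y : R) : is_derive y 1 (fun y => (r y)^-1) (- y / r y ^+ 3).
Proof.
have := is_deriveV (jlt_r_neq0 a0 y) (is_derive_jlt_r a0 y) => d.
apply: is_derive_eq; rewrite /GRing.scale /=; field; exact: jlt_r_neq0.
Qed.

Lemma is_derive_sV (y : R) : is_derive y 1 (fun y => (s y)^-1) (- ds y / s y ^+ 2).
Proof.
have := is_deriveV (jlt_s_neq0 a0 b0 y) (is_derive_jlt_s a0 b0 y) => d.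
apply: is_derive_eq; rewrite /GRing.scale /=; field; exact: jlt_s_neq0.
Qed.

Lemma jlt_partial0 : partial F 0 = fun x y =>
  vec4 (r y * cos (phi y)) (r y * sin (phi y)) (- x) 0.
Proof.
rewrite jlt_mapE; apply/funext => x; apply/funext => y; apply: partial0_vec4.
- by apply: is_derive_eq; rewrite /GRing.scale /=; ring.
- by apply: is_derive_eq; rewrite /GRing.scale /=; ring.
- by apply: is_derive_eq; rewrite /GRing.scale /=; field.
- exact: is_derive_cst.
Qed.

Lemma jlt_partial1 : partial F 1 = fun x y =>
  vec4 (x * (c1 y / r y)) (x * (c2 y / r y)) y (s y)^-1.
Proof.
rewrite jlt_mapE; apply/funext => x; apply/funext => y; apply: partial1_vec4.
- have ? := is_derive_cos_phi y; have ? := is_derive_jlt_r a0 y.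
  apply: is_derive_eq; rewrite /GRing.scale /jlt_c1 /=; field.
  by rewrite jlt_s_neq0 ?jlt_r_neq0.
- have ? := is_derive_sin_phi y; have ? := is_derive_jlt_r a0 y.
  apply: is_derive_eq; rewrite /GRing.scale /jlt_c2 /=; field.
  by rewrite jlt_s_neq0 ?jlt_r_neq0.
- by apply: is_derive_eq; rewrite /GRing.scale /=; field.
- have ? := is_derive_jlt_theta a0 b0 y.
  apply: is_derive_eq; rewrite /GRing.scale /=; field.
  by rewrite jlt_s_neq0 // gt_eqF.
Qed.

(** ** First fundamental form *)

(** The squared norms of [w], [F_x] and [F_y]. *)
Definition jlt_W y := Q y / s y ^+ 2.
Definition jlt_E (x y : R) := r y ^+ 2 + x ^+ 2.
Definition jlt_G x y := jlt_W y * jlt_E x y / r y ^+ 2.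

Notation W := jlt_W.
Notation E := jlt_E.
Notation G := jlt_G.

Lemma jlt_WE y : W y = c1 y ^+ 2 + c2 y ^+ 2.
Proof.
rewrite /W jlt_QsE // -[1](cos2Dsin2 (phi y)) /jlt_c1 /jlt_c2.
have : (y * s y) ^+ 2 = (y * s y) ^+ 2 * (cos (phi y) ^+ 2 + sin (phi y) ^+ 2).
  by rewrite cos2Dsin2 mulr1.
by move=> ->; field; exact: jlt_s_neq0.
Qed.

Lemma jlt_rotC y : cos (phi y) * c1 y + sin (phi y) * c2 y = y.
Proof.
rewrite /jlt_c1 /jlt_c2 -[RHS]mulr1 -(cos2Dsin2 (phi y)).
by field; exact: jlt_s_neq0.
Qed.

Lemma jlt_rotS y : cos (phi y) * c2 y - sin (phi y) * c1 y = (s y)^-1.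
Proof.
rewrite /jlt_c1 /jlt_c2 -[RHS]mul1r -(cos2Dsin2 (phi y)).
by field; exact: jlt_s_neq0.
Qed.

Lemma jlt_W_gt0 y : 0 < W y.
Proof. by rewrite divr_gt0 ?jlt_Q_gt0 // exprn_gt0 // jlt_s_gt0. Qed.

Lemma jlt_E_gt0 x y : 0 < E x y.
Proof. by rewrite ltr_pwDl ?sqr_ge0 // exprn_gt0 // jlt_r_gt0. Qed.

Lemma jlt_G_gt0 x y : 0 < G x y.
Proof.
apply: divr_gt0; first by rewrite mulr_gt0 ?jlt_W_gt0 ?jlt_E_gt0.
by rewrite exprn_gt0 // jlt_r_gt0.
Qed.

Lemma jlt_W_neq0 y : W y != 0. Proof. by rewrite gt_eqF // jlt_W_gt0. Qed.
Lemma jlt_E_neq0 x y : E x y != 0. Proof. by rewrite gt_eqF // jlt_E_gt0. Qed.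
Lemma jlt_G_neq0 x y : G x y != 0. Proof. by rewrite gt_eqF // jlt_G_gt0. Qed.

Lemma jlt_UU x y : dotp (partial F 0 x y) (partial F 0 x y) = E x y.
Proof.
rewrite jlt_partial0 dotp_vec4 /jlt_E -[r y ^+ 2]mulr1.
by rewrite -(cos2Dsin2 (phi y)); ring.
Qed.

Lemma jlt_VV x y : dotp (partial F 1 x y) (partial F 1 x y) = G x y.
Proof.
rewrite jlt_partial1 dotp_vec4 /jlt_G /jlt_E.
have e : y * y + (s y)^-1 * (s y)^-1 = W y.
  by rewrite /W jlt_QsE //; field; exact: jlt_s_neq0.
by rewrite -addrA e jlt_WE; field; exact: jlt_r_neq0.
Qed.

Lemma jlt_UV x y : dotp (partial F 0 x y) (partial F 1 x y) = 0.
Proof.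
rewrite jlt_partial0 jlt_partial1 dotp_vec4.
transitivity (x * (cos (phi y) * c1 y + sin (phi y) * c2 y) - x * y).
  by field; rewrite jlt_r_neq0 ?jlt_s_neq0.
by rewrite jlt_rotC subrr.
Qed.

Lemma jlt_sqrt_det x y :
  Num.sqrt (\det (metric F x y)) = E x y * Num.sqrt (Q y) / (s y * r y).
Proof.
rewrite (det_metric (jlt_UU x y) (jlt_VV x y) (jlt_UV x y)).
have -> : E x y * G x y = (E x y / (s y * r y)) ^+ 2 * Q y.
  by rewrite /jlt_G /jlt_W; field; rewrite jlt_r_neq0 ?jlt_s_neq0.
rewrite sqrtrM ?sqr_ge0 // sqrtr_sqr gtr0_norm; first by rewrite mulrAC.
by rewrite divr_gt0 ?jlt_E_gt0 // mulr_gt0 ?jlt_s_gt0 ?jlt_r_gt0.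
Qed.

Lemma jlt_row_free x y : row_free (jacobian F x y).
Proof.
have d0 : \det (metric F x y) != 0.
  rewrite (det_metric (jlt_UU x y) (jlt_VV x y) (jlt_UV x y)).
  by rewrite mulf_neq0 ?jlt_E_neq0 ?jlt_G_neq0.
have u : metric F x y \in unitmx by rewrite unitmxE unitfE.
apply/row_freeP; exists ((jacobian F x y)^T *m invmx (metric F x y)).
by rewrite mulmxA mulmxV.
Qed.

(** ** Second fundamental form

    The surface is Lagrangian, so that multiplication by [i] maps the
    coordinate frame to a frame of the normal bundle. *)

Definition jlt_N1 (x y : R) :=
  vec4 (- (r y * sin (phi y))) (r y * cos (phi y)) 0 (- x).
Definition jlt_N2 (x y : R) :=
  vec4 (- (x * (c2 y / r y))) (x * (c1 y / r y)) (- (s y)^-1) y.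

Notation N1 := jlt_N1.
Notation N2 := jlt_N2.

Lemma jlt_UN1 x y : dotp (partial F 0 x y) (N1 x y) = 0.
Proof. by rewrite jlt_partial0 dotp_vec4; ring. Qed.

Lemma jlt_UN2 x y : dotp (partial F 0 x y) (N2 x y) = 0.
Proof.
rewrite jlt_partial0 dotp_vec4.
transitivity (- x * (cos (phi y) * c2 y - sin (phi y) * c1 y) + x / s y).
  by field; rewrite jlt_r_neq0 ?jlt_s_neq0.
by rewrite jlt_rotS mulNr addNr.
Qed.

Lemma jlt_VN1 x y : dotp (partial F 1 x y) (N1 x y) = 0.
Proof.
rewrite jlt_partial1 dotp_vec4.
transitivity (x * (cos (phi y) * c2 y - sin (phi y) * c1 y) - x / s y).
  by field; rewrite jlt_r_neq0 ?jlt_s_neq0.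
by rewrite jlt_rotS subrr.
Qed.

Lemma jlt_VN2 x y : dotp (partial F 1 x y) (N2 x y) = 0.
Proof.
by rewrite jlt_partial1 dotp_vec4; field; rewrite jlt_r_neq0 ?jlt_s_neq0.
Qed.

Lemma jlt_N11 x y : dotp (N1 x y) (N1 x y) = E x y.
Proof. by rewrite -jlt_UU jlt_partial0 !dotp_vec4; ring. Qed.

Lemma jlt_N22 x y : dotp (N2 x y) (N2 x y) = G x y.
Proof. by rewrite -jlt_VV jlt_partial1 !dotp_vec4; ring. Qed.

Lemma jlt_N12 x y : dotp (N1 x y) (N2 x y) = 0.
Proof.
rewrite dotp_vec4.
transitivity (x * (cos (phi y) * c1 y + sin (phi y) * c2 y) - x * y).
  by field; rewrite jlt_r_neq0 ?jlt_s_neq0.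
by rewrite jlt_rotC subrr.
Qed.

Lemma jlt_normal_part x y v : normal_part F x y v =
  (dotp v (N1 x y) / E x y) *: N1 x y + (dotp v (N2 x y) / G x y) *: N2 x y.
Proof.
exact: (normal_part_frame (jlt_UU x y) (jlt_VV x y) (jlt_UV x y)
  (jlt_E_neq0 x y) (jlt_G_neq0 x y) (jlt_UN1 x y) (jlt_UN2 x y)
  (jlt_VN1 x y) (jlt_VN2 x y) (jlt_N11 x y) (jlt_N22 x y) (jlt_N12 x y)
  (jlt_E_neq0 x y) (jlt_G_neq0 x y)).
Qed.

Lemma jlt_partial00 x y : partial (partial F 0) 0 x y = vec4 0 0 (- 1) 0.
Proof.
by rewrite jlt_partial0; apply: partial0_vec4; exact: is_derive_cst.
Qed.

Lemma jlt_partial01 x y :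
  partial (partial F 1) 0 x y = vec4 (c1 y / r y) (c2 y / r y) 0 0.
Proof.
rewrite jlt_partial1; apply: partial0_vec4.
- by apply: is_derive_eq; rewrite /GRing.scale /=; ring.
- by apply: is_derive_eq; rewrite /GRing.scale /=; ring.
- exact: is_derive_cst.
- exact: is_derive_cst.
Qed.

Lemma jlt_partial10 x y :
  partial (partial F 0) 1 x y = vec4 (c1 y / r y) (c2 y / r y) 0 0.
Proof.
have ? := is_derive_cos_phi y; have ? := is_derive_sin_phi y.
have ? := is_derive_jlt_r a0 y.
rewrite jlt_partial0; apply: partial1_vec4.
- apply: is_derive_eq; rewrite /GRing.scale /jlt_c1 /=; field.
  by rewrite jlt_r_neq0 ?jlt_s_neq0.
- apply: is_derive_eq; rewrite /GRing.scale /jlt_c2 /=; field.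
  by rewrite jlt_r_neq0 ?jlt_s_neq0.
Qed.

(** With [w = y + i / s], this is the derivative
    [exp (i phi) (w' / r - |w|^2 / r^3)] of [exp (i phi) w / r]. *)
Lemma jlt_partial11 x y : partial (partial F 1) 1 x y = vec4
  (x * (cos (phi y) * ((r y)^-1 - W y / r y ^+ 3) +
        sin (phi y) * (ds y / (s y ^+ 2 * r y))))
  (x * (sin (phi y) * ((r y)^-1 - W y / r y ^+ 3) -
        cos (phi y) * (ds y / (s y ^+ 2 * r y))))
  1 (- ds y / s y ^+ 2).
Proof.
have ? := is_derive_cos_phi y; have ? := is_derive_sin_phi y.
have ? := is_derive_rV y; have ? := is_derive_sV y.
rewrite jlt_partial1; apply: partial1_vec4.
- apply: is_derive_eq; rewrite /GRing.scale /jlt_W /jlt_c1 jlt_QsE // /=; field.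
  by rewrite jlt_r_neq0 ?jlt_s_neq0.
- apply: is_derive_eq; rewrite /GRing.scale /jlt_W /jlt_c2 jlt_QsE // /=; field.
  by rewrite jlt_r_neq0 ?jlt_s_neq0.
Qed.

(** The component of [F_yy] along the normal vector [i F_y]. *)
Definition jlt_h x y := - (W y / s y) * (b * E x y + 1) / r y ^+ 2.

Lemma jlt_yyN1 x y : dotp (partial (partial F 1) 1 x y) (N1 x y) = 0.
Proof.
rewrite jlt_partial11 dotp_vec4.
transitivity (x * ds y / s y ^+ 2 * (1 - (cos (phi y) ^+ 2 + sin (phi y) ^+ 2))).
  by field; rewrite jlt_r_neq0 ?jlt_s_neq0.
by rewrite cos2Dsin2 subrr mulr0.
Qed.

(** The derivative of [s] is eliminated by means of its differential equation. *)
Lemma jlt_yyN2 x y : dotp (partial (partial F 1) 1 x y) (N2 x y) = jlt_h x y.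
Proof.
rewrite jlt_partial11 dotp_vec4.
have r0 := jlt_r_neq0 a0 y; have s0 := jlt_s_neq0 a0 b0 y.
pose A := (r y)^-1 - W y / r y ^+ 3; pose B := ds y / (s y ^+ 2 * r y).
rewrite -/A -/B.
transitivity (x ^+ 2 / r y * (- A * (cos (phi y) * c2 y - sin (phi y) * c1 y)
   - B * (cos (phi y) * c1 y + sin (phi y) * c2 y)) - (s y)^-1
   - ds y * y / s y ^+ 2).
  by rewrite /A /B; field; rewrite r0 s0.
rewrite jlt_rotC jlt_rotS /A /B.
have ode := jlt_s_ode a0 b0 y.
have -> : ds y * y / s y ^+ 2 = W y * (1 + b * r y ^+ 2) / (s y * r y ^+ 2) - (s y)^-1.
  rewrite /jlt_W; move: ode; set q := Q y; move=> ode.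
  have -> : q / s y ^+ 2 * (1 + b * r y ^+ 2) / (s y * r y ^+ 2) =
    q * (1 + b * r y ^+ 2) / (s y ^+ 3 * r y ^+ 2) by field; rewrite r0 s0.
  by rewrite -ode; field; rewrite r0 s0.
have -> : - ((r y)^-1 - W y / r y ^+ 3) / s y - ds y / (s y ^+ 2 * r y) * y =
   - (ds y * y / s y ^+ 2 + (s y)^-1) / r y + W y / (r y ^+ 3 * s y).
  by field; rewrite r0 s0.
have -> : ds y * y / s y ^+ 2 = W y * (1 + b * r y ^+ 2) / (s y * r y ^+ 2) - (s y)^-1.
  rewrite /jlt_W; move: ode; set q := Q y; move=> ode.
  have -> : q / s y ^+ 2 * (1 + b * r y ^+ 2) / (s y * r y ^+ 2) =
    q * (1 + b * r y ^+ 2) / (s y ^+ 3 * r y ^+ 2) by field; rewrite r0 s0.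
  by rewrite -ode; field; rewrite r0 s0.
by rewrite /jlt_h /jlt_E; field; rewrite r0 s0.
Qed.

Lemma jlt_second_ff00 x y :
  second_ff F x y 0 0 = (1 / (s y * G x y)) *: N2 x y.
Proof.
rewrite /second_ff jlt_partial00 jlt_normal_part !dotp_vec4.
rewrite !(mul0r, mulr0, addr0, add0r) scale0r add0r; congr (_ *: _).
by field; rewrite jlt_s_neq0 ?jlt_G_neq0.
Qed.

Lemma jlt_second_ff_xy x y :
  normal_part F x y (vec4 (c1 y / r y) (c2 y / r y) 0 0) =
  (1 / (s y * E x y)) *: N1 x y.
Proof.
rewrite jlt_normal_part !dotp_vec4.
have r0 := jlt_r_neq0 a0 y; have s0 := jlt_s_neq0 a0 b0 y.
rewrite -[RHS]addr0; congr (_ + _).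
  congr (_ *: _).
  transitivity ((cos (phi y) * c2 y - sin (phi y) * c1 y) / E x y).
    by field; rewrite r0 jlt_E_neq0.
  by rewrite jlt_rotS; field; rewrite s0 jlt_E_neq0.
by apply/eqP; rewrite scaler_eq0; apply/orP; left; apply/eqP; ring.
Qed.

Lemma jlt_second_ff11 x y :
  second_ff F x y 1 1 = (jlt_h x y / G x y) *: N2 x y.
Proof.
by rewrite /second_ff jlt_normal_part jlt_yyN1 jlt_yyN2 mul0r scale0r add0r.
Qed.

(** The terms of [F_xx] and [F_yy] in [1 / E] cancel in the trace. *)
Lemma jlt_mean_curvature x y :
  mean_curvature F x y = (- b / (s y * G x y)) *: N2 x y.
Proof.
rewrite (mean_curvatureE (jlt_UU x y) (jlt_VV x y) (jlt_UV x y)) ?jlt_E_neq0 ?jlt_G_neq0 //.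
rewrite jlt_second_ff00 jlt_second_ff11 !scalerA -scalerDl; congr (_ *: _).
have r0 := jlt_r_neq0 a0 y; have s0 := jlt_s_neq0 a0 b0 y.
have E0 := jlt_E_neq0 x y; have W0 := jlt_W_neq0 y.
by rewrite /jlt_h /jlt_G; field; rewrite r0 s0 E0 W0.
Qed.

Lemma jlt_normal_vector x y :
  normal_part F x y (jlt_vector b) = (- b / (s y * G x y)) *: N2 x y.
Proof.
rewrite (_ : jlt_vector b = vec4 0 0 b 0) // jlt_normal_part !dotp_vec4.
rewrite !(mul0r, mulr0, addr0, add0r) scale0r add0r; congr (_ *: _).
by field; rewrite jlt_s_neq0 ?jlt_G_neq0.
Qed.

Lemma jlt_mean_curvature_sqr x y : enorm (mean_curvature F x y) ^+ 2 =
  b ^+ 2 / (a * E x y) * expR (- (b * y ^+ 2)).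
Proof.
rewrite enorm_sqr jlt_mean_curvature dotpZl dotpZr jlt_N22 expRN.
have r0 := jlt_r_neq0 a0 y; have s0 := jlt_s_neq0 a0 b0 y.
have E0 := jlt_E_neq0 x y; have e0 : expR (b * y ^+ 2) != 0 by rewrite expR_eq0.
rewrite /jlt_G /jlt_W jlt_QE' //; field.
by rewrite r0 s0 E0 e0 gt_eqF.
Qed.

(** With [i = 1 / E <= a], the squared norm of the second fundamental form is
    [(3 i^3 / a + i (b + i)^2 / a) exp (- b y^2)]. *)
Lemma jlt_bounded_second_ff : bounded_second_ff F.
Proof.
exists (Num.sqrt (3 * a ^+ 2 + (b + a) ^+ 2)) => x y.
rewrite (second_ff_normE (jlt_UU x y) (jlt_VV x y) (jlt_UV x y)) ?jlt_E_neq0 ?jlt_G_neq0 //.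
have -> : second_ff F x y 0 1 = (1 / (s y * E x y)) *: N1 x y.
  by rewrite /second_ff jlt_partial01 jlt_second_ff_xy.
have -> : second_ff F x y 1 0 = (1 / (s y * E x y)) *: N1 x y.
  by rewrite /second_ff jlt_partial10 jlt_second_ff_xy.
rewrite jlt_second_ff00 jlt_second_ff11 !dotpZl !dotpZr jlt_N11 jlt_N22.
have r0 := jlt_r_neq0 a0 y; have s0 := jlt_s_neq0 a0 b0 y.
have E0 := jlt_E_neq0 x y.
have ea : (E x y)^-1 <= a.
  rewrite -[leRHS]invrK lef_pV2 ?posrE ?invr_gt0 ?jlt_E_gt0 //.
  by rewrite /jlt_E jlt_r_sqr // -addrA lerDl addr_ge0 ?sqr_ge0.
have E1 : 0 < (E x y)^-1 by rewrite invr_gt0 jlt_E_gt0.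
have e1 : expR (- (b * y ^+ 2)) <= 1.
  by rewrite -expR0 ler_expR oppr_le0 mulr_ge0 ?sqr_ge0 // ltW.
have e2 := expR_gt0 (- (b * y ^+ 2)).
rewrite ler_sqrt; last by rewrite addr_ge0 ?sqr_ge0 // mulr_ge0 ?sqr_ge0.
have k0 : expR (b * y ^+ 2) != 0 by rewrite expR_eq0.
have a1 : a != 0 by rewrite gt_eqF.
set e := expR _ in e1 e2; set i := (E x y)^-1 in ea E1.
rewrite [leLHS](_ : _ = (3 * (i / a) * i ^+ 2 + i / a * (b + i) ^+ 2) * e).
  have ia : i / a <= 1 by rewrite ler_pdivrMr // mul1r.
  have ia0 : 0 < i / a by rewrite divr_gt0.
  have i2 : i ^+ 2 <= a ^+ 2 by rewrite lerXn2r // nnegrE ltW.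
  have bi2 : (b + i) ^+ 2 <= (b + a) ^+ 2.
    by rewrite lerXn2r // ?nnegrE ?addr_ge0 ?lerD2l // ltW.
  have t1 : i / a * i ^+ 2 <= a ^+ 2.
    by rewrite -[leRHS]mul1r ler_pM // ?sqr_ge0 ?ltW.
  have t2 : i / a * (b + i) ^+ 2 <= (b + a) ^+ 2.
    by rewrite -[leRHS]mul1r ler_pM // ?sqr_ge0 ?ltW.
  apply: (@le_trans _ _ (3 * (i / a) * i ^+ 2 + i / a * (b + i) ^+ 2)).
    rewrite ler_piMr // addr_ge0 // mulr_ge0 ?sqr_ge0 ?(ltW ia0) //.
    by rewrite mulr_ge0 // ltW.
  lra.
rewrite /e expRN /i /jlt_G /jlt_h /jlt_W jlt_QE' //; field.
by rewrite r0 s0 E0 k0 a1.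
Qed.

(** ** Lagrangian angle and Kaehler angle *)

End Geometry.

(** * The complex structure and the Kaehler angle *)

Section Kaehler.
Variable R : realType.

(** The second complex structure of a hyperkaehler triple: its Kaehler form is
    the imaginary part of the holomorphic volume form, so that on a Lagrangian
    surface the cosine of its Kaehler angle is the sine of the Lagrangian
    angle. *)
Definition imvol_structure : 'M[R]_4 := \matrix_(i < 4)
  [:: vec4 0 0 0 1; vec4 0 0 1 0; vec4 0 (- 1) 0 0; vec4 (- 1) 0 0 0]`_i.

Notation J := imvol_structure.

Lemma mulmx_imvol (u : 'rV[R]_4) : u *m J =
  vec4 (- u 0 (inord 3)) (- u 0 (inord 2)) (u 0 1) (u 0 0).
Proof.
by apply/rowP; apply: forall_ord4;
  rewrite mxE sum_ord4 !mxE /= ?inordK //= !mxE /= ?inordK //=; ring.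
Qed.

Lemma imvol_compatible : compatible_complex_structure J.
Proof.
have JJ : J *m J = - 1%:M.
  apply/row_matrixP => i; rewrite row_mul -[J in row i J]mul1mx row_mul.
  rewrite linearN /=; move: (row i 1%:M) => u.
  rewrite !mulmx_imvol !vec4E; apply/rowP; apply: forall_ord4;
    by rewrite vec4E mxE.
split=> //; suff -> : J^T = - J by rewrite mulmxN JJ opprK.
by apply/matrixP; apply: forall_ord4; apply: forall_ord4;
  rewrite !mxE /= ?inordK //= ?mxE /= ?inordK //= ?oppr0 ?opprK.
Qed.

Lemma det_mx2 (B : 'M[R]_2) : \det B = B 0 0 * B 1 1 - B 0 1 * B 1 0.
Proof.
rewrite (expand_det_row _ 0) sum_ord2 /cofactor !det_mx11 !mxE /=.
have -> : lift 0 0 = 1 :> 'I_2 by apply: val_inj.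
have -> : lift 1 0 = 0 :> 'I_2 by apply: val_inj.
by rewrite expr0 expr1; ring.
Qed.

Definition imvol (u v : 'rV[R]_4) : R := dotp (u *m J) v.

Lemma imvolE u v : imvol u v = u 0 0 * v 0 (inord 3) + u 0 1 * v 0 (inord 2) -
  u 0 (inord 2) * v 0 1 - u 0 (inord 3) * v 0 0.
Proof. by rewrite /imvol mulmx_imvol dotpE !vec4E; ring. Qed.

(** An oriented orthonormal frame has the coordinates of determinant
    [(det g)^(-1/2)], so that the cosine of the Kaehler angle can be read off the
    coordinate frame. *)
Lemma cos_kahler_angleE (F : R -> R -> 'rV[R]_4) (x y : R) (A : 'M[R]_(2, 4)) :
  oriented_frame F x y A ->
  cos_kahler_angle J A * Num.sqrt (\det (metric F x y)) =
  imvol (partial F 0 x y) (partial F 1 x y).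
Proof.
move=> [AA [B B0 AE]].
have dB : \det B ^+ 2 * \det (metric F x y) = 1.
  rewrite -(det1 R 2) -AA AE trmx_mul mulmxA -(mulmxA B) !det_mulmx det_tr.
  by rewrite /metric; ring.
have g0 : 0 < \det (metric F x y).
  by rewrite -(pmulr_rgt0 _ (exprn_gt0 2 B0)) dB.
have dB' : \det B * Num.sqrt (\det (metric F x y)) = 1.
  have : (\det B * Num.sqrt (\det (metric F x y))) ^+ 2 = 1 ^+ 2.
    by rewrite exprMn sqr_sqrtr ?dB ?expr1n // ltW.
  by move/pexpIrn; apply=> //; rewrite ?nnegrE ?mulr_ge0 ?sqrtr_ge0 // ltW.
have rowA i j : A i j = B i 0 * partial F 0 x y 0 j + B i 1 * partial F 1 x y 0 j.
  by rewrite AE mxE sum_ord2 !mxE.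
suff -> : cos_kahler_angle J A =
    \det B * imvol (partial F 0 x y) (partial F 1 x y).
  by rewrite mulrAC dB' mul1r.
rewrite /cos_kahler_angle -/(imvol _ _) !imvolE.
have rE i j : row i A 0 j = A i j by rewrite mxE.
rewrite !rE !rowA det_mx2.
move: (partial F 0 x y) (partial F 1 x y) => U V; ring.
Qed.

End Kaehler.

Section JLTKaehler.
Variables (R : realType) (a b : R).
Hypotheses (a0 : 0 < a) (b0 : 0 < b).

Lemma jlt_imvol x y :
  imvol (partial (jlt_map a b) 0 x y) (partial (jlt_map a b) 1 x y) =
  sin (jlt_theta a b y) * Num.sqrt (\det (metric (jlt_map a b) x y)).
Proof.
rewrite jlt_sqrt_det // sin_jlt_theta // imvolE jlt_partial0 // jlt_partial1 //.
rewrite !vec4E.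
have r0 := jlt_r_neq0 a0 y; have s0 := jlt_s_neq0 a0 b0 y.
have q0 : Num.sqrt (jlt_Q a b y) != 0 by rewrite gt_eqF // sqrtr_gt0 jlt_Q_gt0.
rewrite /jlt_c2 /jlt_E; move: (Num.sqrt _) q0 => q q0.
by field; rewrite r0 s0 q0.
Qed.

(** The holomorphic volume form of the frame [F_x], [F_y] is
    [exp (i phi) w E / r], of argument [theta]. *)
Lemma jlt_cos_kahler_angle x y A : oriented_frame (jlt_map a b) x y A ->
  cos_kahler_angle (imvol_structure R) A = sin (jlt_theta a b y).
Proof.
move=> fA; have d0 : Num.sqrt (\det (metric (jlt_map a b) x y)) != 0.
  rewrite jlt_sqrt_det // gt_eqF // divr_gt0 ?mulr_gt0 //.
  - exact: jlt_E_gt0.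
  - by rewrite sqrtr_gt0 jlt_Q_gt0.
  - exact: jlt_s_gt0.
  - exact: jlt_r_gt0.
by apply: (mulIf d0); rewrite cos_kahler_angleE // jlt_imvol.
Qed.

Lemma jlt_cos_kahler_angle_ge : cos_kahler_angle_ge (imvol_structure R)
  (jlt_map a b) (sin (jlt_phibar a b)).
Proof. by move=> x y A /jlt_cos_kahler_angle ->; exact: jlt_sin_theta_ge. Qed.

Lemma jlt_symplectic : symplectic (imvol_structure R) (jlt_map a b).
Proof.
move=> x y A fA; apply: lt_le_trans (jlt_cos_kahler_angle_ge fA).
apply: sin_gt0_pihalf; rewrite jlt_phibar_gt0 // jlt_phibar_lt //.
Qed.

End JLTKaehler.

(** * The limit angle approaches [pi / 2] *)

Section LimitAngle.
Variable R : realType.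

(** For [a = 1] and small [b], the integrand of [phi] is at least
    [c / (1 + t^2)] on [0, y], with [c] close to [1]. *)
Lemma jlt_phibar_ge (b y c : R) : 0 < b -> 0 < y -> 0 < c ->
  expR (b * y ^+ 2) * (1 + b) <= c ^- 2 -> c * atan y <= jlt_phibar 1 b.
Proof.
move=> b0 y0 c0 hc.
apply: le_trans (jlt_phi_le_phibar ltr01 b0 y).
pose f t := jlt_phi 1 b t - c * atan t.
have df (t : R) : is_derive t 1 f
    (jlt_phi_integrand 1 b t - c * (1 + t ^+ 2)^-1).
  have ? := is_derive_jlt_phi ltr01 b0 t.
  by apply: is_derive_eq; rewrite /GRing.scale.
have cf : continuous f.
  by move=> t; apply: differentiable_continuous; apply/derivable1_diffP; case: (df t).
have f0 : f 0 = 0 by rewrite /f jlt_phi0 atan0 mulr0 subr0.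
suff : f 0 <= f y by rewrite f0 subr_ge0.
apply: (@ger0_derive1_ndecr _ f 0 y) => //; rewrite ?lexx ?(ltW y0) //.
- move=> t; rewrite in_itv /= => /andP[t0 ty].
  rewrite (is_derive_derive1 (df t)) subr_ge0 /jlt_phi_integrand invr1 invfM.
  have t2 : 0 < 1 + t ^+ 2 by rewrite ltr_pwDl // sqr_ge0.
  rewrite mulrC ler_wpM2l ?invr_ge0 ?(ltW t2) //.
  rewrite -[leLHS]invrK lef_pV2 ?posrE ?invr_gt0 ?sqrtr_gt0 ?jlt_P_gt0 //.
  rewrite -[leRHS](gtr0_norm (_ : 0 < c^-1)) ?invr_gt0 // -sqrtr_sqr.
  rewrite ler_sqrt ?sqr_ge0 // exprVn; apply: le_trans hc.
  have u0 : 0 <= b * t ^+ 2 by rewrite mulr_ge0 ?sqr_ge0 // ltW.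
  have uy : b * t ^+ 2 <= b * y ^+ 2.
    by rewrite ler_wpM2l ?(ltW b0) // lerXn2r ?nnegrE // ltW.
  apply: (@le_trans _ _ (expR (b * t ^+ 2) * (1 + b))); last first.
    by rewrite ler_wpM2r ?ler_expR // addr_ge0 // ltW.
  rewrite jlt_PE mul1r mulrDr mulr1 lerD2l mulrC ler_wpM2r ?(ltW b0) //.
  have [->|u1] := eqVneq (b * t ^+ 2) 0; first by rewrite emoment00 expR0.
  have {}u0 : 0 < b * t ^+ 2 by rewrite lt_neqAle eq_sym u1.
  rewrite -(ler_pM2l u0) emoment0M.
  have := expR_ge1Dx (- (b * t ^+ 2)); rewrite expRN => h.
  have e0 := expR_gt0 (b * t ^+ 2).
  have : (1 - b * t ^+ 2) * expR (b * t ^+ 2) <= 1.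
    by rewrite -ler_pdivlMr // mul1r.
  lra.
- exact: continuous_subspaceT.
Qed.

Lemma jlt_phibar_near (e : R) : 0 < e ->
  exists2 b : R, 0 < b & pi / 2 - e < jlt_phibar 1 b.
Proof.
move=> e0.
have p0 : 0 < pi / 2 :> R by rewrite divr_gt0 // pi_gt0.
(* [(pi/2 - d) (1 - d) > pi/2 - e] for this [d] *)
pose d := Num.min (1 / 2) (e / (2 + pi)).
have d0 : 0 < d.
  by rewrite lt_min divr_gt0 // divr_gt0 // addr_gt0 // pi_gt0.
have [d1 d2] : d <= 1 / 2 /\ d * (2 + pi) <= e.
  split; first by rewrite ge_min lexx.
  rewrite -ler_pdivlMr ?ge_min ?lexx ?orbT //.
  by rewrite addr_gt0 // pi_gt0.
have [y y1 hy] : exists2 y : R, 1 <= y & pi / 2 - d < atan y.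
  have /cvgrPdist_lt /(_ d d0) := @cvgy_atan R.
  move=> h; near +oo_R => y; exists y; first by near: y; exact: nbhs_pinfty_ge.
  have : `|pi / 2 - atan y| < d by near: y.
  by rewrite ltr_norml => /andP[_]; lra.
have y0 : 0 < y by exact: lt_le_trans y1.
(* [exp d (1 + d) <= (1 - d)^-2] since [exp d <= (1 - d)^-1] *)
pose b := d / y ^+ 2.
have y2 : 0 < y ^+ 2 by rewrite exprn_gt0.
have b0 : 0 < b by rewrite divr_gt0.
have bd : b <= d by rewrite ler_pdivrMr // ler_peMr ?(ltW d0) // exprn_ege1.
have c0 : 0 < 1 - d by lra.
exists b => //.
apply: lt_le_trans (jlt_phibar_ge b0 y0 c0 _).
  apply: (@le_lt_trans _ _ ((1 - d) * (pi / 2 - d))); last by rewrite ltr_pM2l.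
  have : 0 <= d ^+ 2 by rewrite sqr_ge0.
  rewrite expr2; lra.
rewrite /b divfK ?gt_eqF // -/b.
have e1 : expR d <= (1 - d)^-1.
  rewrite -[expR d]invrK -expRN lef_pV2 ?posrE ?expR_gt0 //.
  by have := expR_ge1Dx (- d).
have e2 : 1 + d <= (1 - d)^-1.
  rewrite -[leRHS]mul1r ler_pdivlMr //; nra.
apply: (@le_trans _ _ (expR d * (1 + d))).
  by rewrite ler_wpM2l ?expR_ge0 // lerD2l.
rewrite -exprVn expr2 ler_pM ?expR_ge0 //; lra.
Unshelve. all: by end_near. Qed.

Lemma jlt_sin_phibar_near (e : R) : 0 < e ->
  exists2 b : R, 0 < b & 1 - e <= sin (jlt_phibar 1 b).
Proof.
move=> e0.
have /cvgrPdist_lt /(_ e e0) := @continuous_sin R (pi / 2).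
rewrite sin_pihalf => -[d /= d0 hd].
have [b b0 hb] := jlt_phibar_near d0.
exists b => //; have h := jlt_phibar_lt ltr01 b0.
have : `|1 - sin (jlt_phibar 1 b)| < e.
  by apply: hd; rewrite /ball_ /= gtr0_norm ?subr_gt0 //; lra.
by rewrite ltr_norml => /andP[_]; lra.
Qed.

End LimitAngle.

(** * The surface is embedded *)

Lemma continuous_row (R : realType) (T : topologicalType) (n : nat)
    (f : T -> 'rV[R]_n) t :
  (forall j, {for t, continuous (fun t => f t 0 j)}) -> {for t, continuous f}.
Proof.
move=> cf A [B nB BA]; rewrite nbhs_filterE.
apply: (@filterS _ _ _ [set u | forall j, B 0 j (f u 0 j)]).
  by move=> u Bu; apply: BA => i j; rewrite ord1.
apply: filter_forall => j; exact: cf (nB 0 j).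
Qed.

Lemma partial_row (R : realType) (f : 'I_4 -> R -> R) (d : 'I_4 -> R) (x : R) :
  (forall j, is_derive x 1 (f j) (d j)) ->
  derivable (fun t => \row_j f j t) x 1 /\
  derive1 (fun t => \row_j f j t) x = \row_j d j.
Proof.
move=> df.
have e j : (fun t => (\row_j f j t : 'rV_4) 0 j) = f j.
  by apply/funext => t; rewrite mxE.
have D : derivable (fun t => \row_j f j t) x 1.
  by apply/derivable_mxP => i j; rewrite ord1 e; have [] := df j.
split=> //; rewrite derive1E derive_mx //; apply/rowP => j.
by rewrite !mxE e; have [] := df j.
Qed.

(** Maps quadratic in [x] with smooth coefficients in [y] are stable under both
    partial derivatives. *)
Definition quadratic_in_x (R : realType) (F : R -> R -> 'rV[R]_4) :=
  exists A B C : 'I_4 -> R -> R,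
    [/\ forall j, smooth (A j), forall j, smooth (B j), forall j, smooth (C j) &
        F = fun x y => \row_j (A j y + x * B j y + x ^+ 2 * C j y)].

Lemma quadratic_in_x_smooth (R : realType) (F : R -> R -> 'rV[R]_4) :
  quadratic_in_x F -> smooth_param F.
Proof.
move=> QF s /=; elim: s F QF => [|i s IH] F [A [B [C [sA sB sC ->]]]].
  split=> [x y|].
    split.
      have dx j : is_derive x 1 (fun t => A j y + t * B j y + t ^+ 2 * C j y)
          (B j y + 2 * x * C j y).
        by apply: is_derive_eq; rewrite /GRing.scale /=; ring.
      by have [] := partial_row dx.
    have dy j : is_derive y 1 (fun t => A j t + x * B j t + x ^+ 2 * C j t)
        (derive1 (A j) y + x * derive1 (B j) y + x ^+ 2 * derive1 (C j) y).
      have ? := smooth_derive y (sA j); have ? := smooth_derive y (sB j).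
      have ? := smooth_derive y (sC j).
      by apply: is_derive_eq; rewrite /GRing.scale /=; ring.
    by have [] := partial_row dy.
  move=> p; apply: continuous_row => j.
  rewrite (_ : (fun t => _) = (fun t : R * R =>
    A j t.2 + t.1 * B j t.2 + t.1 ^+ 2 * C j t.2)); last first.
    by apply/funext => t; rewrite mxE.
  have cs f : smooth f -> f (t : R * R).2 @[t --> p] --> f p.2.
    move=> sf; apply: continuous_cvg; first exact: smooth_continuous.
    exact: cvg_snd.
  apply: cvgD; first (apply: cvgD; first exact: cs); apply: cvgM;
    (try exact: cs); (try exact: cvg_fst).
  rewrite expr2; apply: (@cvgM _ _ _ _ (fst : R * R -> R) fst); exact: cvg_fst.
apply: IH; have [->|->] : i = 0 \/ i = 1.
- by case: i => -[|[|//]] ?; [left | right]; apply: val_inj.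
- exists B, (fun j y => 2 * C j y), (fun _ _ => 0); split=> // [j|j|].
  + by apply: smoothM; [exact: smooth_cst|].
  + exact: smooth_cst.
  apply/funext => x; apply/funext => y.
  have dx j : is_derive x 1 (fun t => A j y + t * B j y + t ^+ 2 * C j y)
      (B j y + 2 * x * C j y).
    by apply: is_derive_eq; rewrite /GRing.scale /=; ring.
  have [_ e] := partial_row dx; apply: etrans e _.
  by apply/rowP => j; rewrite !mxE; ring.
- exists (fun j => derive1 (A j)), (fun j => derive1 (B j)),
    (fun j => derive1 (C j)).
  split=> [j|j|j|]; try exact: smooth_derive1.
  apply/funext => x; apply/funext => y.
  have dy j : is_derive y 1 (fun t => A j t + x * B j t + x ^+ 2 * C j t)
      (derive1 (A j) y + x * derive1 (B j) y + x ^+ 2 * derive1 (C j) y).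
    have ? := smooth_derive y (sA j); have ? := smooth_derive y (sB j).
    have ? := smooth_derive y (sC j).
    by apply: is_derive_eq; rewrite /GRing.scale /=; ring.
  by have [_ e] := partial_row dy; apply: etrans e _.
Qed.

Section Embedding.
Variables (R : realType) (a b : R).
Hypotheses (a0 : 0 < a) (b0 : 0 < b).

Notation phi := (jlt_phi a b).
Notation s := (jlt_s a b).
Notation r := (jlt_r a).
Notation theta := (jlt_theta a b).
Notation F := (jlt_map a b).

Lemma jlt_map_smooth : smooth_param F.
Proof.
apply: quadratic_in_x_smooth.
pose A (j : 'I_4) y := [:: 0; 0; y ^+ 2 * 2^-1; - b^-1 * theta y]`_j.
pose B (j : 'I_4) y := [:: r y * cos (phi y); r y * sin (phi y); 0; 0]`_j.
pose C (j : 'I_4) (y : R) := [:: 0; 0; - 2^-1; 0]`_j : R.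
have [ssin scos] := smooth_sin_cos R.
have sphi := smooth_jlt_phi a0 b0; have sr := smooth_jlt_r a0.
exists A, B, C; split.
- apply: forall_ord4; rewrite /A /= ?inordK //=; try exact: smooth_cst.
    by apply: smoothM; [apply: smoothX; exact: smooth_id | exact: smooth_cst].
  by apply: smoothM; [exact: smooth_cst | exact: smooth_jlt_theta].
- apply: forall_ord4; rewrite /B /= ?inordK //=; try exact: smooth_cst;
    by apply: smoothM => //; exact: smooth_comp.
- by apply: forall_ord4; rewrite /C /= ?inordK //=; exact: smooth_cst.
- rewrite jlt_mapE; apply/funext => x; apply/funext => y.
  by apply/rowP; apply: forall_ord4; rewrite vec4E mxE /A /B /C /= ?inordK //=; ring.
Qed.

(** ** The inverse of the parametrization *)

(** The angle [theta] is a multiple of the last coordinate and determines [y];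
    rotating the first complex coordinate back by [phi y] then gives [x]. *)
Definition jlt_theta_inv t := xget 0 [set y | theta y = t].

Lemma jlt_thetaK : cancel theta jlt_theta_inv.
Proof.
move=> y; apply: (jlt_theta_inj a0 b0).
by apply: (@xgetPex _ 0 [set z | theta z = theta y]); exists y.
Qed.

Lemma is_derive_jlt_theta_inv (y : R) :
  is_derive (theta y) 1 jlt_theta_inv (- b / s y)^-1.
Proof.
apply: is_derive_inverse.
- by near=> z; exact: jlt_thetaK.
- by near=> z; exact: smooth_continuous (smooth_jlt_theta a0 b0) z.
- exact: is_derive_jlt_theta.
- by rewrite mulf_neq0 ?oppr_eq0 ?invr_eq0 ?jlt_s_neq0 // gt_eqF.
Unshelve. all: by end_near. Qed.

Definition jlt_inv (v : 'rV[R]_4) : R * R :=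
  let y := jlt_theta_inv (- b * v 0 (inord 3)) in
  ((v 0 0 * cos (phi y) + v 0 1 * sin (phi y)) / r y, y).

Lemma jlt_map3 x y : - b * F x y 0 (inord 3) = theta y.
Proof. by rewrite jlt_mapE vec4E mulrA mulrNN mulfV ?mul1r // gt_eqF. Qed.

Lemma jlt_mapK : cancel (param_map F) jlt_inv.
Proof.
move=> [x y]; rewrite /jlt_inv /param_map /= jlt_map3 jlt_thetaK; congr (_, _).
rewrite jlt_mapE !vec4E.
transitivity (x * (cos (phi y) ^+ 2 + sin (phi y) ^+ 2)).
  by field; exact: jlt_r_neq0.
by rewrite cos2Dsin2 mulr1.
Qed.

(** By the inverse function theorem, the inverse of [theta] is continuous at each of
    its values as a function on the whole line, so that no relative topology is
    involved. *)
Lemma jlt_inv_continuous : {in range (param_map F), continuous jlt_inv}.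
Proof.
pose Y (v : 'rV[R]_4) : R := jlt_theta_inv (- b * v 0 (inord 3)).
pose X (v : 'rV[R]_4) : R :=
  (v 0 0 * cos (phi (Y v)) + v 0 1 * sin (phi (Y v))) / r (Y v).
have key (v0 : 'rV[R]_4) :
    {for - b * v0 0 (inord 3), continuous jlt_theta_inv} ->
    (X v, Y v) @[v --> v0] --> (X v0, Y v0).
  move=> ci.
  have cj j : (fun v : 'rV[R]_4 => v 0 j) v @[v --> v0] --> v0 0 j.
    exact: coord_continuous.
  have cY : Y v @[v --> v0] --> Y v0.
    have c1 : - b * v 0 (inord 3) @[v --> v0] --> - b * v0 0 (inord 3).
      by apply: cvgMr; exact: cj.
    exact: cvg_comp c1 ci.
  have cc f : smooth f -> f (Y v) @[v --> v0] --> f (Y v0).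
    by move=> /smooth_continuous cf; exact: cvg_comp cY (cf (Y v0)).
  have [ssin scos] := smooth_sin_cos R.
  have sphi := smooth_jlt_phi a0 b0; have sr := smooth_jlt_r a0.
  pose proof (cvgV (jlt_r_neq0 a0 (Y v0)) (cc _ sr)) as cr.
  have c1 := cc (fun y => cos (phi y)) (smooth_comp scos sphi).
  have c2 := cc (fun y => sin (phi y)) (smooth_comp ssin sphi).
  pose proof (cvgM (cvgD (cvgM (cj 0) c1) (cvgM (cj 1) c2)) cr) as cX.
  exact: cvg_pair cX cY.
move=> v; rewrite inE => -[[x y] _ <-]; apply: key.
rewrite jlt_map3.
apply: differentiable_continuous; apply/derivable1_diffP.
by have [] := is_derive_jlt_theta_inv y.
Qed.

Lemma jlt_embedded : embedded_surface F.
Proof.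
split; [exact: jlt_map_smooth | by move=> x y; exact: jlt_row_free |].
exists jlt_inv; first exact: jlt_mapK.
exact: continuous_in_subspaceT jlt_inv_continuous.
Qed.

Lemma jlt_translating_soliton : translating_soliton F (jlt_vector b).
Proof.
split; first exact: jlt_embedded.
by move=> x y; rewrite jlt_mean_curvature // jlt_normal_vector.
Qed.

(** ** Curves on the surface *)

(** In the chart, a smooth regular curve of the surface is a regular curve of class
    [C^1] of the plane. *)
Lemma jlt_curve_lift (c : R -> 'rV[R]_4) :
  (forall n t, derivable (derive1n n c) t 1) ->
  range c `<=` jlt_surface a b ->
  exists X Y X' Y' : R -> R,
    [/\ forall t : R, is_derive t 1 X (X' t) /\ is_derive t 1 Y (Y' t),
        continuous X' /\ continuous Y',
        forall t, c t = F (X t) (Y t) &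
        forall t, X' t = 0 -> Y' t = 0 -> derive1 c t = 0].
Proof.
move=> sc cS.
pose Z t := jlt_inv (c t).
pose X t := (Z t).1; pose Y t := (Z t).2.
have cE t : c t = F (X t) (Y t).
  have [p _ e] : jlt_surface a b (c t) by apply: cS; exists t.
  by rewrite /X /Y /Z -e jlt_mapK.
have cj j n (t : R) : derivable (fun t => derive1n n c t 0 j) t 1.
  by have /derivable_mxP := sc n t; apply.
pose c' j t := derive1 c t 0 j.
have dc j (t : R) : is_derive t 1 (fun t => c t 0 j) (c' j t).
  have d := sc 0 t; rewrite /c' derive1E derive_mx // mxE.
  by apply: DeriveDef => //; exact: (cj j 0).
have cc' j : continuous (c' j).
  move=> t; apply: differentiable_continuous; apply/derivable1_diffP.
  exact: (cj j 1 t).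
pose Y' (t : R) := (- b / s (Y t))^-1 * (- b * c' (inord 3) t).
have dY (t : R) : is_derive t 1 Y (Y' t).
  have d : is_derive t 1 (fun t => - b * c t 0 (inord 3)) (- b * c' (inord 3) t).
    have ? := dc (inord 3) t.
    by apply: is_derive_eq; rewrite /GRing.scale /=; ring.
  have := @is_derive1_comp _ jlt_theta_inv _ t _ _ _ d; apply.
  by rewrite cE jlt_map3; exact: is_derive_jlt_theta_inv.
have cY : continuous Y.
  by move=> t; apply: differentiable_continuous; apply/derivable1_diffP; case: (dY t).
have [ssin scos] := smooth_sin_cos R.
have sphi := smooth_jlt_phi a0 b0; have sr := smooth_jlt_r a0.
have cs := smooth_continuous (smooth_jlt_s a0 b0).
have cY' : continuous Y'.
  move=> t; apply: cvgM; last by apply: cvgMr; exact: cc'.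
  apply: cvgV; first by rewrite mulf_neq0 ?oppr_eq0 ?invr_eq0 ?jlt_s_neq0 // gt_eqF.
  apply: cvgMr; apply: cvgV; first by rewrite jlt_s_neq0.
  exact: cvg_comp (cY t) (cs (Y t)).
have dfY f (t : R) : smooth f ->
    is_derive t 1 (fun t => f (Y t)) (derive1 f (Y t) * Y' t).
  move=> sf; have ? := smooth_derive (Y t) sf.
  exact: (@is_derive1_comp _ f Y).
have cfY f : smooth f -> continuous (fun t => f (Y t)).
  by move=> /smooth_continuous cf t; exact: cvg_comp (cY t) (cf (Y t)).
pose g0 y := cos (phi y) * (r y)^-1; pose g1 y := sin (phi y) * (r y)^-1.
have sg0 : smooth g0.
  by apply: smoothM (smooth_comp scos sphi) (smoothV _ sr) => y; exact: jlt_r_neq0.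
have sg1 : smooth g1.
  by apply: smoothM (smooth_comp ssin sphi) (smoothV _ sr) => y; exact: jlt_r_neq0.
pose X' t := c t 0 0 * (derive1 g0 (Y t) * Y' t) + g0 (Y t) * c' 0 t +
  (c t 0 1 * (derive1 g1 (Y t) * Y' t) + g1 (Y t) * c' 1 t).
have XE : X = fun t => c t 0 0 * g0 (Y t) + c t 0 1 * g1 (Y t).
  by apply/funext => t; rewrite /X /Z /jlt_inv /= mulrDl !mulrA.
have dX (t : R) : is_derive t 1 X (X' t).
  rewrite XE; have := dc 0 t => ?; have := dc 1 t => ?.
  have := dfY _ t sg0 => ?; have := dfY _ t sg1 => ?.
  by apply: is_derive_eq; rewrite /GRing.scale.
have cc j : continuous (fun t => c t 0 j).
  move=> t; apply: differentiable_continuous; apply/derivable1_diffP.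
  by have [] := dc j t.
have cX' : continuous X'.
  have cg f j t : smooth f -> c t 0 j * (derive1 f (Y t) * Y' t) + f (Y t) * c' j t
      @[t --> t] --> c t 0 j * (derive1 f (Y t) * Y' t) + f (Y t) * c' j t.
    move=> sf; apply: cvgD; apply: cvgM; [exact: cc | | exact: cfY | exact: cc'].
    by apply: cvgM; [apply: cfY; exact: smooth_derive1 | exact: cY'].
  by move=> t; apply: cvgD; exact: cg.
exists X, Y, X', Y'; split=> // t X0 Y0.
have := dX t => dXt; have := dY t => dYt.
have d0 := dfY _ t (smoothM sr (smooth_comp scos sphi)).
have d1 := dfY _ t (smoothM sr (smooth_comp ssin sphi)).
have d2 := dfY _ t (smooth_jlt_theta a0 b0).
rewrite (_ : c = fun t => vec4 (X t * (r (Y t) * cos (phi (Y t))))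
    (X t * (r (Y t) * sin (phi (Y t)))) ((Y t ^+ 2 - X t ^+ 2) / 2)
    (- b^-1 * theta (Y t))); last first.
  by apply/funext => u; rewrite cE jlt_mapE !mulrA.
transitivity (vec4 0 0 0 0 : 'rV[R]_4).
  by apply: is_derive_vec4; apply: is_derive_eq;
    rewrite /GRing.scale /= ?X0 ?Y0; ring.
by apply/rowP; apply: forall_ord4; rewrite vec4E mxE.
Qed.

End Embedding.

(** * First homology of an embedded plane *)

Section FreeChains.
Variables (K : choiceType) (M : lmodType int) (f : K -> M).

Lemma fglift_sum (I : Type) (r : seq I) (F : I -> {freeg K / int}) :
  fglift f (\sum_(i <- r) F i) = \sum_(i <- r) fglift f (F i).
Proof.
have add0 : fglift f 0 = 0.
  by have := lift_is_additive f 0 0; rewrite !subrr.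
have addN x : fglift f (- x) = - fglift f x.
  by have := lift_is_additive f 0 x; rewrite add0 !sub0r.
elim: r => [|i r IH]; first by rewrite !big_nil.
by rewrite !big_cons -IH -[X in _ + X]opprK lift_is_additive addN opprK.
Qed.

Lemma freegU_scale (k : int) (x : K) : << k *g x >> = k *: << x >> :> {freeg K / int}.
Proof.
by apply/eqP/freeg_eqP => y; rewrite coeffZ !coeffU mul1r.
Qed.

Lemma freeg_chainE (z : {freeg K / int}) :
  z = \sum_(s <- dom z) coeff s z *: << s >>.
Proof.
by rewrite -[LHS]freeg_sumE; apply: eq_bigr => s _; rewrite freegU_scale.
Qed.

Lemma fglift_chain (z : {freeg K / int}) :
  fglift f z = \sum_(s <- dom z) coeff s z *: f s.
Proof.
rewrite [in LHS](freeg_chainE z) fglift_sum; apply: eq_bigr => s _.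
by rewrite -freegU_scale liftU.
Qed.

Lemma fgliftZ (k : int) (z : {freeg K / int}) : fglift f (k *: z) = k *: fglift f z.
Proof.
rewrite [in RHS]fglift_chain scaler_sumr [in LHS](freeg_chainE z) scaler_sumr.
rewrite fglift_sum; apply: eq_bigr => s _.
by rewrite scalerA -freegU_scale liftU scalerA.
Qed.

End FreeChains.

Section SingularChains.
Variables (R : realType) (S : set 'rV[R]_4) (k : nat).

Lemma singular_chain_sum (I : eqType) (r : seq I) (m : I -> int)
    (F : I -> formal_chain R k) :
  (forall i, i \in r -> singular_chain S (F i)) ->
  singular_chain S (\sum_(i <- r) m i *: F i).
Proof.
move=> SF s /dom_sum_subset /flattenP[/= l /mapP[i]].
rewrite filter_predT => ir -> /domZ_subset; exact: SF.
Qed.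

End SingularChains.

(** ** The standard simplex *)

Lemma std_simplex_le1 (R : realType) (k : nat) (t : 'rV[R]_k.+1) i :
  std_simplex t -> t 0 i <= 1.
Proof.
by move=> [t0 <-]; rewrite (bigD1 i) //= lerDl sumr_ge0.
Qed.

Lemma compact_std_simplex (R : realType) (k : nat) : compact (@std_simplex R k).
Proof.
have cc i : continuous (fun t : 'rV[R]_k.+1 => t 0 i) by exact: coord_continuous.
apply: bounded_closed_compact.
  exists 1; split; first exact: num_real.
  move=> M M1 t st /=; rewrite [leLHS]/Num.Def.normr /= mx_normrE.
  apply: bigmax_le; first by rewrite ltW // (lt_trans _ M1).
  move=> [i j] _ /=; rewrite ord1 ger0_norm; last by case: st.
  by rewrite (le_trans (std_simplex_le1 j st)) // ltW.
have -> : @std_simplex R k =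
    (\bigcap_(i in setT) ((fun t : 'rV[R]_k.+1 => t 0 i) @^-1` [set x | 0 <= x]))
    `&` ((fun t : 'rV[R]_k.+1 => \sum_(i < k.+1) t 0 i) @^-1` [set x | x = 1]).
  apply/seteqP; split=> t [t0 t1]; split=> // i; [by move=> _; exact: t0 | exact: t0].
apply: closedI.
  apply: closed_bigI => i _; apply: preimage_closed; last exact: closed_ge.
  by move=> t _; exact: cc.
apply: preimage_closed; last exact: closed_eq.
move=> t _.
have cs : \sum_(i < k.+1) u 0 i @[u --> t] --> \sum_(i < k.+1) t 0 i.
  by apply: cvg_big => [|i _]; [exact: add_continuous | exact: cc].
exact: cs.
Qed.

Section Coface.
Variables (R : realType) (k : nat).

(** Central projection from vertex [0] to the opposite face; the value at vertex
    [0] itself is [0] and not a point of the face. *)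
Definition simplex_base (n : nat) (t : 'rV[R]_n.+1) : 'rV[R]_n :=
  (1 - t 0 0)^-1 *: \row_j t 0 (lift 0 j).

Lemma coface_lift (i : 'I_k.+2) (t : 'rV[R]_k.+1) j :
  coface i t 0 (lift i j) = t 0 j.
Proof. by rewrite mxE liftK. Qed.

Lemma coface_self (i : 'I_k.+2) (t : 'rV[R]_k.+1) : coface i t 0 i = 0.
Proof. by rewrite mxE unlift_none. Qed.

Lemma coface_std (i : 'I_k.+2) (t : 'rV[R]_k.+1) :
  std_simplex t -> std_simplex (coface i t).
Proof.
move=> [t0 t1]; split=> [j|].
  by rewrite mxE; case: (unlift i j).
rewrite (bigD1_ord i) //= coface_self add0r -t1.
by apply: eq_bigr => j _; rewrite coface_lift.
Qed.

Lemma coface_lift00 (i : 'I_k.+2) (t : 'rV[R]_k.+2) :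
  coface (lift 0 i) t 0 0 = t 0 0.
Proof.
have e : lift (lift 0 i) 0 = 0 :> 'I_k.+3 by apply: val_inj.
by rewrite -[X in coface _ _ _ X]e mxE liftK.
Qed.

End Coface.

Lemma simplex_base_coface (R : realType) (k : nat) (i : 'I_k.+2) (t : 'rV[R]_k.+2) :
  simplex_base (coface (lift 0 i) t) = coface i (simplex_base t).
Proof.
apply/rowP => j; rewrite mxE coface_lift00 mxE [RHS]mxE.
case: (unliftP i j) => [l ->|->].
  have -> : lift 0 (lift i l) = lift (lift 0 i) (lift 0 l) :> 'I_k.+3.
    apply: val_inj; rewrite /= /bump !leq0n !add1n ltnS.
    by rewrite addnS.
  by rewrite coface_lift !mxE.
by rewrite coface_self mulr0.
Qed.

Lemma simplex_base_std (R : realType) k (t : 'rV[R]_k.+2) :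
  std_simplex t -> t 0 0 != 1 -> std_simplex (simplex_base t).
Proof.
move=> [t0 t1] tn1; rewrite big_ord_recl in t1.
have e : \sum_(i < k.+1) t 0 (lift 0 i) = 1 - t 0 0.
  by rewrite -t1 addrC addrA addNr add0r.
have p : 0 < 1 - t 0 0.
  rewrite lt_neqAle eq_sym subr_eq0 eq_sym tn1 /= -e; exact: sumr_ge0.
split=> [i|]; first by rewrite !mxE mulr_ge0 ?invr_ge0 // ltW.
under eq_bigr do rewrite !mxE.
by rewrite -big_distrr /= e mulVf // gt_eqF.
Qed.

Lemma within_continuous_chain (T U V : topologicalType) (A : set T) (B : set U)
    (f : T -> U) (g : U -> V) :
  {within A, continuous f} -> f @` A `<=` B -> {within B, continuous g} ->
  {within A, continuous (g \o f)}.
Proof.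
move=> /subspace_continuousP cf AB /subspace_continuousP cg.
apply/subspace_continuousP => x Ax W nW /=.
have Bfx : B (f x) by apply: AB; exists x.
have := cg _ Bfx _ nW; rewrite nbhs_simpl /= => nB.
have nA : nbhs x [set t | A t -> B (f t) -> W (g (f t))] := cf x Ax _ nB.
suff : nbhs x [set t | A t -> W (g (f t))] by [].
by apply: filterS nA => t h At; apply: (h At); apply: AB; exists t.
Qed.

(** ** The cone operator *)

Section Cone.
Variables (R : realType) (F : R -> R -> 'rV[R]_4) (G : 'rV[R]_4 -> R * R).
Hypotheses (cF : continuous (param_map F)) (FK : cancel (param_map F) G).
Let S := range (param_map F).
Hypothesis cG : {within S, continuous G}.

(** The cone over a singular simplex of the plane with apex the origin, carried
    to the surface. *)
Definition cone (k : nat) (s : 'rV[R]_k.+1 -> 'rV[R]_4) : 'rV[R]_k.+2 -> 'rV[R]_4 :=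
  patch (fun=> 0) (@std_simplex R k.+1)
    (fun t => param_map F ((1 - t 0 0) *: G (s (simplex_base t)))).

Definition cone_chain (k : nat) (c : formal_chain R k) : formal_chain R k.+1 :=
  fglift (fun s => << cone s >> : formal_chain R k.+1) c.

Lemma face_cone0 k (s : 'rV[R]_k.+1 -> 'rV[R]_4) :
  singular_simplex S s -> face 0 (cone s) = s.
Proof.
move=> [_ sS s0]; apply/funext => t; rewrite /face /patch.
case: ifPn => [|]; last by rewrite notin_setE => /s0.
rewrite inE => st /=; rewrite /cone /patch mem_set; last exact: coface_std.
rewrite coface_self subr0 scale1r.
have -> : simplex_base (coface 0 t) = t.
  apply/rowP => j; rewrite mxE coface_self subr0 invr1 mul1r mxE.
  by rewrite coface_lift.
have [p _ e] : S (s t) by apply: sS; exists t.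
by rewrite -e FK.
Qed.

Lemma face_cone_lift k (i : 'I_k.+2) (s : 'rV[R]_k.+2 -> 'rV[R]_4) :
  face (lift 0 i) (cone s) = cone (face i s).
Proof.
apply/funext => t; rewrite /face /cone /patch; case: ifPn => // /set_mem st /=.
rewrite mem_set; last exact: coface_std.
rewrite coface_lift00 simplex_base_coface.
have [->|t1] := eqVneq (t 0 0) 1; first by rewrite subrr !scale0r.
by rewrite mem_set //; exact: simplex_base_std.
Qed.

(** The cone operator is a contracting homotopy: the face opposite to the apex is
    the simplex itself, and the others are the cones over its faces. *)
Lemma boundary_cone k (s : 'rV[R]_k.+2 -> 'rV[R]_4) : singular_simplex S s ->
  boundary (<< cone s >> : formal_chain R k.+2) =
  << s >> - cone_chain (boundary (<< s >> : formal_chain R k.+1)).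
Proof.
move=> Ss; rewrite /boundary !liftU !scale1r big_ord_recl expr0 scale1r face_cone0 //.
congr (_ + _); rewrite /cone_chain fglift_sum -sumrN; apply: eq_bigr => i _.
rewrite fgliftZ liftU scale1r face_cone_lift -scaleNr; congr (_ *: _).
by rewrite /= /bump leq0n add1n exprS mulN1r.
Qed.

(** Away from the apex the cone is a composition of continuous maps. At the apex
    the projection to the base is discontinuous, but it is multiplied by a factor
    tending to [0] and the base simplex is compact. *)
Lemma cone_singular k (s : 'rV[R]_k.+1 -> 'rV[R]_4) :
  singular_simplex S s -> singular_simplex S (cone s).
Proof.
move=> [cs sS s0]; split; last 2 first.
- move=> _ [t st <-]; rewrite /cone /patch mem_set //.
  by exists ((1 - t 0 0) *: G (s (simplex_base t))).
- by move=> t st; rewrite /cone /patch memNset.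
pose g := G \o s.
have cg : {within @std_simplex R k, continuous g}.
  exact: within_continuous_chain cs sS cG.
pose H (t : 'rV[R]_k.+2) := (1 - t 0 0) *: g (simplex_base t).
have c0 : continuous (fun t : 'rV[R]_k.+2 => t 0 0) by exact: coord_continuous.
apply: (@subspace_eq_continuous _ _ _ (param_map F \o H)).
  by move=> t st /=; rewrite /from_subspace /= /cone /patch st.
have [M [M0 Mg]] : exists M, 0 < M /\ forall t, std_simplex t -> `|g t| <= M.
  have /compact_bounded[M [Mr HM]] := continuous_compact cg (@compact_std_simplex R k).
  exists (`|M| + 1); split; first by rewrite ltr_wpDl.
  move=> t st; apply: HM; last by exists t.
  by rewrite (le_lt_trans (ler_norm _)) // ltrDl.
suff cH : {within @std_simplex R k.+1, continuous H}.
  by apply: within_continuous_comp cH => p _; exact: cF.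
apply/subspace_continuousP => t st.
have [t1|t1] := eqVneq (t 0 0) 1.
  (* at the apex: the base point has bounded image *)
  have Ht : H t = 0 by rewrite /H t1 subrr scale0r.
  suff cH : H u @[u --> within (@std_simplex R k.+1) (nbhs t)] --> (0 : R * R)%type.
    by rewrite -Ht in cH; exact: cH.
  apply/cvgrPdist_lt => e e0.
  have eM : 0 < e / M by rewrite divr_gt0.
  have /cvgrPdist_lt /(_ _ eM) := c0 t.
  rewrite near_withinE; apply: filterS => t' ht st'.
  rewrite sub0r normrN normrZ.
  have [t1'|t1'] := eqVneq (t' 0 0) 1; first by rewrite t1' subrr normr0 mul0r.
  rewrite t1 in ht; apply: (@le_lt_trans _ _ (`|1 - t' 0 0| * M)).
    by rewrite ler_wpM2l // Mg //; exact: simplex_base_std.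
  by rewrite -ltr_pdivlMr.
pose B := [set t : 'rV[R]_k.+2 | std_simplex t /\ t 0 0 != 1].
have cb : continuous (fun t : 'rV[R]_k.+2 => \row_(j < k.+1) t 0 (lift 0 j)).
  move=> u; apply: continuous_row => j.
  rewrite (_ : (fun _ => _) = fun u : 'rV[R]_k.+2 => u 0 (lift 0 j)).
    exact: coord_continuous.
  by apply/funext => w; rewrite mxE.
have cB : {within B, continuous (@simplex_base R k.+1)}.
  apply/subspace_continuousP => u [su u1]; apply: cvg_within_filter.
  apply: cvgZ; last exact: cb.
  apply: cvgV; first by rewrite subr_eq0 eq_sym.
  by apply: cvgB; [exact: cvg_cst | exact: c0].
have cgB : {within B, continuous (g \o (@simplex_base R k.+1))}.
  apply: within_continuous_chain cB _ cg => _ [u [su u1] <-].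
  exact: simplex_base_std.
have Bt : B t by [].
move/subspace_continuousP : cgB => /(_ t Bt) cgt.
have cgt' : g (simplex_base u) @[u --> within (@std_simplex R k.+1) (nbhs t)]
    --> g (simplex_base t).
  move=> W nW.
  have {}nW : nbhs (t : 'rV[R]_k.+2) [set u | B u -> W (g (simplex_base u))] :=
    cgt W nW.
  have n1 : nbhs (t : 'rV[R]_k.+2) [set u : 'rV[R]_k.+2 | u 0 0 != 1].
    apply: (c0 t [set x | x != 1]); apply: open_nbhs_nbhs.
    by split; [exact: open_neq | exact: t1].
  suff : nbhs (t : 'rV[R]_k.+2)
    [set u : 'rV[R]_k.+2 | std_simplex u -> W (g (simplex_base u))] by [].
  by apply: filterS2 n1 nW => u u1 h su; apply: h; split.
apply: cvgZ => //; apply: cvg_within_filter.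
by apply: cvgB; [exact: cvg_cst | exact: c0].
Qed.

(** By the homotopy formula a cycle [z] is the boundary of its cone, whose faces
    through the apex cancel. *)
Lemma cycle_boundary_cone (z : formal_chain R 1) :
  singular_1cycle S z -> singular_1boundary S z.
Proof.
move=> [Sz bz]; exists (cone_chain z).
  rewrite /cone_chain fglift_chain; apply: singular_chain_sum => s sz t.
  by rewrite domU1 inE => /eqP ->; apply: cone_singular; exact: Sz.
rewrite /cone_chain fglift_chain {1}/boundary fglift_sum.
transitivity (\sum_(s <- dom z) coeff s z *:
    (<< s >> - cone_chain (boundary (<< s >> : formal_chain R 1)))).
  under eq_bigr do rewrite scalerBr.
  rewrite sumrB -freeg_chainE.
  suff -> : \sum_(s <- dom z) coeff s z *:
      cone_chain (boundary (<< s >> : formal_chain R 1)) = cone_chain (boundary z).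
    by rewrite bz /cone_chain fglift_chain dom0 big_nil subr0.
  rewrite [in RHS](freeg_chainE z) /boundary fglift_sum /cone_chain fglift_sum.
  by apply: eq_bigr => s _; rewrite !fgliftZ.
rewrite big_seq_cond [RHS]big_seq_cond; apply: eq_bigr => s.
rewrite andbT => sz; rewrite fgliftZ -/(boundary _) boundary_cone //; exact: Sz.
Qed.

Theorem embedded_plane_first_betti : first_betti_number S 0.
Proof.
split; first by exists (fun=> 0); split=> [[]|m _ []].
move=> [//|n] z [zc zi]; exfalso.
suff /(zi (fun=> 1)) /(_ 0) : singular_1boundary S (\sum_(i < n.+1) 1 *: z i) by [].
apply: cycle_boundary_cone; split.
  by apply: singular_chain_sum => i _; case: (zc i).
by rewrite /boundary fglift_sum big1 // => i _; rewrite fgliftZ -/(boundary _);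
   case: (zc i) => _ ->; rewrite scaler0.
Qed.

End Cone.

(** * Smooth closed curves separate the plane *)

Section Calculus.
Variable R : realType.
Implicit Types f : R -> R.

Lemma is_derive_continuous f f' :
  (forall x : R, is_derive x 1 f (f' x)) -> continuous f.
Proof.
by move=> df x; apply: differentiable_continuous; apply/derivable1_diffP;
   case: (df x).
Qed.

Lemma is_derive_gt0_near f (x l : R) : is_derive x 1 f l -> 0 < l ->
  forall d, 0 < d -> (exists2 t, x < t < x + d & f x < f t) /\
    (exists2 t, x - d < t < x & f t < f x).
Proof.
move=> [df dl] l0 d d0.
have : h^-1 *: (f (h *: 1 + x) - f x) @[h --> 0^'] --> l by rewrite -dl; exact: df.
move=> /cvgrPdist_lt /(_ l l0).
rewrite near_withinE => -[e /= e0 He].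
have pos h : h != 0 -> `|h| < e -> 0 < h^-1 * (f (h + x) - f x).
  move=> h0 he; have := He h; rewrite /ball_ /= sub0r normrN => /(_ he h0).
  rewrite /GRing.scale /= mulr1 ltr_norml => /andP[_]; lra.
pose h := Num.min e d / 2.
have m0 : 0 < Num.min e d by rewrite lt_min e0.
have h0 : 0 < h by rewrite divr_gt0.
have hm : h < Num.min e d by rewrite ltr_pdivrMr // ltr_pMr // ltr1n.
have [he hd] : h < e /\ h < d by move: hm; rewrite lt_min => /andP.
split.
  exists (h + x); first by apply/andP; split; lra.
  have := pos h; rewrite gt_eqF // gtr0_norm // => /(_ isT he).
  by rewrite pmulr_rgt0 ?invr_gt0 // subr_gt0.
exists (- h + x); first by apply/andP; split; lra.
have := pos (- h); rewrite oppr_eq0 gt_eqF // normrN gtr0_norm // => /(_ isT he).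
by rewrite invrN mulNr -mulrN opprB pmulr_rgt0 ?invr_gt0 // subr_gt0.
Qed.

Lemma periodic_int f : (forall t, f (t + 1) = f t) ->
  forall t, f (t - (Num.floor t)%:~R) = f t.
Proof.
move=> pf.
have pn n t : f (t + n%:R) = f t.
  elim: n t => [|n IH] t; first by rewrite addr0.
  by rewrite -natr1 addrA pf IH.
move=> t; case: (Num.floor t) => n.
  by rewrite -[in RHS](subrK n%:~R t) pn.
by rewrite NegzE mulrNz opprK pn.
Qed.

Lemma floor_01 (t : R) : 0 <= t - (Num.floor t)%:~R < 1.
Proof. by rewrite subr_ge0 floor_le_tmp /= ltrBlDl -intrD1 floorD1_gt. Qed.

End Calculus.

Section PlaneCurve.
Variables (R : realType) (X Y X' Y' : R -> R).
Hypotheses (dX : forall t : R, is_derive t 1 X (X' t))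
  (dY : forall t : R, is_derive t 1 Y (Y' t)).
Hypotheses (cX' : continuous X') (cY' : continuous Y').
Hypotheses (pX : forall t, X (t + 1) = X t) (pY : forall t, Y (t + 1) = Y t).
Implicit Types p q : R * R.

Definition off_curve p := forall t, (X t, Y t) <> p.

Definition sq_dist p t := (X t - p.1) ^+ 2 + (Y t - p.2) ^+ 2.

Definition turn_speed p t :=
  ((X t - p.1) * Y' t - (Y t - p.2) * X' t) / sq_dist p t.

(** The angle swept by the curve, seen from [p], between times [0] and [t]. *)
Definition turn p t := if 0 <= t
  then \int[@lebesgue_measure R]_(u in `[0, t]) turn_speed p u
  else - \int[@lebesgue_measure R]_(u in `[t, 0]) turn_speed p u.

Lemma curve_01 t : exists2 u, 0 <= u < 1 & X u = X t /\ Y u = Y t.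
Proof.
exists (t - (Num.floor t)%:~R); first exact: floor_01.
by rewrite !periodic_int.
Qed.

Lemma sq_dist_gt0 p t : off_curve p -> 0 < sq_dist p t.
Proof.
move=> /(_ t) h; rewrite lt_neqAle eq_sym addr_ge0 ?sqr_ge0 // andbT.
apply/negP; rewrite paddr_eq0 ?sqr_ge0 // !sqrf_eq0 !subr_eq0 => /andP[/eqP e1 /eqP e2].
by apply: h; rewrite e1 e2; case: (p).
Qed.

Lemma X_cont : continuous X. Proof. exact: is_derive_continuous dX. Qed.
Lemma Y_cont : continuous Y. Proof. exact: is_derive_continuous dY. Qed.

Lemma sq_dist_cont p : continuous (sq_dist p).
Proof.
have c (f : R -> R) (z : R) : continuous f -> continuous (fun t => (f t - z) ^+ 2).
  move=> cf t; have h : f u - z @[u --> t] --> f t - z.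
    by apply: cvgB; [exact: cf | exact: cvg_cst].
  exact: (cvgM h h).
move=> t; apply: cvgD; [exact: (c X) X_cont t | exact: (c Y) Y_cont t].
Qed.

Lemma is_derive_turn p (t : R) : off_curve p ->
  is_derive t 1 (turn p) (turn_speed p t).
Proof.
move=> op; apply: is_derive_signed_integral => u.
apply: cvgM.
  by apply: cvgB; apply: cvgM; (try exact: cX'); (try exact: cY');
    (apply: cvgB; last exact: cvg_cst); [exact: X_cont | exact: Y_cont].
apply: cvgV; first by rewrite gt_eqF // sq_dist_gt0.
exact: sq_dist_cont.
Qed.

Lemma turn0 p : turn p 0 = 0.
Proof. by rewrite /turn lexx set_itv1 Rintegral_set1. Qed.

Lemma turn_speed_periodic p t : turn_speed p (t + 1) = turn_speed p t.
Proof.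
have per (f f' : R -> R) : (forall t : R, is_derive t 1 f (f' t)) ->
    (forall t, f (t + 1) = f t) -> f' (t + 1) = f' t.
  move=> df pf.
  have d1 : is_derive t 1 (fun t => t + 1) (1 : R).
    by apply: is_derive_eq; rewrite addr0.
  have := @is_derive1_comp _ f (fun t => t + 1) t _ _ (df (t + 1)) d1.
  rewrite mulr1 (_ : f \o _ = f); last by apply/funext => u; exact: pf.
  by move=> d2; rewrite -(is_derive_derive1 d2) (is_derive_derive1 (df t)).
by rewrite /turn_speed /sq_dist pX pY (per _ _ dX pX) (per _ _ dY pY).
Qed.

(** The curve seen from [p] is its initial position, rotated by [turn p] and
    rescaled: the two coordinates of the back-rotated unit vector have
    derivative zero. *)
Lemma turn_rotation p t : off_curve p -> exists2 l, 0 < l &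
  X t - p.1 = l * ((X 0 - p.1) * cos (turn p t) - (Y 0 - p.2) * sin (turn p t)) /\
  Y t - p.2 = l * ((X 0 - p.1) * sin (turn p t) + (Y 0 - p.2) * cos (turn p t)).
Proof.
move=> op.
pose n t := Num.sqrt (sq_dist p t).
have n0 u : 0 < n u by rewrite sqrtr_gt0 sq_dist_gt0.
have n1 u : n u != 0 by rewrite gt_eqF.
have n2 u : n u ^+ 2 = (X u - p.1) ^+ 2 + (Y u - p.2) ^+ 2.
  by rewrite sqr_sqrtr // ltW // sq_dist_gt0.
have speedE u : turn_speed p u =
    ((X u - p.1) * Y' u - (Y u - p.2) * X' u) / n u ^+ 2.
  by rewrite n2.
have dn (u : R) : is_derive u 1 n
    (((X u - p.1) * X' u + (Y u - p.2) * Y' u) / n u).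
  have ? := dX u; have ? := dY u.
  have d1 : is_derive u 1 (sq_dist p)
      (2 * ((X u - p.1) * X' u + (Y u - p.2) * Y' u)).
    by apply: is_derive_eq; rewrite /GRing.scale /=; ring.
  have d2 := is_derive1_sqrt (sq_dist_gt0 u op).
  have := @is_derive1_comp _ Num.sqrt (sq_dist p) u _ _ d2 d1 => d3.
  by apply: is_derive_eq; rewrite -/(n u); field.
have dcos (u : R) : is_derive u 1 (fun u => cos (turn p u))
    (- sin (turn p u) * turn_speed p u).
  exact: (@is_derive1_comp _ cos (turn p) u _ _ _ (is_derive_turn u op)).
have dsin (u : R) : is_derive u 1 (fun u => sin (turn p u))
    (cos (turn p u) * turn_speed p u).
  exact: (@is_derive1_comp _ sin (turn p) u _ _ _ (is_derive_turn u op)).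
have dnV (u : R) : is_derive u 1 (fun u => (n u)^-1)
    (- ((X u - p.1) * X' u + (Y u - p.2) * Y' u) / n u ^+ 3).
  have := is_deriveV (n1 u) (dn u) => d.
  by apply: is_derive_eq; rewrite /GRing.scale /=; field.
pose f u := ((X u - p.1) * cos (turn p u) + (Y u - p.2) * sin (turn p u)) * (n u)^-1.
pose g u := ((Y u - p.2) * cos (turn p u) - (X u - p.1) * sin (turn p u)) * (n u)^-1.
have df (u : R) : is_derive u 1 f 0.
  have ? := dX u; have ? := dY u; have ? := dcos u; have ? := dsin u.
  have ? := dnV u.
  apply: is_derive_eq; rewrite /GRing.scale /= speedE.
  transitivity ((X' u * cos (turn p u) + Y' u * sin (turn p u)) *
    (n u ^+ 2 - ((X u - p.1) ^+ 2 + (Y u - p.2) ^+ 2)) / n u ^+ 3).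
    by field.
  by rewrite n2 subrr mulr0 mul0r.
have dg (u : R) : is_derive u 1 g 0.
  have ? := dX u; have ? := dY u; have ? := dcos u; have ? := dsin u.
  have ? := dnV u.
  apply: is_derive_eq; rewrite /GRing.scale /= speedE.
  transitivity ((Y' u * cos (turn p u) - X' u * sin (turn p u)) *
    (n u ^+ 2 - ((X u - p.1) ^+ 2 + (Y u - p.2) ^+ 2)) / n u ^+ 3).
    by field.
  by rewrite n2 subrr mulr0 mul0r.
have := is_derive_0_is_cst t 0 df; have := is_derive_0_is_cst t 0 dg.
rewrite /f /g turn0 cos0 sin0 !mulr1 !mulr0 addr0 subr0.
set c := cos _; set s := sin _ => eg ef.
have cs : c ^+ 2 + s ^+ 2 = 1 by exact: cos2Dsin2.
exists (n t / n 0); first by rewrite divr_gt0.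
have nt := n1 t; have n00 := n1 0.
have X0E : X 0 - p.1 = ((X t - p.1) * c + (Y t - p.2) * s) / n t * n 0.
  by rewrite ef mulfVK.
have Y0E : Y 0 - p.2 = ((Y t - p.2) * c - (X t - p.1) * s) / n t * n 0.
  by rewrite eg mulfVK.
rewrite X0E Y0E; split.
  rewrite -[LHS]mulr1 -cs; field; by rewrite nt n00.
rewrite -[LHS]mulr1 -cs; field; by rewrite nt n00.
Qed.

(** After one period the swept angle is a multiple of [2 pi]. *)
Lemma turn1 p : off_curve p -> cos (turn p 1) = 1 /\ sin (turn p 1) = 0.
Proof.
move=> op; have [l l0 []] := turn_rotation 1 op.
have -> : X 1 = X 0 by rewrite -(pX 0) add0r.
have -> : Y 1 = Y 0 by rewrite -(pY 0) add0r.
have := sq_dist_gt0 0 op; rewrite /sq_dist.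
set u := X 0 - _; set v := Y 0 - _; set c := cos _; set s := sin _ => N0 e1 e2.
have N1 : u ^+ 2 + v ^+ 2 != 0 by rewrite gt_eqF.
have lc : l * c = 1.
  apply: (mulfI N1); rewrite mulr1.
  transitivity (u * (l * (u * c - v * s)) + v * (l * (u * s + v * c))); first by ring.
  by rewrite -e1 -e2; ring.
have ls : l * s = 0.
  apply: (mulfI N1); rewrite mulr0.
  transitivity (u * (l * (u * s + v * c)) - v * (l * (u * c - v * s))); first by ring.
  by rewrite -e1 -e2; ring.
have s0 : s = 0 by move/eqP : ls; rewrite mulf_eq0 gt_eqF //= => /eqP.
split=> //.
have c0 : 0 < c by rewrite -(pmulr_rgt0 _ l0) lc.
have : c ^+ 2 = 1 ^+ 2.
  have := cos2Dsin2 (turn p 1).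
  by rewrite -/c -/s s0 expr0n addr0 expr1n.
by move/pexpIrn; apply; rewrite ?nnegrE // ltW.
Qed.

Lemma turn_diff_cont p q : off_curve p -> off_curve q ->
  continuous (fun t => turn p t - turn q t).
Proof.
move=> op oq t; apply: cvgB.
  exact: (is_derive_continuous (fun u => is_derive_turn u op)).
exact: (is_derive_continuous (fun u => is_derive_turn u oq)).
Qed.

(** If the angles differ by an odd multiple of [pi], the scalar products of the two
    views of the curve at times [0] and [t] have opposite signs. *)
Lemma turn_diff_pi p q t : off_curve p -> off_curve q ->
  (forall t, 0 < (X t - p.1) * (X t - q.1) + (Y t - p.2) * (Y t - q.2)) ->
  cos (turn p t - turn q t) != -1.
Proof.
move=> op oq ip; apply/eqP => cD.
have sD : sin (turn p t - turn q t) = 0.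
  have := cos2Dsin2 (turn p t - turn q t); rewrite cD sqrrN expr1n.
  by move/eqP; rewrite -[X in _ == X]addr0 => /eqP/addrI/eqP; rewrite sqrf_eq0 => /eqP.
have eA : turn p t = (turn p t - turn q t) + turn q t by rewrite subrK.
have cA : cos (turn p t) = - cos (turn q t).
  by rewrite eA cosD cD sD mul0r subr0 mulN1r.
have sA : sin (turn p t) = - sin (turn q t).
  by rewrite eA sinD cD sD mul0r add0r mulN1r.
have [l l0 [e1 e2]] := turn_rotation t op.
have [m m0 [e3 e4]] := turn_rotation t oq.
have := ip t; have := ip 0; rewrite e1 e2 e3 e4 cA sA.
set c := cos _; set s := sin _.
set u0 := X 0 - p.1; set v0 := Y 0 - p.2; set u1 := X 0 - q.1; set v1 := Y 0 - q.2.
move=> h0; rewrite (_ : _ + _ = - (l * m * ((u0 * u1 + v0 * v1) *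
    (c ^+ 2 + s ^+ 2)))); last by ring.
by rewrite cos2Dsin2 mulr1 oppr_gt0 ltNge mulr_ge0 // ?mulr_ge0 // ltW.
Qed.

(** Seen from two close points, the curve never lies in opposite directions, so
    that the difference of the two swept angles stays between [- pi] and [pi]; after
    one period it is a multiple of [2 pi], hence zero. *)
Lemma turn_locally_constant p : off_curve p ->
  \forall q \near p, off_curve q /\ turn q 1 = turn p 1.
Proof.
move=> op.
have [d d0 dP] : exists2 d, 0 < d & forall t, d <= sq_dist p t.
  have [c _ hc] := @EVT_min R (sq_dist p) 0 1 ler01
    (continuous_subspaceT (@sq_dist_cont p)).
  exists (sq_dist p c); first exact: sq_dist_gt0.
  move=> t; have [u /andP[u0 u1] [eX eY]] := curve_01 t.
  by rewrite /sq_dist -eX -eY; apply: hc; rewrite in_itv /= u0 ltW.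
have nb : nbhs p [set q | (p.1 - q.1) ^+ 2 + (p.2 - q.2) ^+ 2 < d].
  have c : (p.1 - q.1) ^+ 2 + (p.2 - q.2) ^+ 2 @[q --> p] -->
      (p.1 - p.1) ^+ 2 + (p.2 - p.2) ^+ 2.
    have c1 : p.1 - q.1 @[q --> p] --> p.1 - p.1.
      by apply: cvgB; [exact: cvg_cst | exact: cvg_fst].
    have c2 : p.2 - q.2 @[q --> p] --> p.2 - p.2.
      by apply: cvgB; [exact: cvg_cst | exact: cvg_snd].
    exact: (cvgD (cvgM c1 c1) (cvgM c2 c2)).
  apply: (c [set x | x < d]); apply: open_nbhs_nbhs; split; first exact: open_lt.
  by rewrite /= !subrr expr0n /= addr0.
apply: filterS nb => q qd.
have ip t : 0 < (X t - p.1) * (X t - q.1) + (Y t - p.2) * (Y t - q.2).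
  have := dP t; rewrite /sq_dist => h.
  have := sqr_ge0 (X t - q.1); have := sqr_ge0 (Y t - q.2); move: qd h => /=.
  have -> : (p.1 - q.1) ^+ 2 = ((X t - q.1) - (X t - p.1)) ^+ 2 by ring.
  have -> : (p.2 - q.2) ^+ 2 = ((Y t - q.2) - (Y t - p.2)) ^+ 2 by ring.
  move: (X t - p.1) (X t - q.1) (Y t - p.2) (Y t - q.2) => u u' v v'.
  lra.
have oq : off_curve q.
  by move=> t qE; have := ip t; rewrite -qE /= !subrr !mulr0 addr0 ltxx.
split=> //.
have cD := turn_diff_cont oq op.
have npi := turn_diff_pi _ op oq ip.
have [c1 s1] := turn1 op; have [c2 s2] := turn1 oq.
have cosD1 : cos (turn q 1 - turn p 1) = 1 by rewrite cosB c1 c2 s1 s2; ring.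
have D0 : turn q 0 - turn p 0 = 0 by rewrite !turn0 subrr.
have npi' t : turn q t - turn p t != pi /\ turn q t - turn p t != - pi.
  have h := npi t; rewrite -cosN opprB in h.
  by split; apply: contra h => /eqP ->; rewrite ?cosN cospi.
have ivt v : Num.min 0 (turn q 1 - turn p 1) <= v <= Num.max 0 (turn q 1 - turn p 1) ->
    exists t, turn q t - turn p t = v.
  move=> hv; have := @IVT R (fun t => turn q t - turn p t) 0 1 v ler01
    (continuous_subspaceT cD).
  by rewrite D0 => /(_ hv)[t _ <-]; exists t.
have pi0 := pi_gt0 R.
have lt_pi : turn q 1 - turn p 1 < pi.
  rewrite ltNge; apply/negP => h.
  have [|t e] := ivt pi; last by have [] := npi' t; rewrite e eqxx.
  by rewrite ge_min le_max h (ltW pi0) orbT.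
have gt_pi : - pi < turn q 1 - turn p 1.
  rewrite ltNge; apply/negP => h.
  have [|t e] := ivt (- pi); last by have [] := npi' t; rewrite e eqxx.
  by rewrite ge_min le_max h oppr_le0 (ltW pi0) orbT.
apply/eqP; rewrite -subr_eq0 -normr_eq0; apply/eqP.
apply: cos_inj; rewrite ?in_itv /= ?normr_ge0 ?lexx ?(ltW pi0) //.
  by rewrite ler_norml !ltW.
by rewrite cos_norm cosD1 cos0.
Qed.

(** ** Crossing the curve *)

Hypothesis inj : forall t u, 0 <= t < 1 -> 0 <= u < 1 ->
  X t = X u -> Y t = Y u -> t = u.

Notation T2 := (X' 0 ^+ 2 + Y' 0 ^+ 2).
Hypothesis T0 : 0 < T2.

(** Near its base point the curve is a graph over its tangent, and away from it
    it keeps a positive distance: it meets a short enough normal segment only at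
    the base point. *)
Lemma normal_segment : exists2 d, 0 < d & forall t, 0 < t < 1 ->
  (X t - X 0) * X' 0 + (Y t - Y 0) * Y' 0 = 0 ->
  d <= (X t - X 0) ^+ 2 + (Y t - Y 0) ^+ 2.
Proof.
pose h t := (X t - X 0) * X' 0 + (Y t - Y 0) * Y' 0.
pose h' t := X' t * X' 0 + Y' t * Y' 0.
have dh (t : R) : is_derive t 1 h (h' t).
  have ? := dX t; have ? := dY t.
  by apply: is_derive_eq; rewrite /GRing.scale /h' /=; ring.
have ch' : continuous h'.
  by move=> t; apply: cvgD; apply: cvgMl; [exact: cX' | exact: cY'].
have h'0 : 0 < h' 0 by rewrite /h' -!expr2.
have [e e0 he] : exists2 e, 0 < e & forall t, `|t| < e -> 0 < h' t.
  have /cvgrPdist_lt /(_ _ h'0) := ch' 0; move=> -[e /= e0 He].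
  exists e => // t te; have := He t; rewrite /ball_ /= sub0r normrN => /(_ te).
  by rewrite ltr_norml => /andP[_]; lra.
pose m := Num.min e (1 / 2) / 2.
have m0 : 0 < m by rewrite divr_gt0 // lt_min e0 divr_gt0.
have [me m2] : m < e /\ m < 1 / 2.
  apply/andP; rewrite -lt_min ltr_pdivrMr // ltr_pMr ?ltr1n // lt_min e0.
  by rewrite divr_gt0.
have hinc t u : - m <= t -> t < u -> u <= m -> h t < h u.
  move=> mt tu um; apply: (@gtr0_derive1_incr _ h (- m) m) => //.
  - move=> x; rewrite in_itv /= => /andP[x1 x2].
    rewrite (is_derive_derive1 (dh x)); apply: he.
    by rewrite ltr_norml; apply/andP; split; lra.
  - by apply: continuous_subspaceT; exact: is_derive_continuous dh.
have h0 : h 0 = 0 by rewrite /h !subrr !mul0r addr0.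
have cs := @sq_dist_cont (X 0, Y 0).
have mm : m <= 1 - m by lra.
have [c cI hc] := @EVT_min R (sq_dist (X 0, Y 0)) m (1 - m) mm
  (continuous_subspaceT cs).
exists (sq_dist (X 0, Y 0) c).
  rewrite lt_neqAle eq_sym addr_ge0 ?sqr_ge0 // andbT; apply/negP.
  rewrite paddr_eq0 ?sqr_ge0 // !sqrf_eq0 !subr_eq0 => /andP[/eqP e1 /eqP e2].
  move: cI; rewrite in_itv /= => /andP[mc cm].
  have c01 : 0 <= c < 1 by apply/andP; split; lra.
  have := inj c01 _ e1 e2; rewrite lexx ltr01 => /(_ isT) c0.
  by move: mc; rewrite c0 leNgt m0.
move=> t /andP[t0 t1]; rewrite -/(h t) => ht.
have [tm|mt] := ltP t m.
  have : h 0 < h t by apply: hinc; lra.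
  by rewrite h0 ht ltxx.
have [tm|tm] := ltP (1 - m) t.
  have : h (t - 1) < h 0 by apply: hinc; lra.
  by rewrite h0 /h -pX -pY subrK -/(h t) ht ltxx.
by apply: hc; rewrite in_itv /= mt tm.
Qed.

Definition normal_point (e : R) : R * R := (X 0 - e * Y' 0, Y 0 + e * X' 0).

Lemma off_normal_point d e : (forall t, 0 < t < 1 ->
    (X t - X 0) * X' 0 + (Y t - Y 0) * Y' 0 = 0 ->
    d <= (X t - X 0) ^+ 2 + (Y t - Y 0) ^+ 2) ->
  e != 0 -> e ^+ 2 * T2 < d -> off_curve (normal_point e).
Proof.
move=> hd e0 ed t; have [u /andP[u0 u1] [<- <-]] := curve_01 t.
move=> [eX eY].
have [u00|un0] := eqVneq u 0.
  move: eX eY; rewrite u00 => /esym/eqP; rewrite -subr_eq0 addrAC subrr add0r oppr_eq0.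
  rewrite mulf_eq0 (negbTE e0) /= => /eqP y0 /esym/eqP.
  rewrite -subr_eq0 addrAC subrr add0r mulf_eq0 (negbTE e0) /= => /eqP x0.
  by move: T0; rewrite x0 y0 expr0n /= addr0 ltxx.
have u01 : 0 < u < 1 by rewrite lt_neqAle eq_sym un0 u0.
have := hd u u01; rewrite eX eY => /(_ _) h.
have : d <= (X 0 - e * Y' 0 - X 0) ^+ 2 + (Y 0 + e * X' 0 - Y 0) ^+ 2.
  by apply: h; ring.
rewrite leNgt => /negP; apply; apply: le_lt_trans ed; rewrite le_eqVlt.
by apply/orP; left; apply/eqP; ring.
Qed.

(** The difference [D] of the angles swept as seen from two points on either side
    vanishes at time [0], with derivative [2 / e] there and, by periodicity, at time
    [1]. A zero of [D] inside the period would put another point of the curve on the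
    segment between the two points, while a nonzero derivative of the same sign at
    both ends of the period forces such a zero if [D] vanishes at time [1]. *)
Lemma turn_jump d e : (forall t, 0 < t < 1 ->
    (X t - X 0) * X' 0 + (Y t - Y 0) * Y' 0 = 0 ->
    d <= (X t - X 0) ^+ 2 + (Y t - Y 0) ^+ 2) ->
  0 < e -> e ^+ 2 * T2 < d ->
  turn (normal_point e) 1 != turn (normal_point (- e)) 1.
Proof.
have hh : 0 + 1 / 2 <= 1 - 1 / 2 :> R by lra.
move=> hd e0 ed.
have op : off_curve (normal_point e).
  by apply: (off_normal_point hd) => //; rewrite gt_eqF.
have oq : off_curve (normal_point (- e)).
  by apply: (off_normal_point hd); rewrite ?oppr_eq0 ?gt_eqF // sqrrN.
set p := normal_point e in op *; set q := normal_point (- e) in oq *.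
pose D t := turn p t - turn q t.
pose D' t := turn_speed p t - turn_speed q t.
have dD (t : R) : is_derive t 1 D (D' t).
  have ? := is_derive_turn t op; have ? := is_derive_turn t oq.
  exact: is_deriveB.
have cD : continuous D by exact: turn_diff_cont.
have D0 : D 0 = 0 by rewrite /D !turn0 subrr.
have Dint t : 0 < t < 1 -> D t <> 0.
  move=> t01 /eqP; rewrite subr_eq0 => /eqP eA.
  have [l l0 [e1 e2]] := turn_rotation t op.
  have [m m0 [e3 e4]] := turn_rotation t oq.
  rewrite eA in e1 e2.
  move: e1 e2 e3 e4; rewrite /p /q /normal_point /=.
  set c := cos _; set s := sin _; set u := X t - X 0; set v := Y t - Y 0.
  move=> f1 f2 f3 f4.
  have lm : 0 < l + m by rewrite addr_gt0.
  have eu : u * (l + m) = - (e * Y' 0) * (m - l).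
    have : m * (X t - (X 0 - e * Y' 0)) + l * (X t - (X 0 - - e * Y' 0)) = 0.
      by rewrite f1 f3; ring.
    by rewrite /u; lra.
  have ev : v * (l + m) = e * X' 0 * (m - l).
    have : m * (Y t - (Y 0 + e * X' 0)) + l * (Y t - (Y 0 + - e * X' 0)) = 0.
      by rewrite f2 f4; ring.
    by rewrite /v; lra.
  have perp : u * X' 0 + v * Y' 0 = 0.
    apply: (mulIf (negbT (gt_eqF lm))); rewrite mul0r mulrDl.
    by rewrite mulrAC eu mulrAC (mulrAC v) ev; ring.
  have := hd t t01 perp; rewrite -/u -/v leNgt => /negP; apply.
  apply: le_lt_trans ed.
  have lm2 : 0 < (l + m) ^+ 2 by rewrite exprn_gt0.
  rewrite -(ler_pM2r lm2) mulrDl -!exprMn eu ev.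
  have -> : (- (e * Y' 0) * (m - l)) ^+ 2 + (e * X' 0 * (m - l)) ^+ 2 =
    e ^+ 2 * T2 * (m - l) ^+ 2 by ring.
  have eT : 0 <= e ^+ 2 * T2 by apply: mulr_ge0; [exact: sqr_ge0 | exact: ltW].
  apply: (ler_wpM2l eT); rewrite -subr_ge0.
  rewrite (_ : _ - _ = 4 * (l * m)); last by ring.
  by rewrite mulr_ge0 // ltW // mulr_gt0.
have D'0 : D' 0 = 2 / e.
  rewrite /D' /turn_speed /sq_dist /p /q /normal_point /=.
  have en0 : e != 0 by rewrite gt_eqF.
  have T1 : T2 != 0 by rewrite gt_eqF.
  have -> : (X 0 - (X 0 - e * Y' 0)) ^+ 2 + (Y 0 - (Y 0 + e * X' 0)) ^+ 2 =
    e ^+ 2 * T2 by ring.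
  have -> : (X 0 - (X 0 - - e * Y' 0)) ^+ 2 + (Y 0 - (Y 0 + - e * X' 0)) ^+ 2 =
    e ^+ 2 * T2 by ring.
  by field; rewrite en0 T1.
have D'1 : D' 1 = 2 / e.
  by rewrite -D'0 /D' -(add0r 1) !turn_speed_periodic.
have pos : 0 < 2 / e by rewrite divr_gt0.
apply/eqP => pq1; have D1 : D 1 = 0 by rewrite /D pq1 subrr.
have d0 := dD 0; rewrite D'0 in d0; have d1 := dD 1; rewrite D'1 in d1.
have h2 : (0 : R) < 1 / 2 by rewrite divr_gt0.
have [[t /andP[t0 t1] Dt] _] := is_derive_gt0_near d0 pos h2.
have [_ [u /andP[u0 u1] Du]] := is_derive_gt0_near d1 pos h2.
rewrite D0 in Dt; rewrite D1 in Du.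
have tu : t <= u by apply: ltW (lt_trans t1 _); exact: le_lt_trans hh u0.
have [] := @IVT R D t u 0 tu (continuous_subspaceT cD).
  by rewrite ge_min le_max (ltW Dt) (ltW Du) orbT.
move=> x; rewrite in_itv /= => /andP[tx xu].
by apply: Dint; rewrite (lt_le_trans t0) //= (le_lt_trans xu).
Qed.

(** The angle swept in one period is locally constant off the curve and jumps
    across it at the base point. *)
Theorem curve_separates (K : set (R * R)) : closed K -> ~ K (X 0, Y 0) ->
  ~ connected (~` (range (fun t => (X t, Y t)) `|` K)).
Proof.
move=> Kc Kq; have [d d0 hd] := normal_segment.
have [e [e0 ed Kp Km]] : exists e, [/\ 0 < e, e ^+ 2 * T2 < d,
    ~ K (normal_point e) & ~ K (normal_point (- e))].
  have oK : open (~` K) by exact: closed_openC.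
  have c1 : e ^+ 2 * T2 @[e --> (0 : R)] --> (0 : R) ^+ 2 * T2.
    by apply: cvgMl; exact: exprn_continuous.
  have cN (k : R) : normal_point (k * e) @[e --> (0 : R)] --> (X 0, Y 0).
    have cz (z : R) : k * e * z @[e --> (0 : R)] --> k * 0 * z.
      by apply: cvgMl; apply: cvgMr; exact: cvg_id.
    have h1 : X 0 - k * e * Y' 0 @[e --> (0 : R)] --> X 0 - k * 0 * Y' 0.
      by apply: cvgB; [exact: cvg_cst | exact: cz].
    have h2 : Y 0 + k * e * X' 0 @[e --> (0 : R)] --> Y 0 + k * 0 * X' 0.
      by apply: cvgD; [exact: cvg_cst | exact: cz].
    rewrite mulr0 mul0r subr0 in h1; rewrite mulr0 mul0r addr0 in h2.
    exact: cvg_pair h1 h2.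
  have nK : nbhs (X 0, Y 0) (~` K) by exact: open_nbhs_nbhs.
  have n1 : \forall e \near (0 : R), e ^+ 2 * T2 < d.
    apply: (c1 [set x | x < d]); apply: open_nbhs_nbhs; split; first exact: open_lt.
    by rewrite /= expr0n mul0r.
  have n2 : \forall e \near (0 : R), ~ K (normal_point (1 * e)) by exact: cN nK.
  have n3 : \forall e \near (0 : R), ~ K (normal_point (-1 * e)) by exact: cN nK.
  near (0 : R)^'+ => e; exists e; split.
  - by near: e; exact: nbhs_right_gt.
  - by near: e; exact: cvg_within n1.
  - by rewrite -[e]mul1r; near: e; exact: cvg_within n2.
  - by rewrite -mulN1r; near: e; exact: cvg_within n3.
set A := ~` _; move=> cA.
have off_A p : A p -> off_curve p.
  by move=> nA t e1; apply: nA; left; exists t.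
have A_off p : off_curve p -> ~ K p -> A p.
  by move=> op nK [[t _ e1]|//]; exact: op e1.
have Ap : A (normal_point e).
  by apply: A_off => //; apply: (off_normal_point hd) => //; rewrite gt_eqF.
have Aq : A (normal_point (- e)).
  apply: A_off => //; apply: (off_normal_point hd); rewrite ?sqrrN //.
  by rewrite oppr_eq0 gt_eqF.
set w := turn (normal_point e) 1.
have op b : open [set p | off_curve p /\ (turn p 1 == w) = b].
  rewrite openE => p [oP wP]; apply: filterS (turn_locally_constant oP).
  by move=> q [oQ eQ]; split=> //; rewrite eQ.
pose B := A `&` [set p | off_curve p /\ (turn p 1 == w) = true].
have BA : B = A.
  apply: cA.
  - by exists (normal_point e); split=> //; split; [exact: off_A | exact: eqxx].
  - by exists [set p | off_curve p /\ (turn p 1 == w) = true].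
  - exists (~` [set p | off_curve p /\ (turn p 1 == w) = false]).
      exact: open_closedC.
    apply/seteqP; split=> p [pA h]; split=> //.
      by move=> [_]; case: h => _ ->.
    split; first exact: off_A.
    by apply/negPn/negP => /negbTE h2; apply: h; split => //; exact: off_A.
have : B (normal_point (- e)) by rewrite BA.
by move=> [_ [_ /eqP h]]; have := turn_jump hd e0 ed; rewrite h eqxx.
Unshelve. all: by end_near. Qed.

End PlaneCurve.

(** * Genus *)

Lemma continuous_pair (T U V : topologicalType) (f : T -> U) (g : T -> V) :
  continuous f -> continuous g -> continuous (fun t => (f t, g t)).
Proof. by move=> cf cg t; exact: cvg_pair (cf t) (cg t). Qed.

Lemma connected_plane (R : realType) : connected [set: R * R].
Proof.
have cT : connected [set: R] by apply/connected_intervalP.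
have cr (f : R -> R * R) : continuous f -> connected (range f).
  by move=> cf; apply: connected_continuous_connected cT _; exact: continuous_subspaceT.
pose A (x : R) := range (fun t => (x, t)) `|` range (fun t => (t, 0 : R)).
have -> : [set: R * R] = \bigcup_(x in [set: R]) A x.
  apply/seteqP; split=> [[x y] _|//]; exists x => //; left; by exists y.
apply: bigcup_connected; first by exists (0, 0) => x _; right; exists 0.
move=> x _; apply: connectedU.
- by exists (x, 0); split; [exists 0 | exists x].
- apply: cr; apply: continuous_pair => t; [exact: cvg_cst | exact: cvg_id].
- apply: cr; apply: continuous_pair => t; [exact: cvg_id | exact: cvg_cst].
Qed.

Lemma closed_periodic_curve (R : realType) (X Y : R -> R) :
  continuous X -> continuous Y ->
  (forall t, X (t + 1) = X t) -> (forall t, Y (t + 1) = Y t) ->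
  closed (range (fun t => (X t, Y t))).
Proof.
move=> cX cY pX pY.
have -> : range (fun t => (X t, Y t)) = (fun t => (X t, Y t)) @` `[0, 1].
  apply/seteqP; split=> [_ [t _ <-]|_ [t _ <-]]; last by exists t.
  have [u /andP[u0 u1] [eX eY]] := curve_01 pX pY t.
  by exists u; [rewrite /= in_itv /= u0 ltW | rewrite eX eY].
apply: compact_closed; first exact: norm_hausdorff.
apply: continuous_compact; last exact: segment_compact.
by apply: continuous_subspaceT; exact: continuous_pair.
Qed.

Section Genus.
Variables (R : realType) (a b : R).
Hypotheses (a0 : 0 < a) (b0 : 0 < b).

Notation F := (jlt_map a b).
Notation S := (jlt_surface a b).
Notation G := (jlt_inv a b).

Lemma jlt_param_continuous : continuous (param_map F).
Proof. by have [] := jlt_map_smooth a0 b0 [::]. Qed.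

Lemma jlt_connected : connected S.
Proof.
apply: connected_continuous_connected (@connected_plane R) _.
exact: continuous_subspaceT jlt_param_continuous.
Qed.

(** The first curve separates the plane already; the union of the others is a closed
    set which does not meet it. *)
Lemma jlt_nonseparating_empty n (c : 'I_n -> R -> 'rV[R]_4) :
  nonseparating_curves S c -> n = 0%N.
Proof.
case: n c => // n c [cs disj conn]; exfalso.
have lift i : exists g : (R -> R) * (R -> R) * ((R -> R) * (R -> R)),
    [/\ forall t : R, is_derive t 1 g.1.1 (g.2.1 t) /\ is_derive t 1 g.1.2 (g.2.2 t),
        continuous g.2.1 /\ continuous g.2.2,
        forall t, c i t = F (g.1.1 t) (g.1.2 t) &
        forall t, g.2.1 t = 0 -> g.2.2 t = 0 -> derive1 (c i) t = 0].
  have [sc _ _ _ cS] := cs i.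
  have [X [Y [X' [Y' H]]]] := jlt_curve_lift a0 b0 sc cS.
  by exists ((X, Y), (X', Y')).
have {lift} [g gP] := choice lift.
pose X i := (g i).1.1; pose Y i := (g i).1.2.
have gE i t : G (c i t) = (X i t, Y i t).
  by have [_ _ -> _] := gP i; exact: (jlt_mapK a0 b0 (X i t, Y i t)).
have cE i t : c i t = param_map F (X i t, Y i t) by have [_ _ ->] := gP i.
have pX i t : X i (t + 1) = X i t /\ Y i (t + 1) = Y i t.
  have [_ _ pc _ _] := cs i; have := gE i (t + 1); rewrite pc gE => -[-> ->] //.
pose K := \bigcup_(i in [set i : 'I_n.+1 | i != 0]) range (fun t => (X i t, Y i t)).
have cK : closed K.
  apply: closed_bigcup => [|i _]; first exact: finite_finset.
  have [dg _ _ _] := gP i.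
  apply: closed_periodic_curve; try (by move=> t; case: (pX i t)).
  - by apply: is_derive_continuous => t; case: (dg t).
  - by apply: is_derive_continuous => t; case: (dg t).
have nK : ~ K (X 0 0, Y 0 0).
  move=> [i /= i0 [t _ [eX eY]]].
  suff : (range (c i) `&` range (c 0)) (c 0 0) by rewrite disj.
  by split; [exists t => //; rewrite cE eX eY -cE | exists 0].
have [dg [c1 c2] _ ng] := gP 0.
have [_ nz _ inj _] := cs 0.
have sep := @curve_separates R (X 0) (Y 0) (g 0).2.1 (g 0).2.2
  (fun t => (dg t).1) (fun t => (dg t).2) c1 c2
  (fun t => (pX 0 t).1) (fun t => (pX 0 t).2).
apply: (sep _ _ K cK nK).
- move=> t u t01 u01 eX eY; apply: inj; rewrite ?in_itv //.
  by rewrite !cE eX eY.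
- rewrite lt_neqAle eq_sym addr_ge0 ?sqr_ge0 // andbT; apply/negP.
  rewrite paddr_eq0 ?sqr_ge0 // !sqrf_eq0 => /andP[/eqP e1 /eqP e2].
  by have := nz 0; rewrite (ng _ e1 e2) eqxx.
have -> : ~` (range (fun t => (X 0 t, Y 0 t)) `|` K) =
    G @` (S `\` \bigcup_(i in [set: 'I_n.+1]) range (c i)).
  apply/seteqP; split=> p.
    move=> np; exists (param_map F p); last exact: jlt_mapK.
    split; first by exists p.
    move=> [i _ [t _ e]]; apply: np.
    have {}e : (X i t, Y i t) = p by rewrite -gE e jlt_mapK.
    have [i0|i0] := eqVneq i 0; first by left; exists t => //; rewrite -i0.
    by right; exists i => //; exists t.
  move=> [v [[q _ <-] nv] <-]; rewrite jlt_mapK //.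
  move=> [[t _ e]|[i _ [t _ e]]]; apply: nv; rewrite -e -cE.
    by exists 0 => //; exists t.
  by exists i => //; exists t.
apply: connected_continuous_connected conn _.
apply: continuous_in_subspaceT => v; rewrite inE => -[Sv _].
by apply: jlt_inv_continuous => //; rewrite inE.
Qed.

Lemma jlt_genus : has_genus S 0.
Proof.
split; last by move=> n c /jlt_nonseparating_empty ->.
exists (fun _ _ => 0); split=> [[]//|[]//|].
rewrite (_ : \bigcup_(i in _) _ = set0) ?setD0; first exact: jlt_connected.
by apply/seteqP; split=> // p [[]].
Qed.

Lemma jlt_first_betti : first_betti_number S 0.
Proof.
apply: (embedded_plane_first_betti jlt_param_continuous (jlt_mapK a0 b0)).
exact: continuous_in_subspaceT (jlt_inv_continuous a0 b0).
Qed.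

End Genus.

(** * Area growth and mean curvature energy *)

Section Area.
Variables (R : realType) (a b : R).
Hypotheses (a0 : 0 < a) (b0 : 0 < b).

Notation phi := (jlt_phi a b).
Notation s := (jlt_s a b).
Notation r := (jlt_r a).
Notation theta := (jlt_theta a b).
Notation Q := (jlt_Q a b).
Notation F := (jlt_map a b).
Notation E := (jlt_E a).
Notation mu := (@lebesgue_measure R).
Notation mu2 := (mu \x mu)%E.

(** The squared distance to the origin, after the terms in [x^2 y^2] of the first
    three coordinates have been combined: it is [(x^2 + y^2)^2 / 4] up to terms of
    lower order. *)
Definition jlt_dist2 x y := x ^+ 2 / a + (x ^+ 2 + y ^+ 2) ^+ 2 / 4 +
  theta y ^+ 2 / b ^+ 2.

Lemma jlt_dist2E x y : dotp (F x y) (F x y) = jlt_dist2 x y.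
Proof.
rewrite jlt_mapE dotp_vec4.
transitivity (x ^+ 2 * r y ^+ 2 * (cos (phi y) ^+ 2 + sin (phi y) ^+ 2) +
  ((y ^+ 2 - x ^+ 2) / 2) ^+ 2 + theta y ^+ 2 / b ^+ 2).
  by field; rewrite gt_eqF.
by rewrite cos2Dsin2 jlt_r_sqr // /jlt_dist2; field; rewrite !gt_eqF.
Qed.

Lemma jlt_enorm_lt x y c : 0 < c -> (enorm (F x y) < c) = (jlt_dist2 x y < c ^+ 2).
Proof.
move=> c0; rewrite /enorm jlt_dist2E -[in LHS](gtr0_norm c0) -sqrtr_sqr.
by rewrite ltr_sqrt // exprn_gt0.
Qed.

Lemma jlt_enorm_gt x y c : 0 < c -> (c < enorm (F x y)) = (c ^+ 2 < jlt_dist2 x y).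
Proof.
move=> c0; rewrite !ltNge; congr (~~ _).
rewrite /enorm jlt_dist2E -[in LHS](gtr0_norm c0) -sqrtr_sqr.
by rewrite ler_sqrt // exprn_ge0 // ltW.
Qed.

(** ** Measurability *)

Lemma measurable_fun_comp1 (f : R -> R) : continuous f ->
  measurable_fun [set: R * R] (fun p => f p.1).
Proof.
move=> /continuous_measurable_fun mf.
exact: measurableT_comp mf measurable_fst.
Qed.

Lemma measurable_fun_comp2 (f : R -> R) : continuous f ->
  measurable_fun [set: R * R] (fun p => f p.2).
Proof.
move=> /continuous_measurable_fun mf.
exact: measurableT_comp mf measurable_snd.
Qed.

Lemma measurable_jlt_dist2 :
  measurable_fun [set: R * R] (fun p => jlt_dist2 p.1 p.2).
Proof.
have m1 := measurable_fun_comp1 (smooth_continuous (@smooth_id R)).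
have m2 := measurable_fun_comp2 (smooth_continuous (@smooth_id R)).
have mt := measurable_fun_comp2 (smooth_continuous (smooth_jlt_theta a0 b0)).
apply: measurable_funD; first apply: measurable_funD.
- by apply: measurable_funM => //; apply: measurable_funX.
- apply: measurable_funM => //; apply: measurable_funX.
  by apply: measurable_funD; apply: measurable_funX.
- by apply: measurable_funM => //; apply: measurable_funX.
Qed.

Lemma measurable_jlt_ball c : 0 < c ->
  measurable (param_map F @^-1` [set v | enorm v < c]).
Proof.
move=> c0.
rewrite (_ : _ @^-1` _ = (fun p => jlt_dist2 p.1 p.2) @^-1` `]-oo, c ^+ 2[).
  by rewrite -[X in measurable X]setTI; exact: measurable_jlt_dist2.
by apply/funext => -[x y]; rewrite /preimage /= /param_map /= jlt_enorm_lt // in_itv.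
Qed.

Lemma measurable_jlt_annulus c d : 0 < c -> 0 < d ->
  measurable (param_map F @^-1` [set v | c < enorm v < d]).
Proof.
move=> c0 d0.
rewrite (_ : _ @^-1` _ =
  (fun p => jlt_dist2 p.1 p.2) @^-1` `]c ^+ 2, d ^+ 2[).
  by rewrite -[X in measurable X]setTI; exact: measurable_jlt_dist2.
apply/funext => -[x y]; rewrite /preimage /= /param_map /=.
by rewrite jlt_enorm_lt // jlt_enorm_gt // in_itv.
Qed.

(** The function [|w| / r] with [w = y + i / s]; the area element is its product
    with [E]. *)
Definition jlt_stretch y := Num.sqrt (Q y) / (s y * r y).

Lemma jlt_stretch_gt0 y : 0 < jlt_stretch y.
Proof.
rewrite divr_gt0 ?sqrtr_gt0 ?jlt_Q_gt0 //.
by rewrite mulr_gt0 ?jlt_s_gt0 ?jlt_r_gt0.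
Qed.

(** [|w|^2 = y^2 + 1 / P] with [a <= P]. *)
Lemma jlt_stretch_le1 y : jlt_stretch y <= 1.
Proof.
have sr : 0 < s y * r y by rewrite mulr_gt0 ?jlt_s_gt0 ?jlt_r_gt0.
rewrite ler_pdivrMr // mul1r -[leRHS](gtr0_norm sr) -sqrtr_sqr.
rewrite ler_sqrt ?sqr_ge0 // exprMn jlt_QE // jlt_s_sqr // jlt_r_sqr // mulrDr.
rewrite (mulrC (y ^+ 2)) lerD2r.
by rewrite ler_pdivlMr // mul1r jlt_P_ge.
Qed.

Lemma jlt_stretch_smooth : smooth jlt_stretch.
Proof.
apply: smoothM.
  apply: smooth_sqrt => [t|]; first exact: jlt_Q_gt0.
  rewrite (_ : Q = fun t => 1 + (t * s t) ^+ 2); last first.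
    by apply/funext => t; exact: jlt_QsE.
  apply: smoothD; first exact: smooth_cst.
  by apply: smoothX; apply: smoothM; [exact: smooth_id | exact: smooth_jlt_s].
apply: smoothV => [t|]; last by apply: smoothM; [exact: smooth_jlt_s | exact: smooth_jlt_r].
by rewrite mulf_neq0 ?jlt_s_neq0 ?jlt_r_neq0.
Qed.

Lemma jlt_area_element x y :
  Num.sqrt (\det (metric F x y)) = E x y * jlt_stretch y.
Proof. by rewrite jlt_sqrt_det // /jlt_stretch mulrA. Qed.

Lemma mu2_box (u v u' v' : R) : u <= v -> u' <= v' ->
  mu2 (`[u, v] `*` `[u', v']) = ((v - u) * (v' - u'))%:E.
Proof.
have itv x y : x <= y -> mu `[x, y] = (y - x)%:E.
  move=> xy; rewrite lebesgue_measure_itv /= lte_fin; case: ltP => // yx.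
  by have /eqP -> : x == y; [rewrite eq_le xy | rewrite subrr].
move=> uv u'v'; rewrite EFinM product_measure1E //; congr (_ * _)%E; exact: itv.
Qed.

(** The part of the surface in the ball of radius [c] lies over the disc
    [x^2 + y^2 <= 2 c], where the area element is at most [E <= 1 / a + 2 c]. *)
Lemma jlt_quadratic_area_growth : quadratic_area_growth F.
Proof.
exists (8 / a + 16) => c c1; have c0 : 0 < c by exact: lt_le_trans c1.
rewrite /area /surface_integral; set A := _ @^-1` _.
have mA : measurable A by exact: measurable_jlt_ball.
pose k := a^-1 + 2 * c; pose m := Num.sqrt (2 * c).
have k0 : 0 < k by rewrite addr_gt0 ?invr_gt0 // mulr_gt0.
have A_disc p : A p -> p.1 ^+ 2 + p.2 ^+ 2 <= 2 * c.
  case: p => x y; rewrite /A /= /param_map /= jlt_enorm_lt // /jlt_dist2 => h.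
  have h1 : 0 <= x ^+ 2 / a by rewrite divr_ge0 ?sqr_ge0 // ltW.
  have h2 : 0 <= theta y ^+ 2 / b ^+ 2 by rewrite divr_ge0 ?sqr_ge0.
  have n0 : 0 <= x ^+ 2 + y ^+ 2 by rewrite addr_ge0 ?sqr_ge0.
  have : (x ^+ 2 + y ^+ 2) ^+ 2 <= (2 * c) ^+ 2.
    by rewrite exprMn; lra.
  by rewrite ler_sqr ?nnegrE // mulr_ge0 // ltW.
pose box : set (R * R) := `[- m, m] `*` `[- m, m].
have Abox : A `<=` box.
  move=> p /A_disc h.
  have bd z w : z ^+ 2 + w ^+ 2 <= 2 * c -> - m <= z <= m.
    move=> hz; rewrite -ler_norml -sqrtr_sqr ler_sqrt; last by rewrite mulr_ge0 // ltW.
    by apply: le_trans hz; rewrite lerDl sqr_ge0.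
  split; rewrite /= in_itv /=; first exact: bd h.
  by apply: (bd _ p.1); rewrite addrC.
have mE : measurable_fun A
    (fun p : R * R => (1 * Num.sqrt (\det (metric F p.1 p.2)))%:E).
  apply/measurable_EFinP; rewrite (_ : (fun _ => _) =
      fun p : R * R => (r p.2 ^+ 2 + p.1 ^+ 2) * jlt_stretch p.2); last first.
    by apply/funext => p; rewrite mul1r jlt_area_element.
  apply: measurable_funTS.
  have mr := measurable_fun_comp2 (smooth_continuous (smooth_jlt_r a0)).
  have mst := measurable_fun_comp2 (smooth_continuous jlt_stretch_smooth).
  have m1 := measurable_fun_comp1 (smooth_continuous (@smooth_id R)).
  apply: measurable_funM => //.
  by apply: measurable_funD; apply: measurable_funX.
apply: (@le_trans _ _ (\int[mu2]_(p in A) (cst k%:E) p)%E).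
  apply: ge0_le_integral => // p /A_disc h.
  rewrite lee_fin mul1r jlt_area_element.
  apply: (@le_trans _ _ (E p.1 p.2)).
    by rewrite ler_piMr ?jlt_stretch_le1 // ltW // jlt_E_gt0.
  by rewrite /jlt_E jlt_r_sqr // /k -addrA lerD2l addrC.
rewrite integral_cst //.
apply: (@le_trans _ _ (k%:E * mu2 box)%E).
  apply: lee_pmul => //; first by rewrite lee_fin ltW.
  by apply: le_measure => //; rewrite inE //; exact: measurableX.
have m0 : 0 <= m by rewrite sqrtr_ge0.
rewrite mu2_box ?ge0_cp // -EFinM lee_fin.
have -> : (m - - m) * (m - - m) = 8 * c.
  transitivity (4 * m ^+ 2); first by ring.
  by rewrite /m sqr_sqrtr ?mulr_ge0 // ?(ltW c0) //; ring.
rewrite (_ : k * (8 * c) = 8 / a * c + 16 * c ^+ 2); last by rewrite /k; ring.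
rewrite [leRHS]mulrDl lerD2r ler_wpM2l ?divr_ge0 ?(ltW a0) //.
by rewrite expr2 ler_peMr // ltW.
Qed.

(** ** Energy *)

Definition jlt_energy_density y := b ^+ 2 / a * expR (- (b * y ^+ 2)) * jlt_stretch y.

Lemma jlt_energy_densityE x y :
  enorm (mean_curvature F x y) ^+ 2 * Num.sqrt (\det (metric F x y)) =
  jlt_energy_density y.
Proof.
rewrite jlt_mean_curvature_sqr // jlt_area_element /jlt_energy_density.
by have E0 := jlt_E_neq0 a0 x y; field; rewrite E0 gt_eqF.
Qed.

Lemma jlt_energy_density_gt0 y : 0 < jlt_energy_density y.
Proof.
apply: mulr_gt0; last exact: jlt_stretch_gt0.
by apply: mulr_gt0; [rewrite divr_gt0 // exprn_gt0 | exact: expR_gt0].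
Qed.

Lemma jlt_energy_density_smooth : smooth jlt_energy_density.
Proof.
apply: smoothM; last exact: jlt_stretch_smooth.
apply: smoothM; first exact: smooth_cst.
rewrite (_ : (fun _ => _) = fun y => expR (- b * y ^+ 2)).
  apply: (smooth_comp (@smooth_expR R)).
  by apply: smoothM; [exact: smooth_cst | apply: smoothX; exact: smooth_id].
by apply/funext => y; rewrite mulNr.
Qed.

(** The area element cancels the factor [1 / E] of [|H|^2]: the energy density
    depends on [y] only, so that a box carries an energy proportional to its length
    in the direction of [x]. *)
Lemma jlt_energy_ge : exists2 k, 0 < k & forall (c : R) (A : set 'rV[R]_4),
  0 <= c -> measurable (param_map F @^-1` A) ->
  `[3 / 2 * c, 7 / 4 * c] `*` `[0, 1] `<=` param_map F @^-1` A ->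
  ((k * c)%:E <= mean_curvature_energy F A)%E.
Proof.
have [y0 _ hk] := @EVT_min R jlt_energy_density 0 1 ler01
  (continuous_subspaceT (smooth_continuous jlt_energy_density_smooth)).
set k := jlt_energy_density y0 in hk.
have k0 : 0 < k by exact: jlt_energy_density_gt0.
exists (k / 4) => [|c A c0 mA bA]; first by rewrite divr_gt0.
rewrite /mean_curvature_energy /surface_integral.
set B := `[_, _] `*` _ in bA.
have mB : measurable B by exact: measurableX.
have mf D : measurable_fun D (fun p : R * R =>
    (enorm (mean_curvature F p.1 p.2) ^+ 2 *
      Num.sqrt (\det (metric F p.1 p.2)))%:E).
  apply/measurable_EFinP; rewrite (_ : (fun _ => _) =
      fun p : R * R => jlt_energy_density p.2); last first.
    by apply/funext => p; rewrite jlt_energy_densityE.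
  apply: measurable_funTS.
  exact: measurable_fun_comp2 (smooth_continuous jlt_energy_density_smooth).
apply: (@le_trans _ _ (\int[mu2]_(p in B)
    (enorm (mean_curvature F p.1 p.2) ^+ 2 *
      Num.sqrt (\det (metric F p.1 p.2)))%:E)%E); last first.
  apply: ge0_subset_integral => //; first exact: mf.
  by move=> p _; rewrite lee_fin mulr_ge0 ?sqr_ge0 ?sqrtr_ge0.
apply: (@le_trans _ _ (\int[mu2]_(p in B) (cst k%:E) p)%E).
  rewrite integral_cst //; suff : ((k / 4 * c)%:E <= k%:E * mu2 B)%E by [].
  rewrite /B mu2_box //; last by rewrite ler_wpM2r //; lra.
  by rewrite -EFinM lee_fin subr0 mulr1 le_eqVlt; apply/orP; left; apply/eqP; field.
apply: ge0_le_integral => //.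
- by move=> p _; rewrite lee_fin ltW.
- exact: mf.
- move=> p [_ p2]; rewrite lee_fin jlt_energy_densityE; exact: hk.
Qed.

(** To leading order the squared distance is [x^4 / 4], and the box is chosen so
    that [x^2 / c] lies between [9 / 4 > 2] and [49 / 16 < 4]; a large [c] absorbs
    the other terms. *)
Lemma jlt_box_annulus : exists k, forall c x y : R, k < c ->
  3 / 2 * Num.sqrt c <= x <= 7 / 4 * Num.sqrt c -> 0 <= y <= 1 ->
  c ^+ 2 < jlt_dist2 x y < (2 * c) ^+ 2.
Proof.
have lower (p q u v : R) :
  (9 / 4) ^+ 2 * q <= p -> 0 < q -> 0 <= u -> 0 <= v -> q < u + p / 4 + v by lra.
have upper (k1 k2 c q u v p : R) : u <= k1 * c -> v <= k2 -> k2 <= k2 * c ->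
    p <= (49 / 16) ^+ 2 * q + 49 / 8 * c + 1 -> (k1 + k2 + 2) * c < q ->
    1 < c -> 0 < q -> u + p / 4 + v < 2 ^+ 2 * q by lra.
pose K := 4 / a + pi ^+ 2 / b ^+ 2 + 2.
exists K => c x y Kc /andP[cx xc] /andP[y0 y1].
have K1 : 0 <= 4 / a by rewrite divr_ge0 // ltW.
have K2 : 0 <= pi ^+ 2 / b ^+ 2 by rewrite divr_ge0 ?sqr_ge0.
have c1 : 1 < c by move: Kc; rewrite /K; lra.
have c0 : 0 < c by exact: lt_trans c1.
have sc : Num.sqrt c ^+ 2 = c by rewrite sqr_sqrtr // ltW.
have sc0 := sqrtr_ge0 c.
have x0 : 0 <= x by apply: le_trans cx; rewrite mulr_ge0.
have xl : 9 / 4 * c <= x ^+ 2.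
  rewrite (_ : 9 / 4 * c = (3 / 2 * Num.sqrt c) ^+ 2).
    by rewrite lerXn2r // nnegrE // mulr_ge0.
  by rewrite exprMn sc; field.
have xu : x ^+ 2 <= 49 / 16 * c.
  rewrite (_ : 49 / 16 * c = (7 / 4 * Num.sqrt c) ^+ 2).
    by rewrite lerXn2r // nnegrE // mulr_ge0.
  by rewrite exprMn sc; field.
have yu : y ^+ 2 <= 1 by rewrite -(expr1n _ 2) lerXn2r // nnegrE.
have yl := sqr_ge0 y.
have tu : theta y ^+ 2 / b ^+ 2 <= pi ^+ 2 / b ^+ 2.
  rewrite ler_wpM2r ?invr_ge0 ?sqr_ge0 // lerXn2r ?nnegrE ?pi_ge0 //.
    exact: le_trans (ltW (jlt_phibar_gt0 a0 b0)) (jlt_theta_ge a0 b0 y).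
  have := jlt_theta_le a0 b0 y; have := jlt_phibar_gt0 a0 b0; lra.
have tl : 0 <= theta y ^+ 2 / b ^+ 2 by rewrite divr_ge0 ?sqr_ge0.
have xa : x ^+ 2 / a <= 4 / a * c.
  rewrite [leRHS]mulrAC ler_wpM2r ?invr_ge0 ?(ltW a0) //.
  by apply: le_trans xu _; rewrite ler_wpM2r ?(ltW c0) //; lra.
have xa0 : 0 <= x ^+ 2 / a by rewrite divr_ge0 ?sqr_ge0 // ltW.
have c2 : 0 < c ^+ 2 by rewrite exprn_gt0.
have t1 : (9 / 4) ^+ 2 * c ^+ 2 <= (x ^+ 2 + y ^+ 2) ^+ 2.
  rewrite -exprMn lerXn2r // ?nnegrE ?addr_ge0 ?mulr_ge0 ?sqr_ge0 ?(ltW c0) //.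
  by rewrite ler_wpDr.
have t2 : (x ^+ 2 + y ^+ 2) ^+ 2 <= (49 / 16) ^+ 2 * c ^+ 2 + 49 / 8 * c + 1.
  rewrite (_ : _ + 1 = (49 / 16 * c + 1) ^+ 2); last by field.
  by rewrite lerXn2r ?lerD // nnegrE addr_ge0 ?mulr_ge0 ?sqr_ge0 ?(ltW c0).
have t3 : K * c < c ^+ 2 by rewrite expr2 ltr_pM2r.
have t4 : pi ^+ 2 / b ^+ 2 <= pi ^+ 2 / b ^+ 2 * c by rewrite ler_peMr // ltW.
apply/andP; split; first exact: lower t1 c2 xa0 tl.
by rewrite exprMn; exact: upper xa tu t4 t2 t3 c1 c2.
Qed.

Lemma jlt_energy_annulus : mean_curvature_energy F [set v | c < enorm v < 2 * c]
  @[c --> +oo] --> +oo%E.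
Proof.
have [k k0 hk] := jlt_energy_ge; have [K hK] := jlt_box_annulus.
apply/cvgeyPge => M; near=> c.
have c0 : 0 < c by near: c; exact: nbhs_pinfty_gt.
have Kc : K < c by near: c; apply: nbhs_pinfty_gt; rewrite num_real.
have Mc : (M / k) ^+ 2 <= c by near: c; apply: nbhs_pinfty_ge; rewrite num_real.
apply: (@le_trans _ _ (k * Num.sqrt c)%:E).
  rewrite lee_fin mulrC -ler_pdivrMr //; apply: le_trans (ler_norm _) _.
  by rewrite -sqrtr_sqr ler_sqrt // ltW.
apply: hk; first exact: sqrtr_ge0.
  by apply: measurable_jlt_annulus => //; rewrite mulr_gt0.
move=> [x y] [/=]; rewrite !in_itv /= => hx hy; rewrite /param_map /=.
by rewrite jlt_enorm_lt ?mulr_gt0 // jlt_enorm_gt //; exact: hK.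
Unshelve. all: by end_near. Qed.

Lemma jlt_energy_infinite : mean_curvature_energy F setT = +oo%E.
Proof.
have [k k0 hk] := jlt_energy_ge; apply/eqyP => M M0.
apply: (@le_trans _ _ (k * (M / k))%:E); first by rewrite mulrC divfK // gt_eqF.
by apply: hk; rewrite ?preimage_setT // divr_ge0 // ltW.
Qed.

End Area.

Theorem theorem5p1 (R : realType) :
  (forall a b : R, 0 < a -> 0 < b ->
     cvg (jlt_phi a b y @[y --> +oo]) /\ 0 < jlt_phibar a b < pi / 2) /\
  (exists J1 : 'M[R]_4,
     [/\ compatible_complex_structure J1,
         forall a b : R, 0 < a -> 0 < b ->
           cos_kahler_angle_ge J1 (jlt_map a b) (sin (jlt_phibar a b)) &
         forall eps : R, 0 < eps ->
           exists a b : R,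
             [/\ 0 < a, 0 < b,
                 translating_soliton (jlt_map a b) (jlt_vector b),
                 symplectic J1 (jlt_map a b) &
                 cos_kahler_angle_ge J1 (jlt_map a b) (1 - eps)]]) /\
  (forall a b : R, 0 < a -> 0 < b ->
     translating_soliton (jlt_map a b) (jlt_vector b) /\
     bounded_second_ff (jlt_map a b) /\
     has_genus (jlt_surface a b) 0 /\
     first_betti_number (jlt_surface a b) 0 /\
     quadratic_area_growth (jlt_map a b) /\
     (exists2 l : \bar R,
        mean_curvature_energy (jlt_map a b) [set v | r < enorm v < 2 * r]
          @[r --> +oo] --> l &
        (0 < l)%E) /\
     mean_curvature_energy (jlt_map a b) setT = +oo%E).
Proof.
split.
  move=> a b a0 b0; split; last by rewrite jlt_phibar_gt0 // jlt_phibar_lt.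
  by apply/cvg_ex; eexists; exact: jlt_phi_cvg.
split.
  exists (imvol_structure R); split; first exact: imvol_compatible.
    by move=> a b a0 b0; exact: jlt_cos_kahler_angle_ge.
  move=> eps /jlt_sin_phibar_near[b b0 hb]; exists 1, b; split=> //.
  - exact: jlt_translating_soliton.
  - exact: jlt_symplectic.
  - move=> x y E fE; apply: le_trans hb _.
    exact: (jlt_cos_kahler_angle_ge ltr01 b0 fE).
move=> a b a0 b0; split; first exact: jlt_translating_soliton.
split; first exact: jlt_bounded_second_ff.
split; first exact: jlt_genus.
split; first exact: jlt_first_betti.
split; first exact: jlt_quadratic_area_growth.
split; last exact: jlt_energy_infinite.
by exists +oo%E; [exact: jlt_energy_annulus | exact: lt0y].
Qed.
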